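(* Assume: (1a) for all $i,j,t$: $\mathbb{E}[\epsilon_{it}\mid\boldsymbol{\mu}_j]=\mathbb{E}[\epsilon_{it}]=0$; (1b) for all $s\neq t$: $\mathbb{E}[\eta_{it}\mid\mu_{js}]=0$; (1c) for all $s\neq t$: $(\overline{\epsilon}_{jt},\overline{\eta}_{jt})$ is independent of $(\overline{\epsilon}_{js},\overline{\eta}_{js})$; (2a) $\mathbb{E}(\ddot{\boldsymbol X}_j'\ddot{\boldsymbol X}_j)$ is finite and invertible; (2b) $0<\mathrm{Var}(\mu^*_{jt})<\infty$; (2c) $\mathbb{E}(\ddot{\boldsymbol X}_j'\ddot{\boldsymbol\mu}_j)=0$, $\mathbb{E}(\ddot{\boldsymbol X}_j'\ddot{\boldsymbol\epsilon}_j)=0$ and $\mathbb{E}(\ddot{\boldsymbol X}_j'\ddot{\boldsymbol\eta}_j)=0$; (5a) $\mathbb{E}(\boldsymbol D_j'\boldsymbol D_j)$ is finite and invertible; (5b) $\mathbb{E}(\boldsymbol D_j'\boldsymbol\epsilon_j)=0$; (6a) $(\boldsymbol\beta_0,\boldsymbol\alpha_0)$ is in the interior of $\boldsymbol\Theta_2$, a compact subset of $\mathbb{R}^{K+K_D}$; (6b) $\mathbb{E}\big(\sup_{\boldsymbol\Theta_2}\|m_1(\cdot)\|^2\big)<\infty$ and $\mathbb{E}\big(\sup_{\boldsymbol\Theta_2}\|m_4(\cdot)\|^2\big)<\infty$; (6c) $(\boldsymbol X_j,\boldsymbol\mu_j,\boldsymbol\epsilon_j,\boldsymbol D_j)$ are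 i.i.d. across $j$; (6d) for all $(\boldsymbol\beta,\boldsymbol\alpha)\in\mathbb{R}^{K+K_D}$, $\mathbb{E}(m_1m_1')$ and $\mathbb{E}(m_4m_4')$ are finite. Then, as $J\to\infty$ with $T$ and $n_j$ fixed, $\sqrt J(\widehat{\boldsymbol\alpha}-\boldsymbol\alpha_0)$ converges in distribution to $\mathcal N(0,V_1)$, where $V_1=\mathbb{E}(\boldsymbol D_j'\boldsymbol D_j)^{-1}\,\mathbb{E}(\Gamma\Gamma')\,\big(\mathbb{E}(\boldsymbol D_j'\boldsymbol D_j)^{-1}\big)'$ and $$\Gamma=\boldsymbol D_j'(\boldsymbol R_j-\boldsymbol D_j\boldsymbol\alpha_0)-\mathbb{E}(\boldsymbol D_j'\boldsymbol X_j)\,\mathbb{E}(\ddot{\boldsymbol X}_j'\ddot{\boldsymbol X}_j)^{-1}\ddot{\boldsymbol X}_j'(\ddot{\boldsymbol R}^{obs}_j-\ddot{\boldsymbol X}_j\boldsymbol\beta_0).$$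
   Context: Teachers are indexed by $j=1,\dots,J$, years by $t=1,\dots,T$ ($T\ge 2$ fixed). In each year teacher $j$ teaches a class of $n_j$ students ($n_j$ constant over time). For student $i$ matched to teacher $j$ in year $t$, the observed test score and observed adult earnings are $$R^{obs}_{it}=X_{it}'\boldsymbol\beta_0+\mu_{jt}+\epsilon_{it},\qquad Y^{obs}_i=X_{it}'\boldsymbol\beta_0^Y+\kappa_0\mu_{jt}+\eta_{it},$$ with $X_{it}\in\mathbb{R}^K$ observed covariates, $\mu_{jt}$ the unobserved value added of teacher $j$ in year $t$, $\epsilon_{it},\eta_{it}$ unobserved scalars, and fixed parameters $\boldsymbol\beta_0,\boldsymbol\beta_0^Y\in\mathbb{R}^K$, $\kappa_0\in\mathbb{R}$. Value added has mean $0$ and is stationary: its mean does not vary with $t$ and the correlation of $\mu_{jt}$ and $\mu_{js}$ depends only on $|s-t|$. For a student-level variable $H$, $\overline H_{jt}=\frac1{n_j}\sum_i H_{it}$ is the class average (for $\mu$, $\overline\mu_{jt}=\mu_{jt}$) and $\ddot H_{jt}=\overline H_{jt}-\frac1T\sum_t\overline H_{jt}$. $\boldsymbol H_j$ stacks $\overline H_{jt}$ over $t$ and $\ddot{\boldsymbol H}_j$ stacks $\ddot H_{jt}$ over $t$; thus $\boldsymbol X_j,\ddot{\boldsymbol X}_j$ are $T\times K$ and $\boldsymbol R_j^{obs},\boldsymbol\mu_j,\boldsymbol\epsilon_j,\boldsymbol\eta_j$ (and double-dot versions) are in $\mathbb{R}^T$. For $\boldsymbol\beta\in\mathbb{R}^K$,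 $\widetilde{\boldsymbol R}_j=\boldsymbol R_j^{obs}-\boldsymbol X_j\boldsymbol\beta$; at $\boldsymbol\beta=\boldsymbol\beta_0$ it is denoted $\boldsymbol R_j$, with entries $\overline R_{jt}=\mu_{jt}+\overline\epsilon_{jt}$. $\boldsymbol\phi_0\in\mathbb{R}^{T-1}$ is the (unique) vector, common to all $t$, that for every $t$ minimizes $\mathbb{E}\big[(\overline R_{jt}-\sum_{s\neq t}\phi_{|s-t|}\overline R_{js})^2\big]$, and $\mu^*_{jt}=\sum_{s\neq t}\phi_{0|s-t|}\overline R_{js}$. $D_{jt}\in\mathbb{R}^{K_D}$ is a vector of observed teacher-year variables; $\boldsymbol D_j$ is the $T\times K_D$ matrix with rows $D_{jt}'$. $\boldsymbol\alpha_0\in\mathbb{R}^{K_D}$ is the coefficient of the linear projection of $\mu_{jt}$ on $D_{jt}$: $\mu_{jt}=D_{jt}'\boldsymbol\alpha_0+\zeta_{jt}$, where $\zeta_{jt}$ is orthogonal to $D_{jt}$ by construction, so that $\mathbb{E}(\boldsymbol D_j'\boldsymbol\zeta_j)=0$ with $\boldsymbol\zeta_j$ stacking $\zeta_{jt}$ over $t$. Moment functions: $m_1=\ddot{\boldsymbol X}_j'(\ddot{\boldsymbol R}^{obs}_j-\ddot{\boldsymbol X}_j\boldsymbol\beta)$ and $m_4=\boldsymbol D_j'(\widetilde{\boldsymbol R}_j-\boldsymbol D_j\boldsymbol\alpha)$. $(\widehat{\boldsymbol\beta},\widehat{\boldsymbol\alpha})$ is the GMM estimator with identity weighting matrix: a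 minimizer over $\boldsymbol\Theta_2$ of the squared Euclidean norm of $\frac1J\sum_{j=1}^J(m_1',m_4')'$. Finiteness of matrices is entrywise. *)

(* Defs.v *)
From HB Require Import structures.
From mathcomp Require Export all_boot all_order all_algebra.
From mathcomp Require Export all_classical all_reals all_analysis.
Export Order.TTheory GRing.Theory Num.Theory.
Export numFieldNormedType.Exports.
Set Implicit Arguments.
Unset Strict Implicit.
Unset Printing Implicit Defensive.
Local Open Scope classical_set_scope.
Local Open Scope ring_scope.

Definition dotv (R : realType) (n : nat) (u v : 'cV[R]_n) : R :=
  (u^T *m v) 0 0.

Definition sqnorm (R : realType) (n : nat) (u : 'cV[R]_n) : R := dotv u u.

(* Matrices with their Borel sigma-algebra. *)
Notation borel_mx R m n := (g_sigma_algebraType (@open 'M[R]_(m, n))).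

Section Probability.
Context (d : measure_display) (Omega : measurableType d) (R : realType).
Variable P : probability Omega R.

Definition random_mx (m n : nat) (M : Omega -> 'M[R]_(m, n)) : Prop :=
  forall a b, measurable_fun [set: Omega] (fun w => M w a b).

Definition finite_mean (m n : nat) (M : Omega -> 'M[R]_(m, n)) : Prop :=
  forall a b, P.-integrable [set: Omega] (fun w => (M w a b)%:E).

(* Meaningful when [finite_mean M]. *)
Definition Emx (m n : nat) (M : Omega -> 'M[R]_(m, n)) : 'M[R]_(m, n) :=
  \matrix_(a, b) fine 'E_P[fun w => M w a b]%E.

Definition mean_zero (m n : nat) (M : Omega -> 'M[R]_(m, n)) : Prop :=
  finite_mean M /\ Emx M = 0.

Definition finite_invertible_mean (n : nat) (M : Omega -> 'M[R]_n) : Prop :=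
  finite_mean M /\ Emx M \in unitmx.

Definition correlation (U V : Omega -> R) : R :=
  fine (covariance P U V)
    / (Num.sqrt (fine 'V_P[U]%E) * Num.sqrt (fine 'V_P[V]%E)).

Section GeneralCodomain.
Context (d' : measure_display) (S : measurableType d').

(* Z is a version of E[Y | W], the conditional expectation of Y with respect
   to the sigma-algebra generated by W. *)
Definition is_cond_expectation (W : Omega -> S) (Y Z : Omega -> R) : Prop :=
  let sigmaW := preimage_set_system [set: Omega] W measurable in
  [/\ P.-integrable [set: Omega] (EFin \o Y),
      P.-integrable [set: Omega] (EFin \o Z),
      (forall B : set R, measurable B -> sigmaW (Z @^-1` B)) &
      (forall A, sigmaW A ->
         \int[P]_(w in A) (Z w)%:E = \int[P]_(w in A) (Y w)%:E)%E].

Definition independent_pair (U V : Omega -> S) : Prop :=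
  forall A B : set S, measurable A -> measurable B ->
    P (U @^-1` A `&` V @^-1` B) = (P (U @^-1` A) * P (V @^-1` B))%E.

Definition mutually_independent (W : nat -> Omega -> S) : Prop :=
  forall (s : seq nat) (B : nat -> set S), uniq s ->
    (forall j, measurable (B j)) ->
    P (\bigcap_(j in [set` s]) (W j @^-1` B j)) =
      (\prod_(j <- s) P (W j @^-1` B j))%E.

Definition identically_distributed (W : nat -> Omega -> S) : Prop :=
  forall (j k : nat) (B : set S), measurable B ->
    P (W j @^-1` B) = P (W k @^-1` B).

Definition iid (W : nat -> Omega -> S) : Prop :=
  mutually_independent W /\ identically_distributed W.

End GeneralCodomain.

Definition iid_mx (m n : nat) (W : nat -> Omega -> 'M[R]_(m, n)) : Prop :=
  @iid _ (borel_mx R m n) W.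

(* Conditioning on a random vector. *)
Definition is_cond_expectation_vec (m : nat) (W : Omega -> 'cV[R]_m)
    (Y Z : Omega -> R) : Prop :=
  @is_cond_expectation _ (borel_mx R m 1) W Y Z.

Definition cvg_in_law (m : nat) (Z : nat -> Omega -> 'cV[R]_m)
    (nu : probability (borel_mx R m 1) R) : Prop :=
  forall f : 'cV[R]_m -> R, continuous f ->
    (exists C : R, forall x, `|f x| <= C) ->
    ('E_P[fun w => f (Z J w)] @[J --> \oo] --> \int[nu]_x (f x)%:E)%E.

End Probability.

(* N(m, v), where v is the variance; [normal_prob] takes the standard
   deviation and is not a point mass when that is 0. *)
Definition normal_law (R : realType) (m v : R) (B : set R) : \bar R :=
  if 0 < v then normal_prob m (Num.sqrt v) B else \d_m B.

(* nu = N(m, V), possibly degenerate: every linear form a'x has law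
   N(a'm, a'Va). *)
Definition is_mvnormal (R : realType) (n : nat)
    (nu : probability (borel_mx R n 1) R) (m : 'cV[R]_n) (V : 'M[R]_n) : Prop :=
  forall (a : 'cV[R]_n) (B : set R), measurable B ->
    nu ((fun x : 'cV[R]_n => dotv a x) @^-1` B) =
      normal_law (dotv a m) (dotv a (V *m a)) B.

Definition cvg_in_law_normal (d : measure_display) (Omega : measurableType d)
    (R : realType) (P : probability Omega R) (n : nat)
    (Z : nat -> Omega -> 'cV[R]_n) (m : 'cV[R]_n) (V : 'M[R]_n) : Prop :=
  exists nu : probability (borel_mx R n 1) R,
    is_mvnormal nu m V /\ cvg_in_law P Z nu.

Section TeacherPanel.
Context (R : realType) (T : nat).

Definition class_avg (n : nat) (h : 'I_n -> R) : R := n%:R^-1 * \sum_i h i.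

Definition avg_col (n : nat) (h : 'I_T -> 'I_n -> R) : 'cV[R]_T :=
  \col_t class_avg (h t).

Definition avg_mx (n K : nat) (h : 'I_T -> 'I_n -> 'cV[R]_K) : 'M[R]_(T, K) :=
  \matrix_(t, k) class_avg (fun i => h t i k 0).

Definition rows_mx (K : nat) (h : 'I_T -> 'cV[R]_K) : 'M[R]_(T, K) :=
  \matrix_(t, k) h t k 0.

(* The double-dot operation: deviation from the average over years. *)
Definition ddot (K : nat) (M : 'M[R]_(T, K)) : 'M[R]_(T, K) :=
  \matrix_(t, k) (M t k - T%:R^-1 * \sum_s M s k).

(* Years are 0, ..., T-1; the lag between two distinct years lies in
   1, ..., T-1, and component l of phi is the coefficient of lag l+1. *)
Definition lag (s t : 'I_T) : nat := (maxn s t - minn s t)%N.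

Definition leave_out (phi : (T.-1).-tuple R) (r : 'cV[R]_T) (t : 'I_T) : R :=
  \sum_(s | s != t) phi`_(lag s t).-1 * r s 0.

Definition m1 (K : nat) (X : 'M[R]_(T, K)) (Robs : 'cV[R]_T)
    (beta : 'cV[R]_K) : 'cV[R]_K :=
  (ddot X)^T *m (ddot Robs - ddot X *m beta).

Definition m4 (K KD : nat) (X : 'M[R]_(T, K)) (Robs : 'cV[R]_T)
    (D : 'M[R]_(T, KD)) (beta : 'cV[R]_K) (alpha : 'cV[R]_KD) : 'cV[R]_KD :=
  D^T *m ((Robs - X *m beta) - D *m alpha).

Definition gmm_objective (K KD J : nat) (X : nat -> 'M[R]_(T, K))
    (Robs : nat -> 'cV[R]_T) (D : nat -> 'M[R]_(T, KD))
    (beta : 'cV[R]_K) (alpha : 'cV[R]_KD) : R :=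
  sqnorm (J%:R^-1 *: \sum_(j < J)
    col_mx (m1 (X j) (Robs j) beta) (m4 (X j) (Robs j) (D j) beta alpha)).

Section Predictor.
Context (d : measure_display) (Omega : measurableType d).
Variable P : probability Omega R.
Variable Rb : nat -> Omega -> 'cV[R]_T.

Definition mse (phi : (T.-1).-tuple R) (j : nat) (t : 'I_T) : \bar R :=
  expectation P (fun w => (Rb j w t 0 - leave_out phi (Rb j w) t) ^+ 2).

Definition minimizes_mse (phi : (T.-1).-tuple R) : Prop :=
  forall (j : nat) (t : 'I_T) (psi : (T.-1).-tuple R),
    (mse phi j t <= mse psi j t)%E.

Definition is_unique_mse_minimizer (phi : (T.-1).-tuple R) : Prop :=
  minimizes_mse phi /\ forall psi, minimizes_mse psi -> psi = phi.

End Predictor.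

End TeacherPanel.

(* Main.v *)
(* The moment conditions are linear in (beta, alpha) and just identified, so as soon as the sample averages
   of the double-dotted X'X and of D'D are invertible and the solution of the sample moment equations lies in
   Theta2, the minimizer solves them exactly: no uniform law of large numbers is needed. This happens with
   probability tending to one, and then the triangular system writes sqrt J (alphahat - alpha0) as
   E(D'D)^-1 times the normalized sum of the Gamma_j, up to an error tending to 0 in probability.
   For the normalized sum, the central limit theorem is proved for the functions cos (a.x + th): independence
   makes E exp (i t S_J) a product of J factors 1 - t^2 v / (2 J) + o(1 / J). Convergence in law follows
   because a continuous bounded function is uniformly close, on a large box, to a uniformly bounded
   trigonometric polynomial (Bernstein polynomials in the sines sin (x_i / L)), and the sequence is tight.
   The limit law N(0, V) is built as a linear image of independent normal variables by Schur complements. *)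
From HB Require Import structures.
Require Import Defs.
From mathcomp Require Import all_boot all_order all_algebra.
From mathcomp Require Import all_classical all_reals all_analysis.
From mathcomp Require Import measurable_realfun lebesgue_integral_under ring lra.
Set Implicit Arguments.
Unset Strict Implicit.
Local Open Scope classical_set_scope.
Local Open Scope ring_scope.

(** Everything stays real: cosines with a free phase replace complex exponentials. Shifting the
    phase by [pi / 2] gives the sine, so the addition formula closes on this one family, which
    serves the limit theorem, the trigonometric polynomials and the normal law alike. Independence
    is given on events only; it is carried to functions as mean independence from the later
    variables, which, unlike independence, is linear in the function and so survives the addition
    formula. Second moments suffice throughout: the laws of large numbers rest on Chebyshev's
    inequality, and the Taylor remainders are dominated by squares. The second moments of the blocks
    multiplying the parameters come from those of the moment functions at every parameter: the
    difference of two values isolates one block applied to an arbitrary vector. The error analysis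
    of the linear system is deterministic, off an exceptional event and with constants free of J.
    Its bounds hold for the system scaled by sqrt J, which gives both the feasibility of the exact
    solution and the asymptotic linearity of the estimator. *)

Notation mean P X := (Rintegral P setT X).
Notation integrable_rv P X := (P.-integrable [set: _] (EFin \o X)).

(** * Means of random variables *)

Section Trigonometric.
Context (d : measure_display) (Omega : measurableType d) (R : realType).
Implicit Types X : Omega -> R.

Lemma measurable_cos X : measurable_fun setT X -> measurable_fun setT (fun w => cos (X w)).
Proof.
move=> mX; apply: (measurableT_comp (f := @cos R)) => //.
apply: continuous_measurable_fun; exact: continuous_cos.
Qed.

Lemma measurable_sin X : measurable_fun setT X -> measurable_fun setT (fun w => sin (X w)).
Proof.
move=> mX; apply: (measurableT_comp (f := @sin R)) => //.
apply: continuous_measurable_fun; exact: continuous_sin.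
Qed.

End Trigonometric.

Section Mean.
Context (d : measure_display) (Omega : measurableType d) (R : realType).
Variable P : probability Omega R.
Implicit Types X Y : Omega -> R.

Lemma bounded_integrable X (C : R) : measurable_fun setT X ->
  (forall w, `|X w| <= C) -> integrable_rv P X.
Proof.
move=> mX bX; apply: measurable_bounded_integrable => //.
  by rewrite (le_lt_trans (probability_le1 _ _)) ?ltry.
exists C; split; first exact: num_real.
by move=> M CM w _ /=; rewrite (le_trans (bX w)) ?ltW.
Qed.

Lemma integrable_rv_measurable X : integrable_rv P X -> measurable_fun setT X.
Proof. by move=> /measurable_int /measurable_EFinP. Qed.

Lemma le_integrable_rv X Y : measurable_fun setT X ->
  (forall w, `|X w| <= Y w) -> integrable_rv P Y -> integrable_rv P X.
Proof.
move=> mX XY iY; apply: (le_integrable _ _ _ iY) => //; first exact/measurable_EFinP.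
by move=> w _ /=; rewrite lee_fin (le_trans (XY w)) ?ler_norm.
Qed.

Lemma integrable_rvD X Y : integrable_rv P X -> integrable_rv P Y ->
  integrable_rv P (fun w => X w + Y w).
Proof. by move=> iX iY; apply: (integrableD _ iX iY). Qed.

Lemma integrable_rvB X Y : integrable_rv P X -> integrable_rv P Y ->
  integrable_rv P (fun w => X w - Y w).
Proof. by move=> iX iY; apply: (integrableB _ iX iY). Qed.

Lemma integrable_rvZ X (k : R) : integrable_rv P X ->
  integrable_rv P (fun w => k * X w).
Proof. by move=> iX; apply: (integrableZl _ k iX). Qed.

Lemma integrable_rv_sum (I : Type) (s : seq I) (Q : pred I) (X : I -> Omega -> R) :
  (forall i, Q i -> integrable_rv P (X i)) ->
  integrable_rv P (fun w => \sum_(i <- s | Q i) X i w).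
Proof.
move=> iX; have := integrable_sum measurableT s iX.
by apply: eq_integrable => // w _ /=; rewrite sumEFin.
Qed.

Lemma integrable_rv_cst (k : R) : integrable_rv P (fun=> k).
Proof. exact: (bounded_integrable (C := `|k|)). Qed.

Lemma mean_cst (k : R) : mean P (fun=> k) = k.
Proof. by rewrite Rintegral_cst// [X in fine X]probability_setT mulr1. Qed.

Lemma meanD X Y : integrable_rv P X -> integrable_rv P Y ->
  mean P (fun w => X w + Y w) = mean P X + mean P Y.
Proof. by move=> iX iY; rewrite RintegralD. Qed.

Lemma meanB X Y : integrable_rv P X -> integrable_rv P Y ->
  mean P (fun w => X w - Y w) = mean P X - mean P Y.
Proof. by move=> iX iY; rewrite RintegralB. Qed.

Lemma meanZ X (k : R) : integrable_rv P X ->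
  mean P (fun w => k * X w) = k * mean P X.
Proof. by move=> iX; rewrite RintegralZl. Qed.

Lemma mean_sum (I : Type) (s : seq I) (Q : pred I) (X : I -> Omega -> R) :
  (forall i, Q i -> integrable_rv P (X i)) ->
  mean P (fun w => \sum_(i <- s | Q i) X i w) = \sum_(i <- s | Q i) mean P (X i).
Proof.
move=> iX; elim: s => [|i s IH].
  rewrite big_nil; under eq_Rintegral do rewrite big_nil; exact: mean_cst.
rewrite big_cons; under eq_Rintegral do rewrite big_cons.
case: ifP => // Qi; rewrite meanD ?IH//; first exact: iX.
exact: integrable_rv_sum.
Qed.

Lemma le_mean X Y : integrable_rv P X -> integrable_rv P Y ->
  (forall w, X w <= Y w) -> mean P X <= mean P Y.
Proof. by move=> iX iY XY; apply: le_Rintegral. Qed.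

Lemma le_norm_mean X Y : integrable_rv P X -> integrable_rv P Y ->
  (forall w, `|X w| <= Y w) -> `|mean P X| <= mean P Y.
Proof.
move=> iX iY XY; apply: (le_trans (le_normr_Rintegral _ _)) => //.
by apply: le_mean => //; apply: integrable_norm.
Qed.

Lemma mean_indic (A : set Omega) : measurable A -> mean P \1_A = fine (P A).
Proof. by move=> mA; rewrite /Rintegral integral_indic// setIT. Qed.

Lemma bounded_mean X (C : R) : measurable_fun setT X ->
  (forall w, `|X w| <= C) -> `|mean P X| <= C.
Proof.
move=> mX bX; rewrite -[leRHS]mean_cst; apply: le_norm_mean => //.
  exact: bounded_integrable bX.
exact: integrable_rv_cst.
Qed.

Lemma meanE X : mean P X = fine ('E_P[X])%E.
Proof. by rewrite unlock. Qed.

Lemma integrable_meanE X : integrable_rv P X -> ('E_P[X] = (mean P X)%:E)%E.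
Proof. by move=> iX; rewrite unlock fineK// integrable_fin_num. Qed.

Lemma integrable_sq_integrable X : measurable_fun setT X ->
  integrable_rv P (fun w => X w ^+ 2) -> integrable_rv P X.
Proof.
move=> mX iX2; apply: (@le_integrable_rv X (fun w => 1 + X w ^+ 2)) => //.
  move=> w; rewrite -(real_normK (num_real (X w))).
  have := sqr_ge0 (`|X w| - 1); have := normr_ge0 (X w); nra.
by apply: integrable_rvD => //; exact: integrable_rv_cst.
Qed.

Lemma integrable_sq_prod X Y : measurable_fun setT X -> measurable_fun setT Y ->
  integrable_rv P (fun w => X w ^+ 2) -> integrable_rv P (fun w => Y w ^+ 2) ->
  integrable_rv P (fun w => X w * Y w).
Proof.
move=> mX mY iX iY.
apply: (@le_integrable_rv _ (fun w => X w ^+ 2 + Y w ^+ 2)).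
- exact: measurable_funM.
- move=> w; rewrite normrM -(real_normK (num_real (X w))) -(real_normK (num_real (Y w))).
  have := sqr_ge0 (`|X w| - `|Y w|); have := mulr_ge0 (normr_ge0 (X w)) (normr_ge0 (Y w)).
  nra.
- exact: integrable_rvD.
Qed.

Lemma integrable_sqD X Y : measurable_fun setT X -> measurable_fun setT Y ->
  integrable_rv P (fun w => X w ^+ 2) -> integrable_rv P (fun w => Y w ^+ 2) ->
  integrable_rv P (fun w => (X w + Y w) ^+ 2).
Proof.
move=> mX mY iX iY.
rewrite (_ : (fun w => _) = (fun w => X w ^+ 2 + (2 * (X w * Y w)) + Y w ^+ 2)).
  by apply: integrable_rvD => //; apply: integrable_rvD => //;
    apply: integrable_rvZ; exact: integrable_sq_prod.
by apply/funext => w; ring.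
Qed.

Lemma integrable_sqZ X (k : R) :
  integrable_rv P (fun w => X w ^+ 2) ->
  integrable_rv P (fun w => (k * X w) ^+ 2).
Proof.
move=> iX; rewrite (_ : (fun w => _) = (fun w => k ^+ 2 * X w ^+ 2)).
  exact: integrable_rvZ.
by apply/funext => w; rewrite exprMn.
Qed.

Lemma integrable_sq_sum (I : Type) (s : seq I) (X : I -> Omega -> R) :
  (forall i, measurable_fun setT (X i)) ->
  (forall i, integrable_rv P (fun w => X i w ^+ 2)) ->
  integrable_rv P (fun w => (\sum_(i <- s) X i w) ^+ 2).
Proof.
move=> mX iX; elim: s => [|i s IH].
  rewrite (_ : (fun w => _) = fun=> 0); first exact: integrable_rv_cst.
  by apply/funext => w; rewrite big_nil expr0n.
rewrite (_ : (fun w => _) = (fun w => (X i w + \sum_(i <- s) X i w) ^+ 2)).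
  by apply: integrable_sqD => //; apply: measurable_sum.
by apply/funext => w; rewrite big_cons.
Qed.

Lemma markov_sq X (c : R) : 0 < c -> measurable_fun setT X ->
  integrable_rv P (fun w => X w ^+ 2) ->
  (P [set w | (c <= `|X w|)%R] <= (mean P (fun w => X w ^+ 2) / c ^+ 2)%:E)%E.
Proof.
move=> c0 mX iX; set A := [set w | _].
have mA : measurable A.
  rewrite (_ : A = (fun w => `|X w|) @^-1` `[c, +oo[).
    by rewrite -[X in measurable X]setTI; apply: (measurableT_comp _ mX).
  by apply/seteqP; split => w /=; rewrite in_itv/= andbT.
rewrite -[leLHS]fineK ?fin_num_measure// lee_fin -mean_indic//.
rewrite ler_pdivlMr ?exprn_gt0// mulrC -meanZ; last first.
  apply: (bounded_integrable (C := 1)) => //.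
  by move=> w; rewrite indicE; case: (_ \in _); rewrite ?normr1 ?normr0.
apply: le_mean => //.
  apply: (bounded_integrable (C := c^+2)) => //.
    exact: measurable_funM.
  by move=> w; rewrite indicE normrM (ger0_norm (sqr_ge0 _));
    case: (_ \in _); rewrite ?normr1 ?normr0 ?mulr1 ?mulr0 ?sqr_ge0.
move=> w; rewrite indicE; case: (boolP (w \in A)) => [|_]; last by rewrite mulr0 sqr_ge0.
rewrite inE/A/= mulr1 -(real_normK (num_real (X w))) => cX.
by rewrite lerXn2r// nnegrE (le_trans (ltW c0)).
Qed.

Lemma dominated_mean (X_ : nat -> Omega -> R) X Y :
  (forall n, measurable_fun setT (X_ n)) ->
  (forall w, X_ n w @[n --> \oo] --> X w) ->
  integrable_rv P Y -> (forall n w, `|X_ n w| <= Y w) ->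
  mean P (X_ n) @[n --> \oo] --> mean P X.
Proof.
move=> mX cX iY bX.
have iX_ n : integrable_rv P (X_ n) by apply: le_integrable_rv (bX n) _.
have mX' : measurable_fun setT X.
  by apply: (measurable_fun_cvg mX) => w _; exact: cX.
have iX : integrable_rv P X.
  apply: le_integrable_rv iY => // w.
  have cn : `|X_ n w| @[n --> \oo] --> `|X w| by apply: cvg_norm; exact: cX.
  rewrite -(cvg_lim _ cn)//; apply: limr_le; first by apply/cvg_ex; eexists; exact: cn.
  by apply: nearW => n; exact: bX.
apply: fine_cvg; rewrite fineK ?integrable_fin_num//.
apply: (@dominated_cvg _ _ _ P setT measurableT (fun n w => (X_ n w)%:E) _ (EFin \o Y)) => //=.
- by move=> n; exact/measurable_EFinP.
- by move=> w _; apply: cvg_EFin; [exact: nearW|exact: cX].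
- by move=> n w _; rewrite lee_fin.
Qed.

End Mean.

Arguments bounded_integrable {d Omega R P X C}.
Arguments integrable_rv_cst {d Omega R P} k.

(** * From independence of events to products of means *)

Section Independence.
Context (d : measure_display) (Omega : measurableType d) (R : realType).
Variable P : probability Omega R.
Implicit Types X Y H V : Omega -> R.

Lemma sum_ler_nat (M k : nat) : (\sum_(i < M) (i < k) = minn M k)%N.
Proof.
elim: M => [|M IH]; first by rewrite big_ord0 min0n.
rewrite big_ord_recr/= IH; case: (ltnP M k) => Mk /=.
  by rewrite addn1; apply/esym/minn_idPl.
by rewrite addn0; apply/esym/minn_idPr; exact: leqW.
Qed.

(* The layers {V >= (i + 1) / N} count the integer part of N V. *)
Lemma layer_cake_approx (v : R) (M N : nat) : (0 < N)%N -> 0 <= v -> N%:R * v <= M%:R ->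
  `|v - N%:R^-1 * \sum_(i < M) (\1_(`[i.+1%:R / N%:R, +oo[%classic) v : R)| <= N%:R^-1.
Proof.
move=> N0 v0 vM.
have N0' : 0 < (N%:R : R) by rewrite ltr0n.
have -> : \sum_(i < M) (\1_(`[i.+1%:R / N%:R, +oo[%classic) v : R)
    = (Num.truncn (N%:R * v))%:R.
  (* The bound on [N%:R * v] ensures that no layer reached by [v] lies beyond the first [M]. *)
  have /minn_idPr <- : (Num.truncn (N%:R * v) <= M)%N.
    by rewrite -[leqRHS](natrK (R := R)); apply: le_truncn.
  rewrite -sum_ler_nat natr_sum; apply: eq_bigr => i _.
  rewrite indicE.
  congr ((nat_of_bool _)%:R); rewrite truncn_gt_nat [N%:R * v]mulrC -ler_pdivrMr//.
  by apply/idP/idP => [/set_mem/=|h]; [|apply/mem_set => /=]; rewrite in_itv/= andbT.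
have /truncn_itv/andP[h1 h2] : 0 <= N%:R * v by rewrite mulr_ge0.
rewrite -(ler_pM2l N0') -{1}(gtr0_norm N0') -normrM mulrBr mulrA divff ?gt_eqF// mul1r.
by rewrite ger0_norm ?subr_ge0// lerBlDl natr1 ltW.
Qed.

(** Layers of thickness [1 / N] approximate [V] uniformly by a combination of indicators, for which
    the factorization is assumed. It extends by linearity, and replacing [V] on both sides costs at
    most [C / N] each. *)
Lemma mean_indep_nonneg H V (C D : R) :
  measurable_fun setT H -> (forall w, `|H w| <= C) ->
  measurable_fun setT V -> (forall w, 0 <= V w <= D) ->
  (forall B : set R, measurable B ->
     mean P (fun w => H w * \1_B (V w)) = mean P H * mean P (fun w => \1_B (V w))) ->
  mean P (fun w => H w * V w) = mean P H * mean P V.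
Proof.
move=> mH bH mV bV HV.
have mVB B : measurable B -> measurable_fun setT (fun w => \1_B (V w) : R).
  by move=> mB; apply: (measurableT_comp (f := (\1_B : R -> R))) => //; exact: measurable_indic.
have bVB (B : set R) w : `|\1_B (V w) : R| <= 1.
  by rewrite indicE; case: (_ \in _); rewrite ?normr1 ?normr0.
have iH : integrable_rv P H by exact: bounded_integrable bH.
have C0 : 0 <= C.
  (* A space of total mass 1 has a point, where the bound on [H] forces [C] to be nonnegative. *)
  have [w _] : [set: Omega] !=set0.
    apply/set0P/eqP => T0; have := probability_setT P.
    by rewrite T0 measure0 => /eqP; rewrite eq_sym onee_eq0.
  exact: le_trans (bH w).
have D0 : 0 <= D.
  have [w _] : [set: Omega] !=set0.
    apply/set0P/eqP => T0; have := probability_setT P.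
    by rewrite T0 measure0 => /eqP; rewrite eq_sym onee_eq0.
  by have /andP[/le_trans] := bV w; apply.
have iV : integrable_rv P V.
  apply: (bounded_integrable (C := D)) => // w.
  by have /andP[? ?] := bV w; rewrite ger0_norm.
have iHV : integrable_rv P (fun w => H w * V w).
  apply: (bounded_integrable (C := C * D)); first exact: measurable_funM.
  move=> w; rewrite normrM ler_pM//.
  by have /andP[? ?] := bV w; rewrite ger0_norm.
apply/eqP; rewrite -subr_eq0 -normr_le0; apply/ler_addgt0Pl => e e0; rewrite addr0.
(* This [N] makes the total error [(C + C) / N] at most [e]. *)
pose N := (Num.truncn ((C + C) / e)).+1.
have N0 : 0 < (N%:R : R) by rewrite ltr0n.
have [M VM] : exists M : nat, forall w, N%:R * V w <= M%:R.
  exists (Num.truncn (N%:R * D)).+1 => w.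
  have /andP[V0 VD] := bV w.
  apply: (le_trans (ler_wpM2l (ltW N0) VD)).
  by apply/ltW/truncnS_gt.
pose L i w : R := \1_(`[i.+1%:R / N%:R, +oo[%classic) (V w).
have iL (i : nat) : integrable_rv P (L i).
  apply: (bounded_integrable (C := 1)) => //; [exact: mVB|by move=> w; exact: bVB].
have iHL (i : nat) : integrable_rv P (fun w => H w * L i w).
  apply: (bounded_integrable (C := C * 1)); last by move=> w; rewrite normrM ler_pM// bVB.
  by apply: measurable_funM => //; exact: mVB.
pose VN w := N%:R^-1 * \sum_(i < M) L i w.
have iVN : integrable_rv P VN by apply: integrable_rvZ; apply: integrable_rv_sum.
have HVNE w : H w * VN w = N%:R^-1 * \sum_(i < M) H w * L i w.
  by rewrite /VN mulrCA mulr_sumr.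
have iHVN : integrable_rv P (fun w => H w * VN w).
  rewrite (_ : (fun w => _) = (fun w => N%:R^-1 * \sum_(i < M) H w * L i w)); last exact/funext.
  by apply: integrable_rvZ; apply: integrable_rv_sum.
have E1 : mean P (fun w => H w * VN w) = mean P H * mean P VN.
  rewrite (_ : (fun w => _) = (fun w => N%:R^-1 * \sum_(i < M) H w * L i w)); last exact/funext.
  rewrite meanZ; last by apply: integrable_rv_sum.
  rewrite mean_sum// meanZ; last by apply: integrable_rv_sum.
  rewrite mean_sum// mulrCA; congr (_ * _); rewrite mulr_sumr.
  by apply: eq_bigr => i _; rewrite HV.
have VVN w : `|V w - VN w| <= N%:R^-1.
  by have /andP[? ?] := bV w; apply: layer_cake_approx.
have -> : mean P (fun w => H w * V w) - mean P H * mean P V =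
   mean P (fun w => H w * V w - H w * VN w) - mean P H * mean P (fun w => V w - VN w).
  by rewrite !meanB// E1; ring.
apply: (@le_trans _ _ (C * N%:R^-1 + C * N%:R^-1)).
  apply: (le_trans (ler_normB _ _)); apply: lerD.
    apply: bounded_mean.
      apply: measurable_funB; first exact: measurable_funM.
      exact: integrable_rv_measurable iHVN.
    by move=> w; rewrite -mulrBr normrM ler_pM.
  rewrite normrM ler_pM//; first exact: bounded_mean.
  apply: bounded_mean => //; apply: measurable_funB => //.
  exact: integrable_rv_measurable iVN.
rewrite -mulrDl ler_pdivrMr// mulrC -ler_pdivrMr//.
by apply/ltW/truncnS_gt.
Qed.

(** Adding the constant [D] makes [V] nonnegative, and an indicator of the shifted variable is the
    indicator of a shifted set. *)
Lemma mean_indep_bounded H V (C D : R) :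
  measurable_fun setT H -> (forall w, `|H w| <= C) ->
  measurable_fun setT V -> (forall w, `|V w| <= D) ->
  (forall B : set R, measurable B ->
     mean P (fun w => H w * \1_B (V w)) = mean P H * mean P (fun w => \1_B (V w))) ->
  mean P (fun w => H w * V w) = mean P H * mean P V.
Proof.
move=> mH bH mV bV HV.
have iH : integrable_rv P H by exact: bounded_integrable bH.
have iV : integrable_rv P V by exact: bounded_integrable bV.
have iHV : integrable_rv P (fun w => H w * V w).
  apply: (bounded_integrable (C := C * D)); first exact: measurable_funM.
  by move=> w; rewrite normrM ler_pM.
have := @mean_indep_nonneg H (fun w => V w + D) C (D + D) mH bH.
have -> : (fun w => H w * (V w + D)) = (fun w => H w * V w + D * H w).
  by apply/funext => w; ring.
rewrite (meanD iHV (integrable_rvZ D iH)) meanZ//.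
rewrite (meanD iV (integrable_rv_cst D)) mean_cst mulrDr [D * _]mulrC => h; apply/(addIr (mean P H * D))/h.
- by apply: measurable_funD.
- by move=> w; have := bV w; rewrite ler_norml => /andP[? ?]; apply/andP; split; lra.
- move=> B mB; have := HV ((fun x => x + D) @^-1` B) _; apply.
  rewrite -[X in measurable X]setTI.
  have : measurable_fun setT (fun x : R => x + D) by apply: measurable_funD.
  by apply.
Qed.

End Independence.

(** * The central limit theorem for cosines *)

Section CharacteristicFunctionCLT.
Context (d : measure_display) (Omega : measurableType d) (R : realType).
Context (d' : measure_display) (S : measurableType d').
Variables (P : probability Omega R) (W : nat -> Omega -> S).
Hypothesis mW : forall j, measurable_fun setT (W j).
Hypothesis indepW : mutually_independent P W.

Definition joint_event (B : nat -> set S) (s : seq nat) (w : Omega) : R :=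
  \prod_(j <- s) \1_(B j) (W j w).

(** Mean independence of [H] from [W k, W k.+1, ...], tested on finite cylinder events. The
    condition is linear in [H], so sums stay in the class; the bound on [H] makes all products
    integrable. *)
Definition indep_of_future (k : nat) (H : Omega -> R) : Prop :=
  [/\ measurable_fun setT H, (exists C, forall w, `|H w| <= C) &
   forall (s : seq nat) (B : nat -> set S), uniq s -> all (fun j => k <= j)%N s ->
     (forall j, measurable (B j)) ->
     mean P (fun w => H w * joint_event B s w) =
       mean P H * \prod_(j <- s) fine (P (W j @^-1` B j))].

Let mpre j B : measurable B -> measurable (W j @^-1` B).
Proof. by move=> mB; rewrite -[X in measurable X]setTI; exact: mW. Qed.

Lemma joint_eventE B s w : joint_event B s w = \1_(\bigcap_(j in [set` s]) (W j @^-1` B j)) w.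
Proof.
rewrite /joint_event; elim: s => [|j s IH].
  rewrite big_nil indicE mem_set//.
rewrite big_cons IH !indicE -natrM mulnb; congr ((nat_of_bool _)%:R).
apply/andP/idP => [[/set_mem h1 /set_mem h2]|/set_mem h].
  apply/mem_set => i /=; rewrite inE => /predU1P[->//|]; exact: h2.
split; apply/mem_set; first by apply: h; rewrite /= inE eqxx.
by move=> i /= si; apply: h; rewrite /= inE si orbT.
Qed.

Lemma mjoint_event B s : (forall j, measurable (B j)) ->
  measurable_fun setT (joint_event B s).
Proof.
move=> mB; rewrite (_ : joint_event B s = \1_(\bigcap_(j in [set` s]) (W j @^-1` B j))).
  by apply: measurable_indic; apply: bigcap_measurableType => // j _; exact: mpre.
by apply/funext => w; rewrite joint_eventE.
Qed.

Lemma bjoint_event B s w : `|joint_event B s w| <= 1.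
Proof. by rewrite joint_eventE indicE; case: (_ \in _); rewrite ?normr1 ?normr0. Qed.

(** Mutual independence of the [W j] enters through this starting point of the recursion: the
    probability of a cylinder event is a product. *)
Lemma indep_of_future_cst c : indep_of_future 0 (fun=> c).
Proof.
split=> //; first by exists `|c|.
move=> s B us _ mB.
rewrite mean_cst meanZ; last first.
  by apply: (bounded_integrable (C := 1)); [exact: mjoint_event|exact: bjoint_event].
congr (_ * _).
rewrite (_ : joint_event B s = \1_(\bigcap_(j in [set` s]) (W j @^-1` B j))); last first.
  by apply/funext => w; rewrite joint_eventE.
rewrite mean_indic; last by apply: bigcap_measurableType => // j _; exact: mpre.
rewrite indepW//; elim: s {us} => [|j s IH]; first by rewrite !big_nil.
rewrite !big_cons fineM ?IH ?fin_num_measure//; first exact: mpre.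
by rewrite prode_fin_num// => i _; rewrite fin_num_measure//; exact: mpre.
Qed.

Lemma indep_of_futureS k H : indep_of_future k H -> indep_of_future k.+1 H.
Proof.
move=> [mH bH HH]; split => // s B us ks mB; apply: HH => //.
by apply: sub_all ks => j; exact: ltnW.
Qed.

Lemma indep_of_futureD k H H' : indep_of_future k H -> indep_of_future k H' ->
  indep_of_future k (fun w => H w + H' w).
Proof.
move=> [mH [C bH] HH] [mH' [C' bH'] HH']; split.
- exact: measurable_funD.
- by exists (C + C') => w; apply: (le_trans (ler_normD _ _)); apply: lerD.
- move=> s B us ks mB.
  have iH : integrable_rv P H by exact: bounded_integrable bH.
  have iH' : integrable_rv P H' by exact: bounded_integrable bH'.
  have iB (G : Omega -> R) K : measurable_fun setT G -> (forall w, `|G w| <= K) ->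
      integrable_rv P (fun w => G w * joint_event B s w).
    move=> mG bG; apply: (bounded_integrable (C := K * 1)).
      by apply: measurable_funM => //; exact: mjoint_event.
    by move=> w; rewrite normrM ler_pM// bjoint_event.
  rewrite (meanD iH iH') mulrDl -HH// -HH'//.
  rewrite -(meanD (iB _ _ mH bH) (iB _ _ mH' bH')).
  by congr (mean P _); apply/funext => w; rewrite mulrDl.
Qed.

Lemma indep_of_futureN k H : indep_of_future k H -> indep_of_future k (fun w => - H w).
Proof.
move=> [mH [C bH] HH]; split.
- exact: measurableT_comp.
- by exists C => w; rewrite normrN.
- move=> s B us ks mB.
  have iH : integrable_rv P H by exact: bounded_integrable bH.
  have iB : integrable_rv P (fun w => H w * joint_event B s w).
    apply: (bounded_integrable (C := C * 1)).
      by apply: measurable_funM => //; exact: mjoint_event.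
    by move=> w; rewrite normrM ler_pM// bjoint_event.
  have -> : (fun w => - H w) = (fun w => -1 * H w) by apply/funext => w; rewrite mulN1r.
  rewrite (meanZ _ iH) -mulrA -HH// -(meanZ _ iB).
  by congr (mean P _); apply/funext => w; rewrite !mulN1r mulNr.
Qed.

(** For an indicator in place of [g], the constraint on [W k] joins the cylinder event as one more
    coordinate, which the hypothesis at level [k] allows. [mean_indep_bounded] extends this to
    bounded [g], and the empty cylinder gives the product of means. *)
Lemma indep_of_future_mul k H (g : S -> R) (D : R) : indep_of_future k H ->
  measurable_fun setT g -> (forall x, `|g x| <= D) ->
  indep_of_future k.+1 (fun w => H w * g (W k w)) /\
  mean P (fun w => H w * g (W k w)) = mean P H * mean P (fun w => g (W k w)).
Proof.
move=> [mH [C bH] HH] mg bg.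
have mgW : measurable_fun setT (fun w => g (W k w)) by apply: (measurableT_comp mg).
have key s B : uniq s -> all (fun j => k.+1 <= j)%N s -> (forall j, measurable (B j)) ->
     mean P (fun w => H w * g (W k w) * joint_event B s w) =
       mean P H * mean P (fun w => g (W k w)) * \prod_(j <- s) fine (P (W j @^-1` B j)).
  move=> us ks mB.
  have E0 : mean P (fun w => H w * joint_event B s w) =
       mean P H * \prod_(j <- s) fine (P (W j @^-1` B j)).
    by apply: HH => //; apply: sub_all ks => j; exact: ltnW.
  transitivity (mean P (fun w => H w * joint_event B s w * g (W k w))).
    by congr (mean P _); apply/funext => w; rewrite mulrAC.
  rewrite (@mean_indep_bounded _ _ _ _ _ _ (C * 1) D).
  - by rewrite E0 mulrAC.
  - by apply: measurable_funM => //; exact: mjoint_event.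
  - by move=> w; rewrite normrM ler_pM// bjoint_event.
  - exact: mgW.
  - by move=> w; exact: bg.
  move=> B' mB'.
  have mgB' : measurable (g @^-1` B') by rewrite -[X in measurable X]setTI; exact: mg.
  (* The index [k] is absent from [s], whose members are at least [k.+1], so its slot is free for
     the constraint on [g (W k w)]. *)
  pose BB j := if j == k then g @^-1` B' else B j.
  have kns : k \notin s by apply/negP => /(allP ks); rewrite ltnn.
  have mBB j : measurable (BB j) by rewrite /BB; case: ifP.
  have BBs j : j \in s -> BB j = B j.
    by move=> js; rewrite /BB; case: eqP => // jk; rewrite -jk js in kns.
  have -> : mean P (fun w => \1_B' (g (W k w))) = fine (P (W k @^-1` BB k)).
    rewrite -mean_indic; last exact: mpre.
    by congr (mean P _); apply/funext => w; rewrite /BB eqxx.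
  rewrite E0 -mulrA [_ * fine _]mulrC.
  have -> : fine (P (W k @^-1` BB k)) * (\prod_(j <- s) fine (P (W j @^-1` B j))) =
     \prod_(j <- k :: s) fine (P (W j @^-1` BB j)).
    by rewrite big_cons; congr (_ * _); apply: eq_big_seq => j js; rewrite BBs.
  rewrite -HH//=; last 2 first.
  - by rewrite kns.
  - by rewrite leqnn/=; apply: sub_all ks => j; exact: ltnW.
  congr (mean P _); apply/funext => w; rewrite /joint_event big_cons [in X in _ = _ * (X * _)]/BB eqxx -mulrA; congr (_ * _).
  by rewrite mulrC; congr (_ * _); apply: eq_big_seq => j js; rewrite BBs.
have E : mean P (fun w => H w * g (W k w)) = mean P H * mean P (fun w => g (W k w)).
  have := key [::] (fun=> set0) isT isT (fun=> measurable0).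
  rewrite big_nil mulr1 => <-; congr (mean P _); apply/funext => w.
  by rewrite /joint_event big_nil mulr1.
split=> //; split.
- exact: measurable_funM.
- by exists (C * D) => w; rewrite normrM ler_pM.
- by move=> s B us ks mB; rewrite key// E.
Qed.

End CharacteristicFunctionCLT.

(** * Taylor bounds for sine and cosine *)

Section Taylor.
Variable R : realType.
Implicit Types x : R.

(** Each Taylor bound below is the derivative condition for the next one, so the degree rises by one
    at each application. *)
Lemma ge0_derive_ge0 (f df : R -> R) : (forall x, is_derive x 1 f (df x)) ->
  (forall x, 0 <= x -> 0 <= df x) -> 0 <= f 0 -> forall x, 0 <= x -> 0 <= f x.
Proof.
move=> dfE df0 f0 x; rewrite le_eqVlt => /predU1P[<-//|x0].
have [c] := @MVT R f df 0 x x0 (fun y _ => dfE y) (derivable_within_continuous (fun y _ => @ex_derive _ _ _ _ _ _ _ (dfE y))).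
rewrite in_itv/= => /andP[c0 _] E.
by rewrite -(subrK (f 0) (f x)) E addr_ge0// mulr_ge0 ?subr_ge0 ?(ltW x0)// df0 ?(ltW c0).
Qed.

Lemma sin_le_id x : 0 <= x -> sin x <= x.
Proof.
move=> x0; rewrite -subr_ge0.
apply: (@ge0_derive_ge0 (fun x => x - sin x) (fun x => 1 - cos x)).
- by move=> y _; rewrite subr_ge0 cos_le1.
- by rewrite sin0 subr0.
- by [].
Qed.

Lemma cos_ge_taylor2 x : 1 - x ^+ 2 / 2 <= cos x.
Proof.
wlog x0 : x / 0 <= x.
  by move=> H; have [/H//|/ltW] := lerP 0 x; rewrite -oppr_ge0 -cosN -sqrrN => /H.
rewrite -subr_ge0.
apply: (@ge0_derive_ge0 (fun x => cos x - (1 - x ^+ 2 / 2)) (fun x => x - sin x)) => //.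
- by move=> y; apply: is_derive_eq; rewrite /GRing.scale/=; field.
- by move=> y; rewrite subr_ge0; exact: sin_le_id.
- by rewrite cos0 expr0n/= mul0r subr0 subrr.
Qed.

Lemma sin_ge_taylor3 x : 0 <= x -> x - x ^+ 3 / 6 <= sin x.
Proof.
move=> x0; rewrite -subr_ge0.
apply: (@ge0_derive_ge0 (fun x => sin x - (x - x ^+ 3 / 6)) (fun x => cos x - (1 - x ^+ 2 / 2))) => //.
- by move=> y; apply: is_derive_eq; rewrite /GRing.scale/=; field.
- by move=> y _; rewrite subr_ge0; exact: cos_ge_taylor2.
- by rewrite sin0 expr0n/= mul0r !subr0.
Qed.

Lemma cos_le_taylor4 x : cos x <= 1 - x ^+ 2 / 2 + x ^+ 4 / 24.
Proof.
wlog x0 : x / 0 <= x.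
  move=> H; have [/H//|/ltW] := lerP 0 x; rewrite -oppr_ge0 => /H.
  by rewrite cosN sqrrN (_ : (- x) ^+ 4 = x ^+ 4)//; ring.
rewrite -subr_ge0.
apply: (@ge0_derive_ge0 (fun x => 1 - x ^+ 2 / 2 + x ^+ 4 / 24 - cos x)
  (fun x => sin x - (x - x ^+ 3 / 6))) => //.
- by move=> y; apply: is_derive_eq; rewrite /GRing.scale/=; field.
- by move=> y; rewrite subr_ge0; exact: sin_ge_taylor3.
- by rewrite cos0 !expr0n/= !mul0r subr0 addr0 subrr.
Qed.

Lemma sin_taylor3 x : `|sin x - x| <= `|x| ^+ 3 / 6.
Proof.
wlog x0 : x / 0 <= x.
  move=> H; have [/H//|/ltW] := lerP 0 x; rewrite -oppr_ge0 => /H.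
  by rewrite sinN normrN -opprD normrN.
rewrite (ger0_norm x0) distrC ger0_norm ?subr_ge0 ?sin_le_id//.
by rewrite lerBlDl -lerBlDr; exact: sin_ge_taylor3.
Qed.

(** As a dominating function the cubic remainder would call for a third moment; giving up one order
    leaves a square. Up to 2 the cubic bound is the better one, beyond 2 the trivial bound 1 + |x|
    suffices. *)
Lemma sin_dist_sqr x : `|sin x - x| <= x ^+ 2.
Proof.
rewrite -(real_normK (num_real x)).
have [x2|x2] := lerP `|x| 2.
  apply: (le_trans (sin_taylor3 x)).
  by have := normr_ge0 x; have := sqr_ge0 `|x|; nra.
apply: (le_trans (ler_normB _ _)); have := sin_max x.
nra.
Qed.

End Taylor.

(** * Central limit theorem for square-integrable functions of an i.i.d. sequence *)

Section CentralLimit.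
Context (d : measure_display) (Omega : measurableType d) (R : realType).
Context (d' : measure_display) (S : measurableType d').
Variables (P : probability Omega R) (W : nat -> Omega -> S).
Hypothesis mW : forall j, measurable_fun setT (W j).
Hypothesis iidW : iid P W.

Lemma mean_identically_distributed j k (g : S -> R) : measurable_fun setT g ->
  integrable_rv P (fun w => g (W j w)) -> integrable_rv P (fun w => g (W k w)) ->
  mean P (fun w => g (W j w)) = mean P (fun w => g (W k w)).
Proof.
move=> mg ij ik; have [_ idW] := iidW.
have E i : integrable_rv P (fun w => g (W i w)) ->
    (\int[pushforward P (W i)]_x (g x)%:E = \int[P]_w (g (W i w))%:E)%E.
  by move=> ii; rewrite integral_pushforward//; exact/measurable_EFinP.
rewrite /Rintegral -!E//; congr fine.
by apply: eq_measure_integral => A mA _; exact: idW.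
Qed.

Lemma mean_prod_indep_bounded j k (g h : S -> R) (C D : R) : (j < k)%N ->
  measurable_fun setT g -> measurable_fun setT h ->
  (forall x, `|g x| <= C) -> (forall x, `|h x| <= D) ->
  mean P (fun w => g (W j w) * h (W k w)) =
    mean P (fun w => g (W j w)) * mean P (fun w => h (W k w)).
Proof.
move=> jk mg mh bg bh; have [ind _] := iidW.
have indepS i l (H : Omega -> R) : (i <= l)%N ->
    indep_of_future P W i H -> indep_of_future P W l H.
  move=> /subnK <- iH; elim: (l - i)%N => // m; exact: indep_of_futureS.
have [gj _] := indep_of_future_mul mW (indepS _ j _ (leq0n j) (indep_of_future_cst mW ind 1)) mg bg.
have E : (fun w => 1 * g (W j w)) = (fun w => g (W j w)) by apply/funext => w; rewrite mul1r.
by rewrite E in gj; have [_ <-] := indep_of_future_mul mW (indepS _ _ _ jk gj) mh bh.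
Qed.

Definition truncate (g : S -> R) (n : nat) (x : S) : R :=
  if `|g x| <= n%:R then g x else 0.

Lemma measurable_truncate g n : measurable_fun setT g -> measurable_fun setT (truncate g n).
Proof.
move=> mg; apply: measurable_fun_ifT => //.
by apply: measurable_fun_ler => //; exact: measurableT_comp.
Qed.

Lemma cvg_truncate g x : truncate g n x @[n --> \oo] --> g x.
Proof.
apply: cvg_near_cst; near=> n; rewrite /truncate ifT//.
rewrite (le_trans (ltW (truncnS_gt _)))// ler_nat; near: n; exact: nbhs_infty_ge.
Unshelve. all: by end_near. Qed.

Lemma truncate_le g n x : `|truncate g n x| <= `|g x|.
Proof. by rewrite /truncate; case: ifP => // _; rewrite normr0. Qed.

Lemma truncate_bounded g n x : `|truncate g n x| <= n%:R.
Proof. by rewrite /truncate; case: ifP => // _; rewrite normr0. Qed.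

(** Truncation reduces the claim to bounded functions. The factors and their product are dominated
    by their integrable untruncated counterparts, so both sides pass to the limit. *)
Lemma mean_prod_indep j k (g h : S -> R) : (j < k)%N ->
  measurable_fun setT g -> measurable_fun setT h ->
  integrable_rv P (fun w => g (W j w) ^+ 2) -> integrable_rv P (fun w => h (W k w) ^+ 2) ->
  mean P (fun w => g (W j w) * h (W k w)) =
    mean P (fun w => g (W j w)) * mean P (fun w => h (W k w)).
Proof.
move=> jk mg mh ig ih.
have mgW (f : S -> R) i : measurable_fun setT f -> measurable_fun setT (fun w => f (W i w)).
  by move=> mf; exact: (measurableT_comp mf).
have lim1 (f : S -> R) i : measurable_fun setT f -> integrable_rv P (fun w => f (W i w) ^+ 2) ->
    mean P (fun w => truncate f n (W i w)) @[n --> \oo] --> mean P (fun w => f (W i w)).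
  move=> mf if2; apply: (@dominated_mean _ _ _ _ _ _ (fun w => `|f (W i w)|)).
  - by move=> n; apply: (mgW (truncate f n)); exact: measurable_truncate.
  - by move=> w; exact: cvg_truncate.
  - by apply: integrable_norm; apply: integrable_sq_integrable => //; exact: mgW.
  - by move=> n w; exact: truncate_le.
have lim2 : mean P (fun w => truncate g n (W j w) * truncate h n (W k w)) @[n --> \oo]
    --> mean P (fun w => g (W j w) * h (W k w)).
  apply: (@dominated_mean _ _ _ _ _ _ (fun w => `|g (W j w) * h (W k w)|)).
  - by move=> n; apply: measurable_funM; [apply: (mgW (truncate g n))|apply: (mgW (truncate h n))];
      exact: measurable_truncate.
  - by move=> w; apply: cvgM; exact: cvg_truncate.
  - by apply: integrable_norm; apply: integrable_sq_prod => //; exact: mgW.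
  - by move=> n w; rewrite !normrM ler_pM// truncate_le.
have lim3 : mean P (fun w => truncate g n (W j w)) * mean P (fun w => truncate h n (W k w))
    @[n --> \oo] --> mean P (fun w => g (W j w)) * mean P (fun w => h (W k w)).
  by apply: cvgM; [exact: lim1|exact: lim1].
suff E : (fun n => mean P (fun w => truncate g n (W j w)) * mean P (fun w => truncate h n (W k w)))
    = (fun n => mean P (fun w => truncate g n (W j w) * truncate h n (W k w))).
  by rewrite E in lim3; rewrite -(cvg_lim _ lim2)// -(cvg_lim _ lim3).
apply/funext => n; rewrite (mean_prod_indep_bounded jk (C := n%:R) (D := n%:R))//.
- exact: measurable_truncate.
- exact: measurable_truncate.
- exact: truncate_bounded.
- exact: truncate_bounded.
Qed.

Section Sums.
Variable g : S -> R.
Hypothesis mg : measurable_fun setT g.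
Hypothesis ig : forall j, integrable_rv P (fun w => g (W j w) ^+ 2).
Hypothesis g0 : forall j, mean P (fun w => g (W j w)) = 0.
Let v := mean P (fun w => g (W 0%N w) ^+ 2).
Let S_ J w : R := \sum_(j < J) g (W j w).

Let mgW i : measurable_fun setT (fun w => g (W i w)).
Proof. exact: (measurableT_comp mg). Qed.

Lemma measurable_partial_sum J : measurable_fun setT (S_ J).
Proof. by apply: measurable_sum. Qed.

(** Variances add because each cross term factors and contains a vanishing mean. *)
Lemma mean_sq_partial_sum J : integrable_rv P (fun w => S_ J w ^+ 2) /\
  mean P (fun w => S_ J w ^+ 2) = J%:R * v.
Proof.
split; first by apply: (@integrable_sq_sum _ _ _ _ _ _ (fun j : 'I_J => fun w => g (W j w))).
elim: J => [|J IH].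
  rewrite mul0r (_ : (fun w => _) = fun=> 0) ?mean_cst//.
  by apply/funext => w; rewrite /S_ big_ord0 expr0n.
have iS : integrable_rv P (fun w => S_ J w ^+ 2).
  by apply: (@integrable_sq_sum _ _ _ _ _ _ (fun j : 'I_J => fun w => g (W j w))).
have iSg : integrable_rv P (fun w => S_ J w * g (W J w)).
  by apply: integrable_sq_prod => //; exact: measurable_partial_sum.
have i2 : integrable_rv P (fun w => 2 * (S_ J w * g (W J w))) by exact: integrable_rvZ.
rewrite (_ : (fun w => _) = (fun w => (S_ J w ^+ 2 + 2 * (S_ J w * g (W J w))) + g (W J w) ^+ 2)); last first.
  by apply/funext => w; rewrite /S_ big_ord_recr/=; ring.
rewrite (meanD (integrable_rvD iS i2) (ig J)) (meanD iS i2) meanZ// IH.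
rewrite (_ : (fun w => S_ J w * g (W J w)) = (fun w => \sum_(j < J) g (W j w) * g (W J w))); last first.
  by apply/funext => w; rewrite mulr_suml.
rewrite mean_sum; last by move=> i _; apply: integrable_sq_prod.
rewrite big1 => [|i _]; last by rewrite mean_prod_indep// g0 mul0r.
rewrite mulr0 addr0 -natr1 mulrDl mul1r; congr (_ + _).
by apply: (@mean_identically_distributed J 0%N (fun x => g x ^+ 2)) => //; exact: measurable_funX.
Qed.

(** The phase [th] is generalized before the induction: the sine in the addition formula is a cosine
    with phase [th - pi / 2]. *)
Lemma indep_of_future_cos c k th : indep_of_future P W k (fun w => cos (c * S_ k w + th)).
Proof.
have [ind _] := iidW.
elim: k th => [|k IH] th.
  rewrite (_ : (fun w => _) = fun=> cos th); first exact: indep_of_future_cst.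
  by apply/funext => w; rewrite /S_ big_ord0 mulr0 add0r.
have mcg : measurable_fun setT (fun x => c * g x) by exact: measurable_funM.
have mc : measurable_fun setT (fun x => cos (c * g x)).
  exact: measurable_cos.
have ms : measurable_fun setT (fun x => sin (c * g x)).
  exact: measurable_sin.
rewrite (_ : (fun w => _) = (fun w => cos (c * S_ k w + th) * cos (c * g (W k w))
   + - (cos (c * S_ k w + (th - pi / 2)) * sin (c * g (W k w))))); last first.
  apply/funext => w; rewrite addrA cosBpihalf /S_ big_ord_recr/= mulrDr -cosD.
  by congr cos; ring.
apply: indep_of_futureD => //.
  by have [] := indep_of_future_mul mW (IH th) mc (fun x => cos_max (c * g x)).
apply: indep_of_futureN => //.
by have [] := indep_of_future_mul mW (IH (th - pi / 2)) ms (fun x => sin_max (c * g x)).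
Qed.

(** The real form of the multiplicativity of characteristic functions; the shifted phase carries the
    imaginary part. *)
Lemma mean_cosS c k th : mean P (fun w => cos (c * S_ k.+1 w + th)) =
  mean P (fun w => cos (c * S_ k w + th)) * mean P (fun w => cos (c * g (W 0%N w)))
  - mean P (fun w => cos (c * S_ k w + (th - pi / 2))) * mean P (fun w => sin (c * g (W 0%N w))).
Proof.
have mcg : measurable_fun setT (fun x => c * g x) by exact: measurable_funM.
have mc : measurable_fun setT (fun x => cos (c * g x)).
  exact: measurable_cos.
have ms : measurable_fun setT (fun x => sin (c * g x)).
  exact: measurable_sin.
have mcW j : measurable_fun setT (fun w => cos (c * g (W j w))).
  by apply: (measurableT_comp mc).
have msW j : measurable_fun setT (fun w => sin (c * g (W j w))).
  by apply: (measurableT_comp ms).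
have mS t : measurable_fun setT (fun w => cos (c * S_ k w + t)).
  apply: measurable_cos.
  by apply: measurable_funD => //; apply: measurable_funM => //; exact: measurable_partial_sum.
rewrite -(@mean_identically_distributed k 0%N (fun x => cos (c * g x)))//; last 2 first.
- by apply: (bounded_integrable (C := 1)) => // w; exact: cos_max.
- by apply: (bounded_integrable (C := 1)) => // w; exact: cos_max.
rewrite -(@mean_identically_distributed k 0%N (fun x => sin (c * g x)))//; last 2 first.
- by apply: (bounded_integrable (C := 1)) => // w; exact: sin_max.
- by apply: (bounded_integrable (C := 1)) => // w; exact: sin_max.
have [_ <-] := indep_of_future_mul mW (indep_of_future_cos c k th) mc (fun x => cos_max (c * g x)).
have [_ <-] := indep_of_future_mul mW (indep_of_future_cos c k (th - pi / 2)) ms (fun x => sin_max (c * g x)).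
rewrite -meanB.
- congr (mean P _); apply/funext => w; rewrite addrA cosBpihalf /S_ big_ord_recr/= mulrDr -cosD.
  by congr cos; ring.
- apply: (bounded_integrable (C := 1 * 1)); first exact: measurable_funM.
  by move=> w; rewrite normrM ler_pM// cos_max.
- apply: (bounded_integrable (C := 1 * 1)); first exact: measurable_funM.
  by move=> w; rewrite normrM ler_pM// ?cos_max// sin_max.
Qed.

(** Each step of the recursion multiplies the mean by [q] up to an error of at most |C - q| + |Sn|.
    As [q] lies in [0, 1] and all means are at most 1 in absolute value, these errors add up without
    being amplified. *)
Lemma mean_cos_approx c q k th : 0 <= q <= 1 ->
  `|mean P (fun w => cos (c * S_ k w + th)) - q ^+ k * cos th| <=
  k%:R * (`|mean P (fun w => cos (c * g (W 0%N w))) - q|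
          + `|mean P (fun w => sin (c * g (W 0%N w)))|).
Proof.
move=> /andP[q0 q1]; elim: k th => [|k IH] th.
  rewrite (_ : (fun w => _) = fun=> cos th) ?mean_cst ?expr0 ?mul1r ?subrr ?normr0 ?mul0r//.
  by apply/funext => w; rewrite /S_ big_ord0 mulr0 add0r.
rewrite mean_cosS; move: (IH th).
set A := mean P _; set A' := mean P (fun w => cos (c * _ + (th - _))).
set C := mean P _; set Sn := mean P _ => {}IH.
have bA t : `|mean P (fun w => cos (c * S_ k w + t))| <= 1.
  apply: bounded_mean; last by move=> w; exact: cos_max.
  apply: measurable_cos.
  by apply: measurable_funD => //; apply: measurable_funM => //; exact: measurable_partial_sum.
rewrite (_ : A * C - A' * Sn - _ = (C - q) * A + q * (A - q ^+ k * cos th) - A' * Sn); last first.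
  by rewrite exprS; ring.
apply: (le_trans (ler_normB _ _)).
have h1 : `|(C - q) * A| <= `|C - q| by rewrite normrM ler_piMr//; exact: bA.
have h2 : `|q * (A - q ^+ k * cos th)| <= k%:R * (`|C - q| + `|Sn|).
  by rewrite normrM (ger0_norm q0); apply: le_trans IH; rewrite ler_piMl.
have h3 : `|A' * Sn| <= `|Sn| by rewrite normrM ler_piMl//; exact: bA.
have h4 := ler_normD ((C - q) * A) (q * (A - q ^+ k * cos th)).
rewrite -natr1 [leRHS]mulrDl mul1r; lra.
Qed.

(** At [J = 0] the inverse of 0 is 0, which keeps [c_ge0], [c_le1] and [le_natc] valid for every
    [J]. *)
Let c_ J : R := (Num.sqrt J%:R)^-1.

Lemma cvg_invsqrt : c_ J @[J --> \oo] --> 0.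
Proof.
apply/cvgrPdist_le => e e0; near=> J.
have J0 : (0 < J)%N by near: J; exact: nbhs_infty_gt.
have s0 : 0 < Num.sqrt (J%:R : R) by rewrite sqrtr_gt0 ltr0n.
rewrite sub0r normrN ger0_norm ?invr_ge0 ?(ltW s0)// /c_ -[leRHS]invrK lef_pV2 ?posrE ?invr_gt0//.
rewrite -(ger0_norm (ltW (_ : 0 < e^-1))) ?invr_gt0// -sqrtr_sqr ler_sqrt ?ler0n//.
rewrite (le_trans (ltW (truncnS_gt _)))// ler_nat; near: J; exact: nbhs_infty_ge.
Unshelve. all: by end_near. Qed.

Lemma sqr_invsqrt J : (0 < J)%N -> J%:R * c_ J ^+ 2 = 1.
Proof. by move=> J0; rewrite exprVn sqr_sqrtr ?ler0n// divff// pnatr_eq0 -lt0n. Qed.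

Lemma cvg_bound_invsqrt (u : nat -> R) (l K : R) :
  (forall J, (0 < J)%N -> `|u J - l| <= K * c_ J) -> u J @[J --> \oo] --> l.
Proof.
move=> uK; apply/subr_cvg0/norm_cvg0P.
apply: (@squeeze_cvgr _ _ _ _ (fun=> 0) (fun J => K * c_ J)).
- near=> J; rewrite normr_ge0/= uK//; near: J; exact: nbhs_infty_gt.
- exact: cvg_cst.
- by rewrite -(mulr0 K); apply: cvgM; [exact: cvg_cst|exact: cvg_invsqrt].
Unshelve. all: by end_near. Qed.

Let le_natc J (y : R) : J%:R * (c_ J * y) ^+ 2 <= y ^+ 2.
Proof.
case: J => [|J]; first by rewrite mul0r sqr_ge0.
by rewrite exprMn mulrA sqr_invsqrt// mul1r.
Qed.

Let c_ge0 J : 0 <= c_ J. Proof. by rewrite invr_ge0 sqrtr_ge0. Qed.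

Let c_le1 J : c_ J <= 1.
Proof.
case: J => [|J]; first by rewrite /c_ sqrtr0 invr0.
rewrite /c_ invf_le1 ?sqrtr_gt0 ?ltr0n// -[leLHS]sqrtr1 ler_sqrt ?ler0n//.
by rewrite ler1n.
Qed.

(** Dominated convergence: the integrand is nonnegative and at most half the square of [g], and the
    fourth-order Taylor bound gives the pointwise limit. *)
Lemma cvg_mean_cos : J%:R * (1 - mean P (fun w => cos (c_ J * g (W 0%N w)))) @[J --> \oo] --> v / 2.
Proof.
have mc J : measurable_fun setT (fun w => cos (c_ J * g (W 0%N w))).
  by apply: measurable_cos; exact: measurable_funM.
have ic J : integrable_rv P (fun w => cos (c_ J * g (W 0%N w))).
  by apply: (bounded_integrable (C := 1)) => // w; exact: cos_max.
rewrite (_ : (fun J => _) = (fun J : nat => mean P (fun w => J%:R * (1 - cos (c_ J * g (W 0%N w)))))); last first.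
  apply/funext => J; rewrite meanZ ?meanB ?mean_cst//; first exact: integrable_rv_cst.
  by apply: integrable_rvB => //; exact: integrable_rv_cst.
rewrite (_ : v / 2 = mean P (fun w => 2^-1 * g (W 0%N w) ^+ 2)); last by rewrite meanZ// mulrC.
apply: (@dominated_mean _ _ _ _ _ _ (fun w => 2^-1 * g (W 0%N w) ^+ 2)).
- by move=> J; apply: measurable_funM => //; exact: measurable_funB.
- move=> w; set y := g _; apply: (@cvg_bound_invsqrt _ _ (y ^+ 4 / 24)) => J J0.
  have E := sqr_invsqrt J0; move: E (c_ge0 J) (c_le1 J); move: (c_ J) => c E c0 c1.
  have := cos_ge_taylor2 (c * y); have := cos_le_taylor4 (c * y).
  set C := cos _ => h1 h2.
  have J1 : 0 <= (J%:R : R) by rewrite ler0n.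
  have h1' := ler_wpM2l J1 h1.
  have h2' := ler_wpM2l J1 h2.
  have E1 : J%:R * (c * y) ^+ 2 = y ^+ 2 by rewrite exprMn mulrA E mul1r.
  have E2 : J%:R * (c * y) ^+ 4 = c ^+ 2 * y ^+ 4.
    have -> : J%:R * (c * y) ^+ 4 = (J%:R * c ^+ 2) * (c ^+ 2 * y ^+ 4) by ring.
    by rewrite E mul1r.
  have E3 : c ^+ 2 * y ^+ 4 <= c * y ^+ 4.
    by apply: ler_wpM2r; [exact: exprn_even_ge0|rewrite expr2 ler_piMl ?c0 ?c1].
  have E4 : 0 <= c ^+ 2 * y ^+ 4 by rewrite mulr_ge0 ?exprn_even_ge0.
  rewrite ler_norml; apply/andP; split; lra.
- exact: integrable_rvZ.
- move=> J w; set y := g _.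
  rewrite ger0_norm ?mulr_ge0 ?ler0n ?subr_ge0 ?cos_le1//.
  apply: (@le_trans _ _ (J%:R * ((c_ J * y) ^+ 2 / 2))).
    by apply: ler_wpM2l => //; rewrite lerBlDl -lerBlDr; exact: cos_ge_taylor2.
  by rewrite mulrA [2^-1 * _]mulrC; apply: ler_wpM2r => //; exact: le_natc.
Qed.

(** The mean of [g] is 0, so [c_ J * g] may be subtracted inside. The difference is pointwise cubic
    in [c_ J], hence vanishes even after multiplication by [J], and it is dominated by a square. *)
Lemma cvg_mean_sin : J%:R * mean P (fun w => sin (c_ J * g (W 0%N w))) @[J --> \oo] --> 0.
Proof.
have ms J : measurable_fun setT (fun w => sin (c_ J * g (W 0%N w))).
  by apply: measurable_sin; exact: measurable_funM.
have is_ J : integrable_rv P (fun w => sin (c_ J * g (W 0%N w))).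
  by apply: (bounded_integrable (C := 1)) => // w; exact: sin_max.
have i1 : integrable_rv P (fun w => g (W 0%N w)) by exact: integrable_sq_integrable.
rewrite (_ : (fun J => _) = (fun J : nat => mean P (fun w => J%:R * (sin (c_ J * g (W 0%N w)) - c_ J * g (W 0%N w))))); last first.
  apply/funext => J; rewrite meanZ; last by apply: integrable_rvB => //; exact: integrable_rvZ.
  by rewrite meanB//; [rewrite meanZ// g0 mulr0 subr0|exact: integrable_rvZ].
rewrite -[X in _ --> X](mean_cst P 0).
apply: (@dominated_mean _ _ _ _ _ _ (fun w => g (W 0%N w) ^+ 2)) => //.
- by move=> J; apply: measurable_funM => //; apply: measurable_funB => //; exact: measurable_funM.
- move=> w; set y := g _; apply: (@cvg_bound_invsqrt _ _ (`|y| ^+ 3 / 6)) => J J0.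
  rewrite subr0 normrM ger0_norm//.
  apply: (le_trans (ler_wpM2l _ (sin_taylor3 _))) => //.
  rewrite normrM (ger0_norm (c_ge0 J)) le_eqVlt; apply/orP; left; apply/eqP.
  have := sqr_invsqrt J0; move: (c_ J) => c E.
  have -> : J%:R * ((c * `|y|) ^+ 3 / 6) = (J%:R * c ^+ 2) * (`|y| ^+ 3 / 6 * c) by field.
  by rewrite E mul1r.
- move=> J w; rewrite normrM ger0_norm//.
  by apply: (le_trans (ler_wpM2l _ (sin_dist_sqr _))) => //; exact: le_natc.
Qed.

Lemma cvg_expR_rate (a : R) : 0 <= a -> J%:R * (1 - expR (- a / J%:R)) @[J --> \oo] --> a.
Proof.
move=> a0; apply: (@cvg_bound_invsqrt _ _ (a ^+ 2)) => J J0.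
have J1 : 0 < (J%:R : R) by rewrite ltr0n.
have := expR_ge1Dx (- a / J%:R); have := expR_ge1Dx (a / J%:R).
rewrite mulNr expRN; set x := a / J%:R; have x0 : 0 <= x by rewrite divr_ge0.
set e := expR x => h1 h2.
have e1 : 1 <= e by lra.
have e0 : 0 < e by lra.
have JE : J%:R * x = a by rewrite /x mulrC divfK ?gt_eqF.
(* From [1 + x <= e] and (1 + x)(1 - x + x^2) = 1 + x^3 >= 1. *)
have h3 : e^-1 <= 1 - x + x ^+ 2.
  rewrite invf_ple ?posrE//; last by nra.
  apply: le_trans h1; rewrite -[leLHS]mulr1 mulrC ler_pdivrMr; last by nra.
  by have := mulr_ge0 x0 (mulr_ge0 x0 x0); nra.
have h4 : J%:R * x ^+ 2 <= a ^+ 2 * c_ J.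
  have -> : J%:R * x ^+ 2 = a ^+ 2 * c_ J ^+ 2.
    rewrite -JE; have := sqr_invsqrt J0; move: (c_ J) => c E.
    have -> : (J%:R * x) ^+ 2 * c ^+ 2 = (J%:R * c ^+ 2) * (J%:R * x ^+ 2) by ring.
    by rewrite E mul1r.
  by apply: ler_wpM2l; rewrite ?sqr_ge0// expr2 ler_piMl ?c_ge0 ?c_le1.
have h5 := ler_wpM2l (ltW J1) h3; have h6 := ler_wpM2l (ltW J1) h2.
rewrite ler_norml; apply/andP; split; nra.
Qed.

Theorem clt_cos th : mean P (fun w => cos (c_ J * S_ J w + th)) @[J --> \oo]
  --> expR (- (v / 2)) * cos th.
Proof.
have v0 : 0 <= v / 2.
  by rewrite divr_ge0//; apply: Rintegral_ge0 => w _; exact: sqr_ge0.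
(* The exact [J]-th root of the limit factor: [q J ^+ J] is [expR (- (v / 2))], while
   [J%:R * (1 - q J)] has the same limit [v / 2] as [J%:R * (1 - C J)]. *)
pose q (J : nat) := expR (- (v / 2) / J%:R).
pose C J := mean P (fun w => cos (c_ J * g (W 0%N w))).
pose Sn J := mean P (fun w => sin (c_ J * g (W 0%N w))).
have lim0 : `|J%:R * (1 - q J) - J%:R * (1 - C J)| + `|J%:R * Sn J| @[J --> \oo] --> 0.
  have l1 : J%:R * (1 - q J) - J%:R * (1 - C J) @[J --> \oo] --> v / 2 - v / 2.
    by apply: cvgB; [exact: cvg_expR_rate|exact: cvg_mean_cos].
  have -> : 0 = `|v / 2 - v / 2| + `|0 : R| by rewrite subrr !normr0 addr0.
  by apply: cvgD; apply: cvg_norm => //; exact: cvg_mean_sin.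
apply/subr_cvg0/norm_cvg0P.
apply: (@squeeze_cvgr _ _ _ _ (fun=> 0) _ _ _ _ _ lim0).
  near=> J; rewrite normr_ge0/=.
  have J0 : (0 < J)%N by near: J; exact: nbhs_infty_gt.
  have J1 : 0 < (J%:R : R) by rewrite ltr0n.
  have -> : expR (- (v / 2)) = q J ^+ J.
    by rewrite -expRM_natl; congr expR; rewrite [RHS]mulrC divfK ?gt_eqF.
  apply: (le_trans (mean_cos_approx (c_ J) J th _)).
    rewrite expR_ge0/= -[leRHS]expR0 ler_expR mulNr oppr_le0 divr_ge0//.
  rewrite mulrDr -/(C J) -/(Sn J) normrM (gtr0_norm J1) lerD2r.
  by rewrite -{1}(gtr0_norm J1) -normrM le_eqVlt; apply/orP; left; apply/eqP; congr `|_|; ring.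
exact: cvg_cst.
Unshelve. all: by end_near. Qed.

End Sums.
End CentralLimit.

(** * Approximation by trigonometric polynomials *)

Section TrigonometricPolynomials.
Variables (R : realType) (n : nat).
Implicit Types (x : 'cV[R]_n) (p q : 'cV[R]_n -> R).

Lemma dotvE (u v : 'cV[R]_n) : dotv u v = \sum_i u i 0 * v i 0.
Proof. by rewrite /dotv mxE; apply: eq_bigr => i _; rewrite mxE. Qed.

Lemma dotvDl (u v x : 'cV[R]_n) : dotv (u + v) x = dotv u x + dotv v x.
Proof. by rewrite !dotvE -big_split; apply: eq_bigr => i _; rewrite mxE mulrDl. Qed.

Lemma dotvNl (u x : 'cV[R]_n) : dotv (- u) x = - dotv u x.
Proof. by rewrite !dotvE -sumrN; apply: eq_bigr => i _; rewrite mxE mulNr. Qed.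

(** Allowing a phase makes constants and sines instances of the first constructor, and the
    product-to-sum formula keeps products in the class. *)
Inductive trigpoly : ('cV[R]_n -> R) -> Prop :=
| trigpoly_cos c a th : trigpoly (fun x => c * cos (dotv a x + th))
| trigpolyD p q : trigpoly p -> trigpoly q -> trigpoly (fun x => p x + q x).

Lemma trigpoly_cst c : trigpoly (fun=> c).
Proof.
rewrite (_ : (fun=> c) = (fun x => c * cos (dotv 0 x + 0))); first exact: trigpoly_cos.
by apply/funext => x; rewrite dotvE big1 ?addr0 ?cos0 ?mulr1// => i _; rewrite mxE mul0r.
Qed.

Lemma trigpolyM p q : trigpoly p -> trigpoly q -> trigpoly (fun x => p x * q x).
Proof.
move=> tp tq; elim: tp => [c a th|p1 p2 _ IH1 _ IH2]; last first.
  rewrite (_ : (fun x => _) = (fun x => p1 x * q x + p2 x * q x)); first exact: trigpolyD.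
  by apply/funext => x; rewrite mulrDl.
elim: tq => [c' a' th'|q1 q2 _ IH1 _ IH2]; last first.
  rewrite (_ : (fun x => _) = (fun x => c * cos (dotv a x + th) * q1 x + c * cos (dotv a x + th) * q2 x)).
    exact: trigpolyD.
  by apply/funext => x; rewrite mulrDr.
rewrite (_ : (fun x => _) = (fun x => (c * c' / 2) * cos (dotv (a + a') x + (th + th')) +
  (c * c' / 2) * cos (dotv (a - a') x + (th - th')))).
  by apply: trigpolyD; apply: trigpoly_cos.
apply/funext => x; rewrite !dotvDl dotvNl.
rewrite (_ : _ + _ + (th + th') = (dotv a x + th) + (dotv a' x + th')); last by ring.
rewrite (_ : _ - _ + (th - th') = (dotv a x + th) - (dotv a' x + th')); last by ring.
by move: (dotv a x + th) (dotv a' x + th') => A A'; rewrite (cosD A A') (cosB A A'); field.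
Qed.

Lemma trigpoly_sum (I : Type) (s : seq I) (F : I -> 'cV[R]_n -> R) :
  (forall i, trigpoly (F i)) -> trigpoly (fun x => \sum_(i <- s) F i x).
Proof.
move=> tF; elim: s => [|i s IH].
  by rewrite (_ : (fun x => _) = fun=> 0); [exact: trigpoly_cst|apply/funext => x; rewrite big_nil].
rewrite (_ : (fun x => _) = (fun x => F i x + \sum_(i <- s) F i x)); first exact: trigpolyD.
by apply/funext => x; rewrite big_cons.
Qed.

Lemma trigpoly_prod (I : Type) (s : seq I) (F : I -> 'cV[R]_n -> R) :
  (forall i, trigpoly (F i)) -> trigpoly (fun x => \prod_(i <- s) F i x).
Proof.
move=> tF; elim: s => [|i s IH].
  by rewrite (_ : (fun x => _) = fun=> 1); [exact: trigpoly_cst|apply/funext => x; rewrite big_nil].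
rewrite (_ : (fun x => _) = (fun x => F i x * \prod_(i <- s) F i x)); first exact: trigpolyM.
by apply/funext => x; rewrite big_cons.
Qed.

End TrigonometricPolynomials.

(** * Bernstein weights: total mass and variance *)

Section Bernstein.
Variable R : realType.
Implicit Types (u c : R) (N k : nat).

(* Pascal's recursion for 'C(N, k) u^k (1 - u)^(N - k). *)
Fixpoint bernstein N k u : R :=
  if N is N'.+1 then
    (if k is k'.+1 then u * bernstein N' k' u else 0) + (1 - u) * bernstein N' k u
  else (k == 0%N)%:R.

Lemma bernstein_ge0 N k u : 0 <= u <= 1 -> 0 <= bernstein N k u.
Proof.
move=> /andP[u0 u1]; elim: N k => [|N IH] k /=; first by rewrite ler0n.
rewrite addr_ge0//; last by rewrite mulr_ge0// subr_ge0.
by case: k => // k; rewrite mulr_ge0.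
Qed.

Lemma bernstein_out N k u : (N < k)%N -> bernstein N k u = 0.
Proof.
elim: N k => [|N IH] [|k]//= Nk; by rewrite !IH ?mulr0 ?addr0// ltnW.
Qed.

(** A binomial count conditioned on one trial. The arbitrary weight [g] lets the total mass and the
    variance follow by the same induction. *)
Lemma bernstein_sumS N u (g : nat -> R) :
  \sum_(k < N.+2) bernstein N.+1 k u * g k =
  u * (\sum_(k < N.+1) bernstein N k u * g k.+1)
  + (1 - u) * (\sum_(k < N.+1) bernstein N k u * g k).
Proof.
under eq_bigr do rewrite /= mulrDl; rewrite big_split/=; congr (_ + _).
  rewrite big_ord_recl/= mul0r add0r mulr_sumr.
  by apply: eq_bigr => i _; rewrite mulrA.
rewrite big_ord_recr/= bernstein_out// mulr0 mul0r addr0 mulr_sumr.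
by apply: eq_bigr => i _; rewrite mulrA.
Qed.

Lemma bernstein_sum1 N u : \sum_(k < N.+1) bernstein N k u = 1.
Proof.
have : \sum_(k < N.+1) bernstein N k u * 1 = 1.
  elim: N => [|N IH]; first by rewrite big_ord1 mulr1.
  by rewrite (@bernstein_sumS N u (fun=> 1)) IH; ring.
by under eq_bigr do rewrite mulr1.
Qed.

(** The center [c] is arbitrary because a success in the recursion shifts it to [c - 1]. *)
Lemma bernstein_variance N u c :
  \sum_(k < N.+1) bernstein N k u * (k%:R - c) ^+ 2 =
  N%:R * (u * (1 - u)) + (N%:R * u - c) ^+ 2.
Proof.
elim: N c => [|N IH] c; first by rewrite big_ord1 /=; ring.
rewrite (@bernstein_sumS N u (fun k => (k%:R - c) ^+ 2)).
rewrite (eq_bigr (fun k : 'I_N.+1 => bernstein N k u * (k%:R - (c - 1)) ^+ 2)).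
  by rewrite !IH -natr1; ring.
by move=> k _; rewrite -natr1; congr (_ * _ ^+ 2); ring.
Qed.

End Bernstein.

(** * Recovering an angle from its sine *)

Section SineModulus.
Variable R : realType.
Implicit Types s t : R.

Lemma ler_cos_pi s t : 0 <= s -> s <= t -> t <= pi -> cos t <= cos s.
Proof.
move=> s0 st tpi; rewrite leNgt ltr_cos ?in_itv/= -?leNgt//.
- by rewrite (le_trans s0).
- by rewrite s0 (le_trans st).
Qed.

(** With half-difference [h] and midpoint [m], the sines differ by 2 sin h cos m. Both angles lie in
    [-pi/2, pi/2], so |m| <= pi/2 - h and cos m >= sin h, which leaves at least 2 sin^2 h = 1 - cos
    (2h). *)
Lemma sin_separation s t : `|s| <= pi / 2 -> `|t| <= pi / 2 ->
  1 - cos (s - t) <= `|sin s - sin t|.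
Proof.
wlog ts : s t / t <= s.
  move=> H hs ht; have [/H|/ltW /H] := lerP t s; first exact.
  by rewrite -[cos (t - s)]cosN opprB distrC; exact.
move=> hs ht; pose h := (s - t) / 2; pose m := (s + t) / 2.
have sE : s = m + h by rewrite /m /h; field.
have tE : t = m - h by rewrite /m /h; field.
have -> : s - t = h + h by rewrite sE tE; ring.
have -> : sin s - sin t = 2 * (sin h * cos m) by rewrite sE tE sinD sinB; ring.
move: hs ht; rewrite !ler_norml => /andP[s1 s2] /andP[t1 t2].
have h0 : 0 <= h by rewrite /h; lra.
have hpi : h <= pi / 2 by rewrite /h; lra.
have sh0 : 0 <= sin h by apply: sin_ge0_pi; rewrite h0/=; have := pi_gt0 R; lra.
have cm : sin h <= cos m.
  rewrite -cosBpihalf -[cos m]cos_norm -cosN; apply: ler_cos_pi => //.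
  - by rewrite ler_norml /m /h; apply/andP; split; lra.
  - by have := pi_gt0 R; lra.
rewrite ger0_norm; last by rewrite !mulr_ge0// (le_trans sh0).
rewrite cosD -!expr2 cos2sin2.
have := ler_wpM2l sh0 cm; lra.
Qed.

Lemma sin_close s t eta : 0 < eta -> eta <= pi -> `|s| <= pi / 2 -> `|t| <= pi / 2 ->
  `|sin s - sin t| < 1 - cos eta -> `|s - t| < eta.
Proof.
move=> e0 epi hs ht; apply: contraTT; rewrite -!leNgt => est.
apply: le_trans (sin_separation hs ht); rewrite lerD2l lerN2 -[cos (s - t)]cos_norm.
apply: ler_cos_pi => //; first exact: ltW.
by apply: (le_trans (ler_normB _ _)); lra.
Qed.

End SineModulus.

(** * Uniform continuity on boxes *)

Section UniformContinuity.
Variables (R : realType) (n : nat).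

Lemma compact_box (B : R) : compact [set x : 'cV[R]_n | forall i, `|x i 0| <= B].
Proof.
have c1 : compact [set v : 'rV[R]_n | forall i, `[- B, B]%classic (v ord0 i)].
  by apply: (@rV_compact R n (fun=> `[- B, B]%classic)) => i; exact: segment_compact.
rewrite (_ : [set x | _] = trmx @` [set v : 'rV[R]_n | forall i, `[- B, B]%classic (v ord0 i)]).
  apply: continuous_compact => //; apply: continuous_subspaceT => v A /nbhs_ballP[e e0 eA].
  apply/nbhs_ballP; exists e => // w [_ vw]; apply: eA; split=> // i j; rewrite !mxE; exact: vw.
apply/seteqP; split => [x xB|_ [v vB <-] i].
  by exists x^T; rewrite ?trmxK// => i; rewrite /= mxE in_itv/= -ler_norml.
by rewrite mxE; have := vB i; rewrite /= in_itv/= -ler_norml.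
Qed.

(** Only [x] is confined to the box: the interpolation nodes it is later compared with have
    coordinates up to pi/2 times the half-width and may lie outside. *)
Lemma box_uniformly_continuous (f : 'cV[R]_n -> R) (B e : R) : continuous f -> 0 < e ->
  exists2 eta, 0 < eta & forall x y : 'cV[R]_n, (forall i, `|x i 0| <= B) ->
    (forall i, `|x i 0 - y i 0| < eta) -> `|f x - f y| <= e.
Proof.
move=> cf e0.
have /compact_near_coveringP cov := @compact_box B.
pose Q (eta : R) (x : 'cV[R]_n) := forall y : 'cV[R]_n, (forall i, `|x i 0 - y i 0| < eta) -> `|f x - f y| <= e.
have : \forall eta \near 0^'+, [set x : 'cV[R]_n | forall i, `|x i 0| <= B] `<=` Q eta.
  apply: cov => x _.
  have e2 : 0 < e / 2 by rewrite divr_gt0.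
  have /cvgrPdist_le/(_ _ e2)/nbhs_ballP[r /= r0 rf] := cf x.
  (* Half the radius for the moving center and half for [eta], so that [y] stays in the ball of
     radius [r] around [x]. *)
  exists (ball x (r / 2), [set eta | 0 < eta < r / 2]).
    split => /=; first by apply: nbhsx_ballx; rewrite divr_gt0.
    near=> eta; apply/andP; split; first by near: eta; exact: nbhs_right_gt.
    by near: eta; apply: nbhs_right_lt; rewrite divr_gt0.
  move=> [x' eta] [/= [r20 xx'] /andP[eta0 etar]] y x'y.
  have r2 : 0 < r / 2 by rewrite divr_gt0.
  have h1 : `|f x - f x'| <= e / 2.
    apply: rf; split => // i j; apply: le_ball (xx' i j); lra.
  have h2 : `|f x - f y| <= e / 2.
    apply: rf; split => // i j; rewrite (_ : r = r / 2 + r / 2); last by field.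
    apply: ball_triangle (xx' i j) _.
    by rewrite ord1 /ball/=; apply: lt_trans (x'y i) etar.
  have := ler_normD (f x' - f x) (f x - f y).
  rewrite (_ : f x' - f x + (f x - f y) = f x' - f y); last by ring.
  rewrite (distrC (f x') (f x)); lra.
move=> H; near (0:R)^'+ => eta.
exists eta; first by near: eta; exact: nbhs_right_gt.
by move=> x y xB; apply: (near H eta).
Unshelve. all: by end_near. Qed.

End UniformContinuity.

Section TrigonometricApproximation.
Variables (R : realType) (n : nat).
Implicit Types x : 'cV[R]_n.

Lemma sum_prod_bernstein (N : nat) (u : 'I_n -> R) :
  \sum_(k : {ffun 'I_n -> 'I_N.+1}) \prod_i bernstein N (k i) (u i) = 1.
Proof.
rewrite -(bigA_distr_bigA (fun i (k : 'I_N.+1) => bernstein N k (u i)))/=.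
by rewrite big1// => i _; exact: bernstein_sum1.
Qed.

(** The weights form a product law, so the sums over all coordinates other than [i] collapse to
    1. *)
Lemma sum_prod_bernstein_variance (N : nat) (u : 'I_n -> R) (i : 'I_n) :
  \sum_(k : {ffun 'I_n -> 'I_N.+1}) (\prod_j bernstein N (k j) (u j)) * ((k i)%:R - N%:R * u i) ^+ 2
  = N%:R * (u i * (1 - u i)).
Proof.
pose F j (k : 'I_N.+1) := bernstein N k (u j) * (if j == i then (k%:R - N%:R * u i) ^+ 2 else 1).
transitivity (\sum_(k : {ffun 'I_n -> 'I_N.+1}) \prod_j F j (k j)).
  apply: eq_bigr => k _; rewrite /F big_split/=; congr (_ * _).
  by rewrite -big_mkcond/= big_pred1_eq.
rewrite -(bigA_distr_bigA F)/= (bigD1 i)//= [X in _ * X]big1 => [|j ji].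
  rewrite mulr1 /F eqxx bernstein_variance subrr expr0n addr0//.
by rewrite /F (negbTE ji); under eq_bigr do rewrite mulr1; exact: bernstein_sum1.
Qed.

Lemma trigpoly_bernstein (N k : nat) (u : 'cV[R]_n -> R) :
  trigpoly u -> trigpoly (fun x => bernstein N k (u x)).
Proof.
move=> tu; elim: N k => [|N IH] k /=; first exact: trigpoly_cst.
apply: trigpolyD; first by case: k => [|k]; [exact: trigpoly_cst|exact: trigpolyM].
apply: trigpolyM => //.
rewrite (_ : (fun x => _) = (fun x => 1 + (-1) * u x)); last by apply/funext => x; rewrite mulN1r.
by apply: trigpolyD; [exact: trigpoly_cst|apply: trigpolyM => //; exact: trigpoly_cst].
Qed.

(* Tensor Bernstein polynomials in the variables (1 + sin (x_i / L)) / 2: their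
   weights are nonnegative and sum to 1 on the whole space, so that the global
   bound on f is inherited, and x_i can be recovered from sin (x_i / L) on the box. *)
Lemma trigpoly_approx (f : 'cV[R]_n -> R) (C M e : R) : continuous f ->
  (forall x, `|f x| <= C) -> 0 < M -> 0 < e ->
  exists p, [/\ trigpoly p, (forall x, `|p x| <= C) &
    forall x, (forall i, `|x i 0| <= M) -> `|f x - p x| <= e].
Proof.
move=> cf bf M0 e0.
have e2 : 0 < e / 2 by rewrite divr_gt0.
have [eta eta0 unif] := box_uniformly_continuous M cf e2.
(* [eta] rescaled to the angles [x i 0 / M]; the cap 1 keeps it below [pi], where the cosine
   decreases. *)
pose e1 := Num.min (eta / M) 1.
have e10 : 0 < e1 by rewrite lt_min ltr01 divr_gt0.
have e1pi : e1 <= pi by rewrite ge_min; apply/orP; right; have := pi_ge2 R; lra.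
(* Halved because [u] is (1 + sin) / 2: a gap below [del] in [u] is a gap below [1 - cos e1] in the
   sines. *)
pose del := (1 - cos e1) / 2.
have del0 : 0 < del.
  rewrite divr_gt0// subr_gt0 -cos0 ltr_cos ?in_itv/= ?lexx ?pi_ge0//.
  by rewrite (ltW e10).
have C0 : 0 <= C by exact: le_trans (bf 0).
(* Chebyshev constant: far from the nodes [f] varies by at most [C * 2], and each of the [n]
   coordinates contributes a variance of at most [1 / N]. *)
pose A := C * 2 * n%:R / del ^+ 2.
have A0 : 0 <= A by rewrite divr_ge0 ?sqr_ge0// !mulr_ge0.
pose N := (Num.truncn (A / (e / 2))).+1.
have N0 : 0 < (N%:R : R) by rewrite ltr0n.
have AN : A / N%:R <= e / 2.
  by rewrite ler_pdivrMr// mulrC -ler_pdivrMr//; apply/ltW/truncnS_gt.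
pose u (i : 'I_n) x := (1 + sin (x i 0 / M)) / 2.
have u01 i x : 0 <= u i x <= 1.
  by have := sin_le1 (x i 0 / M); have := sin_geN1 (x i 0 / M); rewrite /u => *; apply/andP; split; lra.
(* The node at which [u i] takes the value [k i / N]. *)
pose y (k : {ffun 'I_n -> 'I_N.+1}) : 'cV[R]_n := \col_i (M * asin (2 * ((k i)%:R / N%:R) - 1)).
pose b (k : {ffun 'I_n -> 'I_N.+1}) x := \prod_i bernstein N (k i) (u i x).
have b0 k x : 0 <= b k x by apply: prodr_ge0 => i _; exact: bernstein_ge0.
have bs x : \sum_(k : {ffun 'I_n -> 'I_N.+1}) b k x = 1 by exact: sum_prod_bernstein.
exists (fun x => \sum_(k : {ffun 'I_n -> 'I_N.+1}) f (y k) * b k x); split.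
- apply: trigpoly_sum => k; apply: trigpolyM; first exact: trigpoly_cst.
  apply: trigpoly_prod => i; apply: trigpoly_bernstein.
  rewrite (_ : u i = (fun x => 2^-1 + 2^-1 * cos (dotv (\col_j ((j == i)%:R / M)) x + - (pi / 2)))).
    by apply: trigpolyD; [exact: trigpoly_cst|exact: trigpoly_cos].
  apply/funext => x; rewrite cosBpihalf dotvE (bigD1 i)//= mxE eqxx big1 => [|j ji].
    by rewrite addr0 /u mulrDl !mul1r [_ / 2]mulrC [M^-1 * _]mulrC.
  by rewrite mxE (negbTE ji) !mul0r.
- move=> x; apply: (le_trans (ler_norm_sum _ _ _)).
  rewrite -[leRHS]mulr1 -(bs x) mulr_sumr; apply: ler_sum => k _.
  by rewrite normrM (ger0_norm (b0 k x)) ler_wpM2r.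
move=> x xM.
have -> : f x - \sum_(k : {ffun 'I_n -> 'I_N.+1}) f (y k) * b k x =
    \sum_(k : {ffun 'I_n -> 'I_N.+1}) (f x - f (y k)) * b k x.
  under [RHS]eq_bigr do rewrite mulrBl.
  by rewrite sumrB -mulr_sumr bs mulr1.
(* Bernstein's dichotomy: either every coordinate is within [del] and uniform continuity applies, or
   one is not, and then the sum of squares is at least [del ^+ 2] and pays for the trivial bound
   [C * 2]. *)
have key k : `|f x - f (y k)| <= e / 2 + C * 2 / del ^+ 2 * \sum_i ((k i)%:R / N%:R - u i x) ^+ 2.
  have S0 : 0 <= \sum_i ((k i)%:R / N%:R - u i x) ^+ 2 by apply: sumr_ge0 => i _; exact: sqr_ge0.
  have D0 : 0 <= C * 2 / del ^+ 2 by rewrite divr_ge0 ?sqr_ge0// mulr_ge0.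
  have [/existsP[i hi]|/existsPn hk] := boolP [exists i, del <= `|(k i)%:R / N%:R - u i x|].
    have h1 : `|f x - f (y k)| <= C * 2.
      by apply: (le_trans (ler_normB _ _)); rewrite mulr_natr mulr2n lerD.
    apply: (le_trans h1); rewrite -[leLHS]add0r; apply: lerD; first exact: ltW.
    rewrite -{1}[C * 2](divfK (_ : del ^+ 2 != 0)); last by rewrite expf_neq0 ?gt_eqF.
    apply: ler_wpM2l => //; rewrite (bigD1 i)//= -[leLHS]addr0; apply: lerD.
      by rewrite -(real_normK (num_real (_ - _))) lerXn2r ?nnegrE ?(ltW del0).
    by apply: sumr_ge0 => j _; exact: sqr_ge0.
  apply: (@le_trans _ _ (e / 2)); last by rewrite lerDl mulr_ge0.
  apply: unif => // i; rewrite mxE.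
  have := hk i; rewrite -ltNge => hki.
  set a := 2 * ((k i)%:R / N%:R) - 1.
  have ki : 0 <= (k i)%:R / (N%:R : R) <= 1.
    by rewrite divr_ge0//= ler_pdivrMr// mul1r ler_nat -ltnS.
  have a1 : -1 <= a <= 1 by rewrite /a; move: ki => /andP[? ?]; apply/andP; split; lra.
  have -> : x i 0 - M * asin a = M * (x i 0 / M - asin a).
    by field; rewrite gt_eqF.
  rewrite normrM (gtr0_norm M0) -ltr_pdivlMl// [M^-1 * eta]mulrC.
  apply: (@lt_le_trans _ _ e1); last by rewrite /e1 ge_min lexx.
  apply: sin_close => //.
  - by rewrite normrM (gtr0_norm (_ : 0 < M^-1)) ?invr_gt0//; have := pihalf_ge1 R;
      have := xM i; rewrite -[X in _ <= X -> _]mul1r -ler_pdivrMr// => h1 h2; exact: le_trans h1 h2.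
  - by rewrite ler_norml asin_geNpi2// asin_lepi2.
  rewrite asinK ?in_itv//=.
  have -> : sin (x i 0 / M) - a = (- 2) * ((k i)%:R / N%:R - u i x) by rewrite /a /u; lra.
  rewrite normrM normrN normr_nat; move: hki; rewrite /del; lra.
apply: (le_trans (ler_norm_sum _ _ _)).
apply: (@le_trans _ _ (\sum_(k : {ffun 'I_n -> 'I_N.+1}) (e / 2 + C * 2 / del ^+ 2 * \sum_i ((k i)%:R / N%:R - u i x) ^+ 2) * b k x)).
  by apply: ler_sum => k _; rewrite normrM (ger0_norm (b0 k x)) ler_wpM2r.
under eq_bigr do rewrite mulrDl; rewrite big_split/= -mulr_sumr bs mulr1.
rewrite [leRHS](_ : e = e / 2 + e / 2); last by field.
rewrite lerD2l; apply: le_trans AN.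
under eq_bigr do rewrite -mulrA; rewrite -mulr_sumr.
have D0 : 0 <= C * 2 / del ^+ 2 by rewrite divr_ge0 ?sqr_ge0// mulr_ge0.
rewrite /A (mulrAC (C * 2) n%:R) -[leRHS]mulrA; apply: ler_wpM2l => //.
under eq_bigr do rewrite mulr_suml.
rewrite exchange_big/=.
have -> : n%:R * N%:R^-1 = \sum_(i < n) (N%:R^-1 : R).
  by rewrite sumr_const card_ord mulr_natl.
apply: ler_sum => i _.
have -> : \sum_(k : {ffun 'I_n -> 'I_N.+1}) ((k i)%:R / N%:R - u i x) ^+ 2 * b k x =
    N%:R ^- 2 * \sum_(k : {ffun 'I_n -> 'I_N.+1}) b k x * ((k i)%:R - N%:R * u i x) ^+ 2.
  rewrite mulr_sumr; apply: eq_bigr => k _; field.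
  by rewrite gt_eqF.
rewrite (sum_prod_bernstein_variance N (fun i => u i x)).
have /andP[? ?] := u01 i x.
have -> : N%:R ^- 2 * (N%:R * (u i x * (1 - u i x))) = N%:R^-1 * (u i x * (1 - u i x)).
  by move: (u i x) => t; field; rewrite gt_eqF.
rewrite ler_piMr ?invr_ge0//; nra.
Qed.

End TrigonometricApproximation.

(** * Continuity theorem *)

Section BorelMatrices.
Variables (R : realType) (m n : nat).

Lemma continuous_borel_mx (f : 'M[R]_(m, n) -> R) : continuous f ->
  measurable_fun setT (f : borel_mx R m n -> R).
Proof.
move=> /continuousP cf; apply: (measurability _ (RGenOpens.measurableE R)) => _ [_ [a [b ->] <-]].
by rewrite setTI; apply: sub_sigma_algebra; apply: cf; exact: interval_open.
Qed.

Lemma measurable_entry i j : measurable_fun setT (fun M : borel_mx R m n => M i j).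
Proof. by apply: continuous_borel_mx; exact: coord_continuous. Qed.

(* An open set is a countable union of boxes with rational centers and radii 1 / (k + 1). *)
Lemma random_mx_measurable d (Omega : measurableType d) (Z : Omega -> 'M[R]_(m, n)) :
  random_mx Z -> measurable_fun setT (Z : Omega -> borel_mx R m n).
Proof.
move=> mZ; apply: (@measurability _ _ Omega (borel_mx R m n) setT Z (@open 'M[R]_(m, n)) erefl) => _ [U oU <-].
rewrite setTI.
pose box (p : 'M[rat]_(m, n) * nat) : set 'M[R]_(m, n) :=
  [set N | forall i j, `|ratr (p.1 i j) - N i j| < p.2.+1%:R^-1].
(* Boxes that are not contained in [U] contribute the empty set, which leaves a union over a
   countable type. *)
pose F (p : 'M[rat]_(m, n) * nat) : set Omega := if `[< box p `<=` U >] then Z @^-1` box p else set0.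
rewrite (_ : Z @^-1` U = \bigcup_p F p).
  apply: countable_bigcupT_measurable => [|p]; first exact: countableP.
  rewrite /F; case: ifP => // _.
  rewrite (_ : _ @^-1` _ = \big[setI/setT]_i \big[setI/setT]_j
      ((fun w => `|ratr (p.1 i j) - Z w i j|) @^-1` `]-oo, p.2.+1%:R^-1[)).
    apply: bigsetI_measurable => i _; apply: bigsetI_measurable => j _.
    rewrite -[X in measurable X]setTI.
    have : measurable_fun setT (fun w => `|ratr (p.1 i j) - Z w i j|).
      by apply: measurableT_comp => //; exact: measurable_funB.
    by apply.
  apply/seteqP; split => w.
    by move=> /= wb; rewrite -bigcap_seq => i _; rewrite -bigcap_seq => j _ /=; rewrite in_itv/= wb.
  rewrite -bigcap_seq => h i j; have := h i; rewrite -bigcap_seq => /(_ (mem_index_enum _)) /(_ j (mem_index_enum _)).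
  by rewrite /= in_itv.
apply/seteqP; split => [w Uw|w [p _]]; last first.
  by rewrite /F; case: asboolP => // pU /pU.
have /nbhs_ballP[e /= e0 eU] : nbhs (Z w) U by exact: open_nbhs_nbhs.
(* The rational center costs a second radius: points of the box lie within [2 / k.+1 < e] of
   [Z w]. *)
pose k := Num.truncn (2 / e).
have k0 : 0 < (k.+1%:R^-1 : R) by rewrite invr_gt0.
have ke : k.+1%:R^-1 + k.+1%:R^-1 < e.
  have : 2 / e < k.+1%:R by exact: truncnS_gt.
  by rewrite ltr_pdivrMr// [_ * e]mulrC -ltr_pdivrMr ?ltr0n// -mulr2n -[X in _ -> X < _]mulr_natl.
have hq i j : exists r : rat, `|ratr r - Z w i j| < k.+1%:R^-1.
  have [|r] := @rat_in_itvoo R (Z w i j - k.+1%:R^-1) (Z w i j + k.+1%:R^-1).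
    by rewrite ltrD2l (lt_trans _ k0)// oppr_lt0.
  by rewrite in_itv/= -ltr_distl => h; exists r.
pose q : 'M[rat]_(m, n) := \matrix_(i, j) projT1 (cid (hq i j)).
exists (q, k) => //; rewrite /F; case: asboolP => [_ i j /=|].
  by rewrite mxE; case: cid.
case=> N Nb; apply: eU; split => // i j.
have := Nb i j; rewrite /= mxE; case: cid => r /= h1 h2.
rewrite /ball/=; apply: le_lt_trans ke.
rewrite (_ : Z w i j - N i j = (Z w i j - ratr r) + (ratr r - N i j)); last by ring.
by apply: (le_trans (ler_normD _ _)); rewrite lerD ?(ltW h2)// distrC ltW.
Qed.

End BorelMatrices.

Section Levy.
Context (d : measure_display) (Omega : measurableType d) (R : realType).
Variable P : probability Omega R.

Lemma mean_dist_le (X Y : Omega -> R) (A : set Omega) (e D : R) :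
  integrable_rv P X -> integrable_rv P Y -> measurable A -> 0 <= e ->
  (forall w, `|X w - Y w| <= D) -> (forall w, ~ A w -> `|X w - Y w| <= e) ->
  `|mean P X - mean P Y| <= e + D * fine (P A).
Proof.
move=> iX iY mA e0 bD be; rewrite -meanB//.
have iA : integrable_rv P \1_A by exact: integrable_indic.
have iAD : integrable_rv P (fun w => D * \1_A w) by exact: integrable_rvZ.
rewrite -mean_indic// -(meanZ _ iA) -{1}(mean_cst P e) -(meanD (integrable_rv_cst e) iAD).
apply: le_norm_mean; first exact: integrable_rvB.
  by apply: integrable_rvD => //; exact: integrable_rv_cst.
move=> w; rewrite indicE; case: (boolP (w \in A)) => [_|].
  by rewrite mulr1 (le_trans (bD w)) ?lerDr.
by rewrite notin_setE => /be; rewrite mulr0 addr0.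
Qed.

Lemma trigpoly_mean n (p : 'cV[R]_n -> R) (Z : Omega -> 'cV[R]_n) : trigpoly p -> random_mx Z ->
  integrable_rv P (fun w => p (Z w)).
Proof.
move=> tp mZ; elim: tp => [c a th|p1 p2 _ IH1 _ IH2]; last exact: integrable_rvD.
apply: integrable_rvZ; apply: (bounded_integrable (C := 1)); last by move=> w; exact: cos_max.
apply: measurable_cos; apply: measurable_funD => //.
rewrite (_ : (fun w => _) = (fun w => \sum_i a i 0 * Z w i 0)); last first.
  by apply/funext => w; rewrite dotvE.
by apply: measurable_sum => i; apply: measurable_funM.
Qed.

Lemma continuous_mean n (f : 'cV[R]_n -> R) (C : R) (Z : Omega -> 'cV[R]_n) :
  continuous f -> (forall x, `|f x| <= C) -> random_mx Z ->
  integrable_rv P (fun w => f (Z w)).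
Proof.
move=> cf bf mZ; apply: (bounded_integrable (C := C)) => //.
exact: (measurableT_comp (continuous_borel_mx cf) (random_mx_measurable mZ)).
Qed.

Definition tight n (Z : nat -> Omega -> 'cV[R]_n) : Prop :=
  forall e, 0 < e -> exists2 M, 0 < M & \forall J \near \oo,
    exists A : set Omega, [/\ measurable A, (P A <= e%:E)%E &
      forall w, ~ A w -> forall i, `|Z J w i 0| <= M].

End Levy.

Section LevyContinuity.
Context (d : measure_display) (Omega : measurableType d) (R : realType).
Variables (P : probability Omega R) (n : nat) (nu : probability (borel_mx R n 1) R).
Variable Z : nat -> Omega -> 'cV[R]_n.

Let random_id : random_mx (fun x : borel_mx R n 1 => x : 'cV[R]_n).
Proof. by move=> i j; exact: measurable_entry. Qed.

(** The exceedance sets decrease to the empty set, so their indicators tend to 0 pointwise and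
    dominated convergence makes their mass small. *)
Lemma tight_id (e : R) : 0 < e -> exists2 M, 0 < M &
  exists A : set (borel_mx R n 1), [/\ measurable A, (nu A <= e%:E)%E &
      forall x : 'cV[R]_n, ~ A x -> forall i, `|x i 0| <= M].
Proof.
move=> e0.
pose A (k : nat) : set (borel_mx R n 1) := [set x : 'cV[R]_n | exists i, k.+1%:R < `|x i 0|].
have mA k : measurable (A k).
  rewrite (_ : A k = \big[setU/set0]_i ((fun x : 'cV[R]_n => `|x i 0|) @^-1` `]k.+1%:R, +oo[)).
    apply: bigsetU_measurable => i _; rewrite -[X in measurable X]setTI.
    have : measurable_fun setT (fun x : borel_mx R n 1 => `|(x : 'cV[R]_n) i 0|).
      by apply: measurableT_comp => //; exact: measurable_entry.
    by apply.
  rewrite -bigcup_seq; apply/seteqP; split => [x [i xi]|x [i _ /=]].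
    by exists i; rewrite /= ?mem_index_enum// in_itv/= xi.
  by rewrite in_itv/= andbT => xi; exists i.
have lim : mean nu (\1_(A k)) @[k --> \oo] --> mean nu (fun=> 0).
  apply: (@dominated_mean _ _ _ nu _ _ (fun=> 1)).
  - by move=> k; exact: measurable_indic.
  - move=> x; apply: cvg_near_cst; near=> k.
    rewrite indicE memNset// => -[i]; apply/negP; rewrite -leNgt.
    have xM : `|(x : 'cV[R]_n) i 0| <= \sum_i `|(x : 'cV[R]_n) i 0|.
      by rewrite (bigD1 i)//= lerDl sumr_ge0.
    apply: (le_trans xM); apply: (le_trans (ltW (truncnS_gt _))).
    by rewrite ler_nat ltnS; near: k; exact: nbhs_infty_ge.
  - exact: integrable_rv_cst.
  - by move=> k x; rewrite indicE; case: (_ \in _); rewrite ?normr1 ?normr0.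
rewrite mean_cst in lim.
near \oo => k; exists k.+1%:R => //; exists (A k); split => //.
  rewrite -[leLHS]fineK ?fin_num_measure// lee_fin -mean_indic//.
  near: k; move/cvgrPdist_le : lim => /(_ _ e0); apply: filterS => k.
  by rewrite sub0r normrN; apply: le_trans; exact: ler_norm.
by move=> x xA i; rewrite leNgt; apply/negP => xi; apply: xA; exists i.
Unshelve. all: by end_near. Qed.

Lemma cvg_mean_trigpoly p : (forall J, random_mx (Z J)) ->
  (forall a th, mean P (fun w => cos (dotv a (Z J w) + th)) @[J --> \oo]
    --> mean nu (fun x => cos (dotv a x + th))) ->
  trigpoly p -> mean P (fun w => p (Z J w)) @[J --> \oo] --> mean nu p.
Proof.
move=> mZ lim; elim => [c a th|p1 p2 t1 IH1 t2 IH2].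
  have i1 J : integrable_rv P (fun w => cos (dotv a (Z J w) + th)).
    have := trigpoly_mean P (trigpoly_cos 1 a th) (mZ J).
    by under eq_fun do rewrite mul1r.
  have i2 : integrable_rv nu (fun x => cos (dotv a x + th)).
    have := trigpoly_mean nu (trigpoly_cos 1 a th) random_id.
    by under eq_fun do rewrite mul1r.
  rewrite meanZ//; under eq_fun do rewrite meanZ//.
  by apply: cvgM => //; exact: cvg_cst.
rewrite meanD; [|exact: (trigpoly_mean nu t1 random_id)|exact: (trigpoly_mean nu t2 random_id)].
rewrite (_ : (fun J => _) = (fun J => mean P (fun w => p1 (Z J w)) + mean P (fun w => p2 (Z J w)))).
  exact: cvgD.
by apply/funext => J; rewrite meanD//; exact: trigpoly_mean.
Qed.

Theorem levy : (forall J, random_mx (Z J)) -> tight P Z ->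
  (forall a th, mean P (fun w => cos (dotv a (Z J w) + th)) @[J --> \oo]
    --> mean nu (fun x => cos (dotv a x + th))) ->
  cvg_in_law P Z nu.
Proof.
move=> mZ tZ lim f cf [C bf].
have iZ J : integrable_rv P (fun w => f (Z J w)) by exact: continuous_mean bf (mZ J).
have inu : integrable_rv nu f by exact: continuous_mean bf random_id.
have -> : (\int[nu]_x (f x)%:E = (mean nu f)%:E)%E by rewrite fineK// integrable_fin_num.
under eq_fun do rewrite integrable_meanE//.
apply: cvg_EFin; first exact: nearW.
apply/cvgrPdist_le => e e0.
have C0 : 0 <= C by exact: le_trans (bf 0).
(* Outside the box [f] and its approximant differ by up to [C + C]; this mass keeps that
   contribution below [e / 4], and the added 1 covers [C = 0]. The budget is [e / 8 + e / 4] for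
   each of the two laws and [e / 4] for the trigonometric polynomial. *)
pose e1 := e / 4 / (C + C + 1).
have D0 : 0 < C + C + 1 by lra.
have e10 : 0 < e1 by rewrite !divr_gt0.
have De1 : (C + C) * e1 <= e / 4.
  by rewrite /e1 mulrA ler_pdivrMr// mulrC ler_wpM2l//; lra.
have [M1 M10 near1] := tZ _ e10.
have [M2 M20 [A2 [mA2 PA2 ZA2]]] := tight_id e10.
have M0 : 0 < Num.max M1 M2 by rewrite lt_max M10.
have e8 : 0 < e / 8 by rewrite divr_gt0.
have [p [tp bp fp]] := trigpoly_approx cf bf M0 e8.
have limp := cvg_mean_trigpoly mZ lim tp.
have bfp x : `|f x - p x| <= C + C.
  by apply: (le_trans (ler_normB _ _)); rewrite lerD.
have fineP d1 (T1 : measurableType d1) (Q : probability T1 R) (A : set T1) :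
    measurable A -> (Q A <= e1%:E)%E -> (C + C) * fine (Q A) <= e / 4.
  move=> mA QA; apply: le_trans De1; apply: ler_wpM2l; first by lra.
  by rewrite -lee_fin fineK// fin_num_measure.
have h2 : `|mean nu f - mean nu p| <= e / 8 + e / 4.
  apply: (le_trans (mean_dist_le (A := A2) (e := e / 8) (D := C + C) inu _ mA2 _ _ _)).
  - exact: (trigpoly_mean nu tp random_id).
  - by lra.
  - by [].
  - by move=> x xA; apply: fp => i; rewrite le_max (ZA2 _ xA) orbT.
  - by rewrite lerD2l; exact: fineP.
near=> J.
have [A [mA PA ZA]] : exists A : set Omega, [/\ measurable A, (P A <= e1%:E)%E &
      forall w, ~ A w -> forall i, `|Z J w i 0| <= M1] by near: J.
have h1 : `|mean P (fun w => f (Z J w)) - mean P (fun w => p (Z J w))| <= e / 8 + e / 4.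
  apply: (le_trans (mean_dist_le (A := A) (e := e / 8) (D := C + C) (iZ J) _ mA _ _ _)).
  - exact: trigpoly_mean.
  - by lra.
  - by [].
  - by move=> x xA; apply: fp => i; rewrite le_max (ZA _ xA).
  - by rewrite lerD2l; exact: fineP.
have h3 : `|mean nu p - mean P (fun w => p (Z J w))| <= e / 4.
  by near: J; apply/(cvgrPdist_le _ _).1 => //; rewrite divr_gt0.
move: h1 h2 h3; rewrite /= !ler_norml => /andP[? ?] /andP[? ?] /andP[? ?]; apply/andP; split; lra.
Unshelve. all: by end_near. Qed.

End LevyContinuity.

(** * Normal laws *)

Section NormalDensity.
Variables (R : realType) (m s : R).
Notation mu := (@lebesgue_measure R).

(** The Radon-Nikodym derivative of the normal law agrees almost everywhere with its density, as
    both have the same integral over every measurable set. *)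
Lemma integral_normal_prob (f : R -> R) : (normal_prob m s).-integrable setT (EFin \o f) ->
  (\int[normal_prob m s]_x (f x)%:E = \int[mu]_x (f x * normal_pdf m s x)%:E)%E.
Proof.
move=> intf; have mf := measurable_int _ intf.
have dom := normal_prob_dominates m s.
rewrite -(Radon_Nikodym_change_of_variables dom)//=.
apply: ae_eq_integral => //.
- apply: emeasurable_funM; first exact: mf.
  apply: (measurable_int mu).
  by apply: Radon_Nikodym_integrable; exact: dom.
- apply/measurable_EFinP/measurable_funM; first exact/measurable_EFinP.
  exact: measurable_normal_pdf.
under [in X in ae_eq _ _ _ X]eq_fun do rewrite EFinM.
apply: ae_eqe_mul2l => /=; apply: integral_ae_eq => //=.
- by apply: Radon_Nikodym_integrable; exact: dom.
- by apply/measurable_EFinP; exact: measurable_normal_pdf.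
- by move=> E _ mE; rewrite -Radon_Nikodym_integral.
Qed.

End NormalDensity.

(** * The characteristic function of a centered normal law, by a differential equation *)

Section GaussianCharacteristicFunction.
Variables (R : realType) (s : R).
Hypothesis s0 : s != 0.
Notation mu := (@lebesgue_measure R).
Let g (x : R) := normal_pdf 0 s x.
Implicit Types t th x : R.

Let gE x : g x = normal_peak s * expR (- x ^+ 2 / (s ^+ 2 *+ 2)).
Proof. by rewrite /g normal_pdfE// /normal_fun subr0. Qed.

Let s2 : 0 < s ^+ 2. Proof. by rewrite exprn_even_gt0. Qed.

Let g0 x : 0 <= g x. Proof. exact: normal_pdf_ge0. Qed.

Let mg : measurable_fun setT g. Proof. exact: measurable_normal_pdf. Qed.

Let dominated (f G : R -> R) : measurable_fun setT f -> (forall x, `|f x| <= G x) ->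
  mu.-integrable setT (EFin \o G) -> mu.-integrable setT (EFin \o f).
Proof.
move=> mf fG; apply: le_integrable => //; first exact/measurable_EFinP.
by move=> x _ /=; rewrite lee_fin (le_trans (fG x))// ler_norm.
Qed.

(** A multiple of the normal density of doubled variance dominates. With [y = x ^+ 2 / (4 * s ^+ 2)]
    the exponential in [g] is e^(-2y): one factor e^(-y) is kept, the other absorbs |x|, since |x|
    <= |s| (1 + y) <= |s| e^y. *)
Lemma integrable_norm_mul_normal_pdf : mu.-integrable setT (fun x => (`|x| * g x)%:E).
Proof.
pose s' := Num.sqrt 2 * s.
have s'0 : s' != 0 by rewrite mulf_neq0// gt_eqF// sqrtr_gt0.
have s'2 : s' ^+ 2 = 2 * s ^+ 2 by rewrite exprMn sqr_sqrtr.
pose K := `|s| * normal_peak s / normal_peak s'.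
have p' : 0 < normal_peak s' by exact: normal_peak_gt0.
apply: (dominated (G := fun x => K * normal_pdf 0 s' x)).
- by apply: measurable_funM => //; exact: measurableT_comp.
- move=> x.
  have K0 : 0 <= K by rewrite !mulr_ge0 ?invr_ge0 ?normal_peak_ge0.
  rewrite normrM normr_id (ger0_norm (g0 x)).
  rewrite gE normal_pdfE// /normal_fun subr0 s'2 /K.
  set y := x ^+ 2 / (4 * s ^+ 2).
  have -> : - x ^+ 2 / (s ^+ 2 *+ 2) = - y + - y by rewrite /y -mulr_natr; field; rewrite s0.
  have -> : - x ^+ 2 / ((2 * s ^+ 2) *+ 2) = - y by rewrite /y -mulr_natr; field; rewrite s0.
  rewrite expRD mulrA mulrA [X in _ <= X]mulrA divfK ?gt_eqF//.
  apply: ler_wpM2r; first exact: expR_ge0.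
  rewrite [`|x| * _]mulrC [`|s| * _]mulrC -mulrA; apply: ler_wpM2l; first exact: normal_peak_ge0.
  have sn : 0 < `|s| by rewrite normr_gt0.
  have h1 : `|x| <= `|s| * (1 + y).
    have yE : `|s| * y = `|x| ^+ 2 / (4 * `|s|).
      by rewrite /y -(real_normK (num_real x)) -(real_normK (num_real s)); field; rewrite gt_eqF.
    rewrite mulrDr mulr1 yE -subr_ge0.
    have -> : `|s| + `|x| ^+ 2 / (4 * `|s|) - `|x| = (2 * `|s| - `|x|) ^+ 2 / (4 * `|s|).
      by field; rewrite gt_eqF.
    by rewrite divr_ge0 ?sqr_ge0// mulr_ge0.
  rewrite expRN ler_pdivrMr ?expR_gt0//; apply: (le_trans h1); rewrite ler_wpM2l//.
  exact: expR_ge1Dx.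
- by apply: (integrableZl _ K (integrable_normal_pdf 0 s')).
Qed.

Let H th t := (\int[mu]_x (cos (t * x + th) * g x))%R.

Let mtrig (f : R -> R) t th : continuous f -> measurable_fun setT (fun x => f (t * x + th)).
Proof.
move=> cf; apply: (measurableT_comp (f := f)); first exact: continuous_measurable_fun.
by apply: measurable_funD => //; exact: measurable_funM.
Qed.

Let ic (f : R -> R) t th : continuous f -> (forall x, `|f x| <= 1) ->
  mu.-integrable setT (EFin \o (fun x => f (t * x + th) * g x)).
Proof.
move=> cf bf; apply: (dominated (G := g)).
- by apply: measurable_funM => //; exact: mtrig.
- by move=> x; rewrite normrM (ger0_norm (g0 x)) ler_piMl.
- exact: integrable_normal_pdf.
Qed.

Let ixc (f : R -> R) t th : continuous f -> (forall x, `|f x| <= 1) ->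
  mu.-integrable setT (EFin \o (fun x => (x * f (t * x + th)) * g x)).
Proof.
move=> cf bf; apply: (dominated (G := fun x => `|x| * g x)).
- by apply: measurable_funM => //; apply: measurable_funM => //; exact: mtrig.
- move=> x; rewrite !normrM (ger0_norm (g0 x)); apply: ler_wpM2r => //.
  by rewrite ler_piMr.
- exact: integrable_norm_mul_normal_pdf.
Qed.

Let dF t th x : is_derive t 1 (fun t => cos (t * x + th) * g x) (- (x * sin (t * x + th) * g x)).
Proof. by apply: is_derive_eq; rewrite /GRing.scale/=; ring. Qed.

Let derivableP (f : R -> R) x df : is_derive x 1 f df -> derivable f x 1.
Proof. by move=> fdf; exact: ex_derive. Qed.

Let deriveP (f : R -> R) x df : is_derive x 1 f df -> 'D_1 f x = df.
Proof. by move=> fdf; exact: derive_val. Qed.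

(** Differentiation under the integral on a neighborhood of [t]: the derivative of the integrand is
    dominated by |x| g(x), uniformly in [t]. *)
Let dH th t : is_derive t 1 (H th) (- \int[mu]_x (x * sin (t * x + th) * g x))%R.
Proof.
have tI : `]t - 1, t + 1[%classic t by rewrite /= in_itv/= ltrBlDr !ltrDl ltr01.
have p1 x y : partial1of2 (fun t x => cos (t * x + th) * g x) x y = - (y * sin (x * y + th) * g y).
  by rewrite partial1of2E; apply: deriveP; exact: dF.
have ub x y : `|partial1of2 (fun t x => cos (t * x + th) * g x) x y| <= `|y| * g y.
  rewrite p1 normrN !normrM (ger0_norm (g0 y)); apply: ler_wpM2r => //.
  by rewrite ler_piMr// sin_max.
have int x : `]t - 1, t + 1[%classic x -> mu.-integrable setT (EFin \o (fun y => cos (x * y + th) * g y)).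
  by move=> _; apply: ic; [exact: continuous_cos|exact: cos_max].
have der x y : `]t - 1, t + 1[%classic x -> setT y -> derivable ((fun t x => cos (t * x + th) * g x) ^~ y) x 1.
  by move=> _ _; exact: derivableP (dF x th y).
have G0 y : 0 <= `|y| * g y by rewrite mulr_ge0.
apply: DeriveDef.
  exact: (derivable_under_integral measurableT tI int der G0 integrable_norm_mul_normal_pdf (fun x y _ _ => ub x y)).
rewrite -derive1E (differentiation_under_integral measurableT tI int der G0 integrable_norm_mul_normal_pdf (fun x y _ _ => ub x y)).
have -> : - (\int[mu]_x (x * sin (t * x + th) * g x))%R = -1 * (\int[mu]_x (x * sin (t * x + th) * g x))%R.
  by rewrite mulN1r.
rewrite -RintegralZl//; last by apply: ixc; [exact: continuous_sin|exact: sin_max].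
by apply: eq_Rintegral => x _; rewrite p1 mulN1r.
Qed.

Let h t th x := sin (t * x + th) * g x.
(** The derivative of [h], by g' = - x g / s^2; that it integrates to 0 is the integration by parts
    behind the differential equation. *)
Let h' t th x := t * (cos (t * x + th) * g x) - (s ^+ 2)^-1 * (x * sin (t * x + th) * g x).

Let dh t th x : is_derive x 1 (h t th) (h' t th x).
Proof.
rewrite (_ : h t th = fun x => sin (t * x + th) * (normal_peak s * expR (- x ^+ 2 / (s ^+ 2 *+ 2)))); last first.
  by apply/funext => y; rewrite /h gE.
rewrite /h' gE; apply: is_derive_eq; rewrite /GRing.scale/= -mulr_natr.
by field; rewrite s0.
Qed.

Let ih' t th : mu.-integrable setT (EFin \o h' t th).
Proof.
have i1 : mu.-integrable setT (EFin \o (fun x => t * (cos (t * x + th) * g x))).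
  by apply: (integrableZl _ t (ic (f := cos) t th _ _)) => //; [exact: continuous_cos|exact: cos_max].
have i2 : mu.-integrable setT (EFin \o (fun x => (s ^+ 2)^-1 * (x * sin (t * x + th) * g x))).
  by apply: (integrableZl _ _ (ixc (f := sin) t th _ _)) => //; [exact: continuous_sin|exact: sin_max].
exact: (integrableB _ i1 i2).
Qed.

Let mh' t th : measurable_fun setT (h' t th).
Proof. by have /measurable_int/measurable_EFinP := ih' t th. Qed.

Let ch' t th : continuous (h' t th).
Proof.
rewrite (_ : h' t th = fun x => t * (cos (t * x + th) * (normal_peak s * expR (- x ^+ 2 / (s ^+ 2 *+ 2))))
   - (s ^+ 2)^-1 * (x * sin (t * x + th) * (normal_peak s * expR (- x ^+ 2 / (s ^+ 2 *+ 2))))); last first.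
  by apply/funext => x; rewrite /h' gE.
move=> x; apply: differentiable_continuous; apply/derivable1_diffP.
exact: ex_derive.
Qed.

Let h_bound t th (n : nat) x : (0 < n)%N -> `|x| = n%:R ->
  `|h t th x| <= normal_peak s * (s ^+ 2 *+ 2) / n%:R.
Proof.
move=> n0 xn; have n1 : 0 < (n%:R : R) by rewrite ltr0n.
rewrite /h normrM (ger0_norm (g0 x)); apply: (@le_trans _ _ (g x)); first by rewrite ler_piMl// sin_max.
rewrite gE -mulrA; apply: ler_wpM2l; first exact: normal_peak_ge0.
rewrite mulNr expRN -[X in _ <= X]invrK lef_pV2 ?posrE ?expR_gt0 ?invr_gt0 ?divr_gt0 ?pmulrn_lgt0//.
apply: le_trans (expR_ge1Dx _).
rewrite invfM invrK -(real_normK (num_real x)) xn mulrC.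
have D0 : 0 <= (s ^+ 2 *+ 2)^-1 by rewrite invr_ge0 pmulrn_lge0// ltW.
apply: (@le_trans _ _ (n%:R ^+ 2 / (s ^+ 2 *+ 2))); last by rewrite lerDr.
by apply: ler_wpM2r => //; rewrite expr2 ler_peMl// ler1n.
Qed.

Let B (n : nat) : set R := [set` `[- n%:R, n%:R] : interval R].

Let int_h'_itv t th (n : nat) : (0 < n)%N ->
  (\int[mu]_(x in B n) (h' t th x)%:E = (h t th n%:R - h t th (- n%:R)%R)%:E)%E.
Proof.
move=> n0; have n1 : 0 < (n%:R : R) by rewrite ltr0n.
have ch : continuous (h t th).
  by move=> x; apply: differentiable_continuous; apply/derivable1_diffP; exact: derivableP (dh t th x).
rewrite /B (@continuous_FTC2 _ (h' t th) (h t th))//.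
- by rewrite gtrN.
- exact: continuous_subspaceT.
- split.
  + by move=> x _; exact: derivableP (dh t th x).
  + by apply: cvg_at_right_filter; exact: ch.
  + by apply: cvg_at_left_filter; exact: ch.
- by move=> x _; rewrite derive1E; apply: deriveP; exact: dh.
Qed.

(** The fundamental theorem on [-n, n] leaves boundary terms of order 1 / n, and dominated
    convergence removes the cutoff. *)
Let int_h' t th : (\int[mu]_x h' t th x = 0)%R.
Proof.
have lim1 : (\int[mu]_x ((h' t th \_ (B n)) x)%:E @[n --> \oo] --> \int[mu]_x (h' t th x)%:E)%E.
  apply: (@dominated_cvg _ _ _ mu setT measurableT
     (fun n x => ((h' t th \_ (B n)) x)%:E) _ (fun x => `|h' t th x|%:E)) => //=.
  - move=> n; apply/measurable_EFinP; apply/(measurable_restrict _ _ _) => //; first exact: measurable_itv.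
    by apply: measurable_funS (mh' t th).
  - move=> x _; apply: cvg_near_cst; near=> n.
    rewrite patchE mem_set// /B/= in_itv/= -ler_norml.
    rewrite (le_trans (ltW (truncnS_gt _)))// ler_nat; near: n; exact: nbhs_infty_ge.
  - exact: integrable_norm.
  - by move=> n x _; rewrite lee_fin patchE; case: ifP => // _; rewrite normr0.
have E n : (0 < n)%N -> (\int[mu]_x ((h' t th \_ (B n)) x)%:E = (h t th n%:R - h t th (- n%:R)%R)%:E)%E.
  move=> n0; rewrite -int_h'_itv// [RHS]integral_mkcond.
  by apply: eq_integral => x _; rewrite restrict_EFin.
have lim2 : h t th n%:R - h t th (- n%:R) @[n --> \oo] --> (0 : R).
  apply: (@cvg_bound_invsqrt _ _ _ (normal_peak s * (s ^+ 2 *+ 2) + normal_peak s * (s ^+ 2 *+ 2))) => n n0.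
  rewrite subr0; apply: (le_trans (ler_normB _ _)).
  have b1 := @h_bound t th n n%:R n0 (normr_nat _ n).
  have b2 := @h_bound t th n (- n%:R) n0 (eq_trans (normrN _) (normr_nat _ n)).
  apply: (le_trans (lerD b1 b2)); rewrite -mulrDl; apply: ler_wpM2l.
    by rewrite addr_ge0// mulr_ge0 ?normal_peak_ge0// pmulrn_lge0// ltW.
  rewrite lef_pV2 ?posrE ?sqrtr_gt0 ?ltr0n//.
  rewrite -[X in _ <= X](ger0_norm (ler0n R n)) -sqrtr_sqr ler_sqrt ?sqr_ge0//.
  by rewrite expr2 ler_peMl// ler1n.
have lim3 : (\int[mu]_x ((h' t th \_ (B n)) x)%:E @[n --> \oo] --> (0:R)%:E)%E.
  have lim2' : ((h t th n%:R - h t th (- n%:R)%R)%:E @[n --> \oo] --> (0:R)%:E)%E.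
    by apply: cvg_EFin => //; exact: nearW.
  apply: cvg_trans lim2'.
  apply: near_eq_cvg; near=> n; rewrite E//; near: n; exact: nbhs_infty_gt.
by rewrite /Rintegral -(cvg_lim _ lim1)// (cvg_lim _ lim3).
Unshelve. all: by end_near. Qed.

Let H_ode t th : (\int[mu]_x (x * sin (t * x + th) * g x) = s ^+ 2 * t * H th t)%R.
Proof.
have i1 := ic (f := cos) t th (@continuous_cos R) (@cos_max R).
have i2 := ixc (f := sin) t th (@continuous_sin R) (@sin_max R).
have := int_h' t th; rewrite /h' RintegralB//; last 2 first.
- exact: (integrableZl _ t i1).
- exact: (integrableZl _ (s ^+ 2)^-1 i2).
rewrite !RintegralZl// => /eqP; rewrite subr_eq0 => /eqP E.
by rewrite -mulrA /H E mulrA divff ?gt_eqF// mul1r.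
Qed.

(** As a function of [t], [H th] solves H' = - s^2 t H, so its product with
    [expR (t ^+ 2 * s ^+ 2 / 2)] is constant. *)
Lemma cos_normal_integral t th : H th t = expR (- (t ^+ 2 * s ^+ 2 / 2)) * cos th.
Proof.
pose G t := H th t * expR (t ^+ 2 * s ^+ 2 / 2).
have dG (u : R) : is_derive u 1 G 0.
  have dHu := dH th u; rewrite H_ode in dHu.
  by rewrite /G; apply: is_derive_eq; rewrite /GRing.scale/=; field.
have GE : G t = G 0 by exact: is_derive_0_is_cst.
have H0 : H th 0 = cos th.
  rewrite /H; under eq_Rintegral do rewrite mul0r add0r.
  rewrite RintegralZl//; last exact: integrable_normal_pdf.
  by rewrite /Rintegral integral_normal_pdf mulr1.
move: GE; rewrite /G H0 expr0n/= !mul0r expR0 mulr1 => <-.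
by rewrite mulrCA expRN mulVf ?mulr1// gt_eqF// expR_gt0.
Qed.

Theorem normal_characteristic_function t th :
  mean (normal_prob 0 s) (fun x => cos (t * x + th)) = expR (- (t ^+ 2 * s ^+ 2 / 2)) * cos th.
Proof.
rewrite -cos_normal_integral /H /Rintegral integral_normal_prob//.
apply: (bounded_integrable (C := 1)); last by move=> x; exact: cos_max.
exact: (mtrig t th (@continuous_cos R)).
Qed.

End GaussianCharacteristicFunction.

Section Pushforward.
Context (d d' : measure_display) (Omega : measurableType d) (S : measurableType d') (R : realType).

Lemma pushforward_probability (P : probability Omega R) (X : Omega -> S) :
  measurable_fun setT X -> exists nu : probability S R,
    (forall B, nu B = P (X @^-1` B)) /\
    (forall f : S -> R, measurable_fun setT f -> integrable_rv P (fun w => f (X w)) ->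
       mean nu f = mean P (fun w => f (X w))).
Proof.
move=> mX; pose X' : {mfun Omega >-> S} := HB.pack X (isMeasurableFun.Build _ _ _ _ X mX).
exists (distribution P X'); split => // f mf fX.
by rewrite /Rintegral integral_distribution//; exact/measurable_EFinP.
Qed.

End Pushforward.

(** * Gaussian vectors with a given covariance matrix *)

Section GaussianVectors.
Variable R : realType.

Definition gaussian_char n (V : 'M[R]_n) (a : 'cV[R]_n) (th : R) : R :=
  expR (- (dotv a (V *m a) / 2)) * cos th.

Lemma dotv_mulmx n (V : 'M[R]_n) (a b : 'cV[R]_n) :
  dotv a (V *m b) = \sum_i a i 0 * \sum_j V i j * b j 0.
Proof. by rewrite dotvE; apply: eq_bigr => i _; rewrite mxE. Qed.

Let tail n (a : 'cV[R]_n.+1) : 'cV[R]_n := \col_i a (lift ord0 i) 0.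
Let lower n (V : 'M[R]_n.+1) : 'M[R]_n := \matrix_(i, j) V (lift ord0 i) (lift ord0 j).
Let first_col n (V : 'M[R]_n.+1) : 'cV[R]_n := \col_i V (lift ord0 i) 0.

Lemma quadratic_formS n (V : 'M[R]_n.+1) (a : 'cV[R]_n.+1) : V^T = V ->
  dotv a (V *m a) = V 0 0 * a 0 0 ^+ 2 + 2 * a 0 0 * dotv (first_col V) (tail a)
    + dotv (tail a) (lower V *m tail a).
Proof.
move=> symV; have sV i j : V i j = V j i by rewrite -{1}symV mxE.
rewrite !dotv_mulmx big_ord_recl big_ord_recl.
have -> : \sum_(i < n) V 0 (lift ord0 i) * a (lift ord0 i) 0 = dotv (first_col V) (tail a).
  by rewrite dotvE; apply: eq_bigr => i _; rewrite !mxE sV.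
have -> : \sum_(i < n) a (lift ord0 i) 0 * (\sum_(j < n.+1) V (lift ord0 i) j * a j 0) =
   a 0 0 * dotv (first_col V) (tail a) + \sum_i tail a i 0 * \sum_j lower V i j * tail a j 0.
  rewrite dotvE mulr_sumr -big_split; apply: eq_bigr => i _.
  rewrite big_ord_recl /= !mxE mulrDr; congr (_ + _); first by ring.
  by congr (_ * _); apply: eq_bigr => j _; rewrite !mxE.
by ring.
Qed.

(* The Schur complement; division by V 0 0 = 0 gives 0, and then the first row vanishes. *)
Let schur n (V : 'M[R]_n.+1) : 'M[R]_n :=
  \matrix_(i, j) (lower V i j - first_col V i 0 * first_col V j 0 / V 0 0).

Lemma schur_quadratic_form n (V : 'M[R]_n.+1) (b : 'cV[R]_n) :
  dotv b (schur V *m b) = dotv b (lower V *m b) - dotv (first_col V) b ^+ 2 / V 0 0.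
Proof.
rewrite !dotv_mulmx.
have -> : dotv (first_col V) b ^+ 2 / V 0 0 =
  \sum_i b i 0 * \sum_j (first_col V i 0 * first_col V j 0 / V 0 0) * b j 0.
  rewrite dotvE expr2 mulr_suml mulr_suml; apply: eq_bigr => i _.
  rewrite !mulr_sumr mulr_suml; apply: eq_bigr => j _; ring.
rewrite -sumrB; apply: eq_bigr => i _; rewrite -mulrBr -sumrB; congr (_ * _).
by apply: eq_bigr => j _; rewrite mxE mulrBl.
Qed.

(** When the corner vanishes, the form is affine in the first coordinate with slope [2 * s], and an
    affine function that is nowhere negative has slope 0. *)
Lemma psd_first_col n (V : 'M[R]_n.+1) : V^T = V -> (forall a, 0 <= dotv a (V *m a)) ->
  V 0 0 = 0 -> forall b, dotv (first_col V) b = 0.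
Proof.
move=> symV psdV V0 b; set s := dotv _ _.
have q t : 0 <= 2 * t * s + dotv b (lower V *m b).
  pose a : 'cV[R]_n.+1 := \col_i (if unlift ord0 i is Some j then b j 0 else t).
  have := psdV a; rewrite quadratic_formS// V0 mul0r add0r.
  have -> : tail a = b by apply/colP => i; rewrite !mxE liftK.
  by rewrite [a 0 0]mxE unlift_none.
apply/eqP/negPn/negP => s0.
(* The point at which the affine function would equal -1. *)
have := q (- (dotv b (lower V *m b) + 1) / (2 * s)).
have -> : 2 * (- (dotv b (lower V *m b) + 1) / (2 * s)) * s = - (dotv b (lower V *m b) + 1).
  by field.
by rewrite opprD addrAC addNr add0r leNgt ltrN10.
Qed.

Lemma schur_sym n (V : 'M[R]_n.+1) : V^T = V -> (schur V)^T = schur V.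
Proof.
move=> symV; have sV i j : V i j = V j i by rewrite -{1}symV mxE.
by apply/matrixP => i j; rewrite !mxE sV; congr (_ - _ / _); rewrite mulrC.
Qed.

(** Completing the square: for nonzero [V 0 0], the first coordinate [- s / V 0 0] minimizes the
    form of [V], and the minimum is the form of the Schur complement. If [V 0 0 = 0], that
    coordinate is 0 and both forms reduce to that of [lower V]. *)
Lemma schur_psd n (V : 'M[R]_n.+1) : V^T = V -> (forall a, 0 <= dotv a (V *m a)) ->
  forall b, 0 <= dotv b (schur V *m b).
Proof.
move=> symV psdV b; rewrite schur_quadratic_form.
set s := dotv (first_col V) b.
pose a : 'cV[R]_n.+1 := \col_i (if unlift ord0 i is Some j then b j 0 else - s / V 0 0).
have := psdV a; rewrite quadratic_formS//.
have -> : tail a = b by apply/colP => i; rewrite !mxE liftK.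
rewrite [a 0 0]mxE unlift_none -/s; have [V0|V0] := eqVneq (V 0 0) 0.
  by rewrite V0 invr0 !mulr0 !mul0r add0r add0r subr0.
by congr (0 <= _); field.
Qed.

(** One Cholesky step per dimension: an independent standard normal [w.2] carries the first
    coordinate and its covariances with the others, and the Schur complement is the covariance that
    remains. When [V 0 0 = 0], [r] and [c] vanish and the first coordinate is constant. *)
Lemma gaussian_vector n (V : 'M[R]_n) : V^T = V -> (forall a, 0 <= dotv a (V *m a)) ->
  exists (d : measure_display) (Omega : measurableType d) (Q : probability Omega R)
    (G : Omega -> 'cV[R]_n), random_mx G /\
    forall a th, mean Q (fun w => cos (dotv a (G w) + th)) = gaussian_char V a th.
Proof.
elim: n V => [|n IH] V symV psdV.
  (* In dimension 0 any probability space will do; the standard normal law supplies one. *)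
  exists _, _, (normal_prob (0 : R) 1), (fun=> 0); split; first by move=> [].
  move=> a th; rewrite /gaussian_char !dotvE !big_ord0 mul0r oppr0 expR0 mul1r.
  by rewrite add0r mean_cst.
have [d [Om [Q [G [mG charG]]]]] := IH _ (schur_sym symV) (schur_psd symV psdV).
pose r := Num.sqrt (V 0 0).
pose c : 'cV[R]_n := \col_i (first_col V i 0 / r).
pose G' (w : Om * measurableTypeR R) : 'cV[R]_n.+1 :=
  \col_i (if unlift ord0 i is Some j then c j 0 * w.2 + G w.1 j 0 else r * w.2).
exists _, _, (Q \x normal_prob (0 : R) 1)%E, G'; split.
  move=> i k; rewrite (_ : (fun w => _) = (fun w : Om * measurableTypeR R =>
    if unlift ord0 i is Some j then c j 0 * w.2 + G w.1 j 0 else r * w.2)); last first.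
    by apply/funext => w; rewrite mxE.
  have m2 : measurable_fun setT (fun w : Om * measurableTypeR R => (w.2 : R)).
    exact: measurable_snd.
  case: unlift => [j|]; last exact: measurable_funM.
  apply: measurable_funD; first exact: measurable_funM.
  by apply: (measurableT_comp (mG j 0)); exact: measurable_fst.
move=> a th.
(* The total coefficient of the fresh normal variable in the linear form; integrating that variable
   out first leaves a cosine of a linear form of [G]. *)
pose t := a 0 0 * r + dotv (first_col V) (tail a) / r.
have dotG w : dotv a (G' w) = t * w.2 + dotv (tail a) (G w.1).
  rewrite dotvE big_ord_recl mxE unlift_none /t dotvE.
  rewrite (eq_bigr (fun i => (first_col V i 0 * tail a i 0) * (w.2 / r) + tail a i 0 * G w.1 i 0)).
    by rewrite big_split/= -mulr_suml dotvE; ring.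
  by move=> i _; rewrite !mxE liftK !mxE; ring.
have mdG : measurable_fun setT (fun w => dotv (tail a) (G w)).
  rewrite (_ : (fun w => _) = (fun w => \sum_i tail a i 0 * G w i 0)); last first.
    by apply/funext => w; rewrite dotvE.
  by apply: measurable_sum => i; apply: measurable_funM.
have icos : integrable_rv (Q \x normal_prob (0 : R) 1)%E
    (fun w : Om * measurableTypeR R => cos (t * w.2 + (dotv (tail a) (G w.1) + th))).
  apply: (bounded_integrable (C := 1)); last by move=> w; exact: cos_max.
  apply: measurable_cos; apply: measurable_funD.
    by apply: measurable_funM => //; exact: measurable_snd.
  by apply: measurable_funD => //; apply: (measurableT_comp mdG); exact: measurable_fst.
transitivity (mean (Q \x normal_prob (0 : R) 1)%E
   (fun w : Om * measurableTypeR R => cos (t * w.2 + (dotv (tail a) (G w.1) + th)))).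
  by congr (mean _ _); apply/funext => w; rewrite dotG addrA.
rewrite /Rintegral -(integral12_prod_meas1 icos) /fubini_F/=.
have E w : (\int[normal_prob (0:R) 1]_y (cos (t * y + (dotv (tail a) (G w) + th)))%:E =
    (expR (- (t ^+ 2 / 2)) * cos (dotv (tail a) (G w) + th))%:E)%E.
  rewrite -[LHS]fineK; last first.
    apply: integrable_fin_num => //.
    apply: (bounded_integrable (C := 1)); last by move=> y; exact: cos_max.
    apply: measurable_cos; apply: measurable_funD => //; exact: measurable_funM.
  congr (_%:E); rewrite -[LHS]/(mean _ _) normal_characteristic_function ?oner_neq0//.
  by rewrite expr1n mulr1.
under eq_integral do rewrite E.
rewrite -[LHS]/(mean Q (fun w => expR (- (t ^+ 2 / 2)) * cos (dotv (tail a) (G w) + th))).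
rewrite meanZ; last first.
  apply: (bounded_integrable (C := 1)); last by move=> y; exact: cos_max.
  by apply: measurable_cos; apply: measurable_funD.
rewrite charG /gaussian_char mulrA -expRD; congr (expR _ * _).
rewrite schur_quadratic_form (quadratic_formS a symV) /t.
have V00 : 0 <= V 0 0.
  pose e : 'cV[R]_n.+1 := \col_i (if unlift ord0 i is Some j then 0 else 1).
  have := psdV e; rewrite quadratic_formS//.
  have -> : tail e = 0 by apply/colP => i; rewrite !mxE liftK.
  rewrite mulmx0 [e 0 0]mxE unlift_none !dotvE !big1 => [|i _|i _]; rewrite ?mxE ?mulr0 ?mul0r//.
  by rewrite expr1n mulr1 !addr0.
have r2 : r ^+ 2 = V 0 0 by rewrite sqr_sqrtr.
have [V0|V0] := eqVneq (V 0 0) 0.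
  have r0 : r = 0 by rewrite /r V0 sqrtr0.
  by rewrite (psd_first_col symV psdV V0) r0 V0 invr0; field.
have r0 : r != 0 by rewrite -sqrf_eq0 r2.
by rewrite -r2; field.
Qed.

End GaussianVectors.

Section LinearForms.
Variable R : realType.

Lemma measurable_dotv n (a : 'cV[R]_n) : measurable_fun setT (fun x : borel_mx R n 1 => dotv a x).
Proof.
rewrite (_ : (fun x => _) = (fun x : borel_mx R n 1 => \sum_i a i 0 * (x : 'cV[R]_n) i 0)).
  by apply: measurable_sum => i; apply: measurable_funM => //; exact: measurable_entry.
by apply/funext => x; rewrite dotvE.
Qed.

Lemma dotvZl n (k : R) (a x : 'cV[R]_n) : dotv (k *: a) x = k * dotv a x.
Proof. by rewrite !dotvE mulr_sumr; apply: eq_bigr => i _; rewrite mxE mulrA. Qed.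

Lemma dotvZr n (k : R) (a x : 'cV[R]_n) : dotv a (k *: x) = k * dotv a x.
Proof. by rewrite !dotvE mulr_sumr; apply: eq_bigr => i _; rewrite mxE mulrCA. Qed.

End LinearForms.

(** * A law on the line is determined by its cosine transforms *)

Section LawUniqueness.
Variable R : realType.

(** A tent of slope [k] cut off at height 1; it increases with [k] to the indicator of the open
    interval. *)
Let bump (a b : R) (k : nat) (x : R) : R :=
  Num.min 1 (Num.max 0 (k%:R * Num.min (x - a) (b - x))).

Let continuous_bump a b k : continuous (bump a b k).
Proof.
have cid : continuous (fun x : R => x) by move=> x; exact: cvg_id.
have ccst (c : R) : continuous (fun _ : R => c) by move=> x; exact: cvg_cst.
have c1 : continuous (fun x => x - a) by move=> x; apply: cvgB; [exact: cid|exact: ccst].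
have c2 : continuous (fun x => b - x) by move=> x; apply: cvgB; [exact: ccst|exact: cid].
have c3 : continuous (fun x => k%:R * Num.min (x - a) (b - x)).
  move=> x; apply: cvgM; first exact: ccst.
  exact: (continuous_min (c1 x) (c2 x)).
have c4 : continuous (fun x => Num.max 0 (k%:R * Num.min (x - a) (b - x))).
  by move=> x; exact: (continuous_max (ccst 0 x) (c3 x)).
by move=> x; exact: (continuous_min (ccst 1 x) (c4 x)).
Qed.

Let bump01 a b k x : 0 <= bump a b k x <= 1.
Proof. by rewrite /bump le_min ler01 le_max lexx/= ge_min lexx. Qed.

Let cvg_bump a b x : bump a b k x @[k --> \oo] --> (\1_`]a, b[%classic x : R).
Proof.
rewrite indicE; case: (boolP (x \in _)) => [/set_mem|/negP xab].
  rewrite /= in_itv/= => /andP[ax xb].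
  have m0 : 0 < Num.min (x - a) (b - x) by rewrite lt_min !subr_gt0 ax.
  apply: cvg_near_cst; near=> k.
  have h : 1 <= k%:R * Num.min (x - a) (b - x).
    rewrite -ler_pdivrMr// (le_trans (ltW (truncnS_gt _)))// ler_nat.
    by near: k; exact: nbhs_infty_ge.
  by rewrite /bump max_r ?(le_trans ler01 h)// min_l.
apply: cvg_near_cst; apply: nearW => k.
have h : Num.min (x - a) (b - x) <= 0.
  rewrite leNgt; apply/negP; rewrite lt_min !subr_gt0 => /andP[ax xb].
  by apply: xab; apply/mem_set; rewrite /= in_itv/= ax.
rewrite /bump max_l; first by rewrite min_r.
by rewrite mulr_ge0_le0.
Unshelve. all: by end_near. Qed.

Context (d : measure_display) (Omega : measurableType d) (P : probability Omega R).
Variables (X : Omega -> R) (nu : probability (measurableTypeR R) R).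
Hypothesis mX : measurable_fun setT X.
Hypothesis char_eq : forall t th, mean P (fun w => cos (t * X w + th)) = mean nu (fun x => cos (t * x + th)).

Let col (x : R) : 'cV[R]_1 := const_mx x.

Let random_col d' (T : measurableType d') (Y : T -> R) : measurable_fun setT Y ->
  random_mx (fun w => col (Y w)).
Proof. by move=> mY i j; rewrite (_ : (fun w => _) = Y)//; apply/funext => w; rewrite mxE. Qed.

Let dotv_col a x : dotv a (col x) = a 0 0 * x.
Proof. by rewrite dotvE big_ord1 mxE. Qed.

(** The constant sequence [X] converges in law to [nu] by [levy], and the limit of a constant
    sequence of means is unique. Both laws are moved to columns of length 1, where [levy] is
    stated. *)
Let mean_continuous (h : R -> R) (C : R) : continuous h -> (forall x, `|h x| <= C) ->
  mean P (fun w => h (X w)) = mean nu h.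
Proof.
move=> ch bh.
have mid : measurable_fun setT (fun x : measurableTypeR R => x : R) by exact: measurable_id.
have [nu' [_ meannu']] := pushforward_probability nu (random_mx_measurable (random_col mid)).
have [nuP [nuPE _]] := pushforward_probability P (random_mx_measurable (random_col mX)).
have icos a th : integrable_rv nu (fun x => cos (a * x + th)).
  apply: (bounded_integrable (C := 1)); last by move=> x; exact: cos_max.
  by apply: measurable_cos; apply: measurable_funD => //; exact: measurable_funM.
have tightP : tight P (fun=> (fun w => col (X w))).
  move=> e e0; have [M M0 [A [mA PA ZA]]] := tight_id nuP e0.
  exists M => //; apply: nearW => J.
  exists ((fun w => col (X w)) @^-1` A); split.
  - rewrite -[X in measurable X]setTI.
    exact: (random_mx_measurable (random_col mX)).
  - by have := PA; rewrite nuPE.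
  - by move=> w wA; exact: ZA.
have lim : cvg_in_law P (fun=> (fun w => col (X w))) nu'.
  apply: levy => //; first by move=> _; exact: random_col.
  move=> a th; rewrite (_ : mean nu' _ = mean P (fun w => cos (dotv a (col (X w)) + th))); first exact: cvg_cst.
  rewrite meannu'; last 2 first.
  - apply: measurable_cos; apply: measurable_funD => //.
    exact: measurable_dotv.
  - by move: (icos (a 0 0) th); apply: eq_integrable => // x _; rewrite /= dotv_col.
  under eq_fun do rewrite dotv_col.
  by rewrite -char_eq; congr (mean P _); apply/funext => w; rewrite dotv_col.
have ch' : continuous (fun M : 'cV[R]_1 => h (M 0 0)).
  by move=> M; apply: continuous_comp; [exact: coord_continuous|exact: ch].
have mh : measurable_fun setT h by exact: continuous_measurable_fun.
have ihX : integrable_rv P (fun w => h (X w)).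
  by apply: (bounded_integrable (C := C)) => //; exact: (measurableT_comp mh).
have ih : integrable_rv nu h by apply: (bounded_integrable (C := C)).
have := lim (fun M => h (M 0 0)) ch' (ex_intro _ C (fun M => bh _)).
have colE x : (col x : 'cV[R]_1) 0 0 = x by rewrite mxE.
have -> : (fun w => h ((col (X w) : 'cV[R]_1) 0 0)) = (fun w => h (X w)).
  by apply/funext => w; rewrite colE.
rewrite integrable_meanE//.
have -> : (\int[nu']_x (h ((x : 'cV[R]_1) 0 0))%:E = (mean nu h)%:E)%E.
  have E := meannu' (fun M : 'cV[R]_1 => h (M 0 0)) (continuous_borel_mx ch').
  have Ec : (fun x => h ((col x : 'cV[R]_1) 0 0)) = h by apply/funext => x; rewrite colE.
  rewrite Ec in E; rewrite -E//; rewrite fineK//.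
  apply: integrable_fin_num => //; apply: (bounded_integrable (C := C)) => //.
  exact: continuous_borel_mx.
move=> H; have := cvg_unique _ (cvg_cst _) H.
by move=> /(_ (@ereal_hausdorff R) _ _) [].
Qed.

(** Open intervals generate the Borel sets and are stable under intersection; their masses agree as
    limits of means of [bump]. *)
Lemma law_unique (B : set R) : measurable B -> P (X @^-1` B) = nu B.
Proof.
move: B; have [nuX [nuXE _]] := pushforward_probability (S := measurableTypeR R) P mX.
suff H : forall B : set (measurableTypeR R), measurable B -> nuX B = nu B.
  by move=> B mB; rewrite -nuXE; exact: H.
apply: (@measure_unique _ R (measurableTypeR R) (@RGenOpens.G R) (fun k => `]- k%:R, k%:R[%classic) _ _ _ _ nuX nu).
- exact: RGenOpens.measurableE.
- move=> _ _ [a [b ->]] [a' [b' ->]]; exists (Num.max a a'), (Num.min b b').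
  apply/seteqP; split => x /=; rewrite !in_itv/= gt_max lt_min.
    by move=> [/andP[-> ->] /andP[-> ->]].
  by move=> /andP[/andP[-> ->] /andP[-> ->]].
- by move=> k; exists (- k%:R), k%:R.
- apply/seteqP; split => // x _; exists (Num.truncn `|x|).+1 => //=.
  by rewrite in_itv/= -ltr_norml; exact: truncnS_gt.
- move=> _ [a [b ->]].
  have mab : measurable (`]a, b[%classic : set R) by exact: measurable_itv.
  have mb k : measurable_fun setT (bump a b k) by exact: continuous_measurable_fun (@continuous_bump a b k).
  have bb k x : `|bump a b k x| <= 1 by have /andP[? ?] := bump01 a b k x; rewrite ger0_norm.
  have l1 : mean P (fun w => bump a b k (X w)) @[k --> \oo] --> mean P (fun w => \1_`]a, b[%classic (X w) : R).
    apply: (@dominated_mean _ _ _ P _ _ (fun=> 1)) => //.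
    - by move=> k; exact: (measurableT_comp (mb k)).
    - exact: integrable_rv_cst.
  have l2 : mean nu (bump a b k) @[k --> \oo] --> mean nu (\1_`]a, b[%classic : R -> R).
    apply: (@dominated_mean _ _ _ nu _ _ (fun=> 1)) => //.
    - exact: integrable_rv_cst.
  have E : (fun k => mean P (fun w => bump a b k (X w))) = (fun k => mean nu (bump a b k)).
    by apply/funext => k; apply: (mean_continuous (C := 1)) => //; exact: continuous_bump.
  rewrite E in l1.
  have := cvg_unique _ l1 l2.
  move=> /(_ (@Rhausdorff R) _).
  have mXab : measurable (X @^-1` `]a, b[) by rewrite -[X in measurable X]setTI; exact: mX.
  rewrite [X in _ = X]mean_indic// -[mean P _]/(mean P (\1_(X @^-1` `]a, b[))) mean_indic//.
  move=> H; transitivity (P (X @^-1` `]a, b[)); first exact: nuXE.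
  by rewrite -[LHS]fineK ?fin_num_measure// H fineK// fin_num_measure.
- by move=> k; rewrite (le_lt_trans (probability_le1 _ _)) ?ltry//; exact: measurable_itv.
Qed.

End LawUniqueness.

Section MultivariateNormal.
Variable R : realType.

(** The transform of the linear form [dotv a x] at [t] is that of [nu] at [t *: a], so uniqueness on
    the line identifies its law: a point mass when the variance is 0, a normal law otherwise. *)
Lemma mvnormal_exists n (V : 'M[R]_n) : V^T = V -> (forall a, 0 <= dotv a (V *m a)) ->
  exists nu : probability (borel_mx R n 1) R, is_mvnormal nu 0 V /\
    forall a th, mean nu (fun x => cos (dotv a x + th)) = gaussian_char V a th.
Proof.
move=> symV psdV; have [d [Om [Q [G [mG charG]]]]] := gaussian_vector symV psdV.
have [nu [nuE meannu]] := pushforward_probability Q (random_mx_measurable mG).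
have charnu a th : mean nu (fun x => cos (dotv a x + th)) = gaussian_char V a th.
  have mc : measurable_fun setT (fun x : borel_mx R n 1 => cos (dotv a x + th)).
    by apply: measurable_cos; apply: measurable_funD => //; exact: measurable_dotv.
  rewrite -charG meannu//; apply: (bounded_integrable (C := 1)); last by move=> w; exact: cos_max.
  exact: (measurableT_comp mc (random_mx_measurable mG)).
exists nu; split => // a B mB.
have chart t th : mean nu (fun x => cos (t * dotv a x + th)) = expR (- (t ^+ 2 * dotv a (V *m a) / 2)) * cos th.
  transitivity (mean nu (fun x => cos (dotv (t *: a) x + th))).
    by congr (mean nu _); apply/funext => x; rewrite dotvZl.
  rewrite charnu /gaussian_char dotvZl -scalemxAr dotvZr; congr (expR _ * _).
  by rewrite mulrA -expr2.
have -> : dotv a (0 : 'cV[R]_n) = 0 by rewrite dotvE big1// => i _; rewrite mxE mulr0.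
rewrite /normal_law; case: ifPn => [v0|]; last first.
  rewrite -leNgt => v0; have {}v0 : dotv a (V *m a) = 0 by apply/eqP; rewrite eq_le v0 psdV.
  apply: (law_unique (nu := (\d_(0 : measurableTypeR R) : probability _ R))) => //.
    exact: measurable_dotv.
  move=> t th; rewrite chart v0 mulr0 mul0r oppr0 expR0 mul1r.
  rewrite /Rintegral integral_dirac//; last first.
    by apply/measurable_EFinP; apply: measurable_cos; apply: measurable_funD => //; exact: measurable_funM.
  by rewrite diracT mul1e /= mulr0 add0r.
apply: (law_unique (nu := normal_prob 0 (Num.sqrt (dotv a (V *m a))))) => //.
  exact: measurable_dotv.
move=> t th; rewrite chart normal_characteristic_function ?gt_eqF ?sqrtr_gt0//.
by rewrite sqr_sqrtr// ltW.
Qed.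

End MultivariateNormal.

(** * Perturbation of linear systems *)

Section EntrywiseNorm.
Variable R : realType.

(** Unlike the largest absolute entry, this norm is submultiplicative without dimension factors. *)
Definition mxl1 m n (M : 'M[R]_(m, n)) : R := \sum_i \sum_j `|M i j|.

Lemma mxl1_ge0 m n (M : 'M[R]_(m, n)) : 0 <= mxl1 M.
Proof. by apply: sumr_ge0 => i _; apply: sumr_ge0. Qed.

Lemma entry_le_mxl1 m n (M : 'M[R]_(m, n)) i j : `|M i j| <= mxl1 M.
Proof.
rewrite /mxl1 (bigD1 i)//= (bigD1 j)//= -addrA lerDl addr_ge0//; first exact: sumr_ge0.
by apply: sumr_ge0 => k _; apply: sumr_ge0.
Qed.

Lemma mxl1D m n (M N : 'M[R]_(m, n)) : mxl1 (M + N) <= mxl1 M + mxl1 N.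
Proof.
rewrite /mxl1 -big_split; apply: ler_sum => i _; rewrite -big_split.
by apply: ler_sum => j _; rewrite mxE ler_normD.
Qed.

Lemma mxl1N m n (M : 'M[R]_(m, n)) : mxl1 (- M) = mxl1 M.
Proof. by apply: eq_bigr => i _; apply: eq_bigr => j _; rewrite mxE normrN. Qed.

Lemma mxl1B m n (M N : 'M[R]_(m, n)) : mxl1 (M - N) <= mxl1 M + mxl1 N.
Proof. by rewrite -(mxl1N N) mxl1D. Qed.

Lemma mxl1Z m n (k : R) (M : 'M[R]_(m, n)) : mxl1 (k *: M) = `|k| * mxl1 M.
Proof.
rewrite /mxl1 mulr_sumr; apply: eq_bigr => i _; rewrite mulr_sumr.
by apply: eq_bigr => j _; rewrite mxE normrM.
Qed.

Lemma mxl1M m n p (M : 'M[R]_(m, n)) (N : 'M[R]_(n, p)) : mxl1 (M *m N) <= mxl1 M * mxl1 N.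
Proof.
apply: (@le_trans _ _ (\sum_i \sum_k (`|M i k| * \sum_j `|N k j|))).
  apply: ler_sum => i _; under [leRHS]eq_bigr do rewrite mulr_sumr.
  rewrite [leRHS]exchange_big; apply: ler_sum => j _.
  rewrite mxE; apply: (le_trans (ler_norm_sum _ _ _)).
  by apply: ler_sum => k _; rewrite normrM.
rewrite [leRHS]mulr_suml; apply: ler_sum => i _; rewrite mulr_suml; apply: ler_sum => k _.
apply: ler_wpM2l => //; rewrite /mxl1 (bigD1 k)//= lerDl.
by apply: sumr_ge0 => j _; apply: sumr_ge0.
Qed.

Lemma mxl1_le0 m n (M : 'M[R]_(m, n)) : mxl1 M <= 0 -> M = 0.
Proof.
move=> M0; apply/matrixP => i j; rewrite mxE; apply/eqP; rewrite -normr_le0.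
exact: le_trans (entry_le_mxl1 M i j) M0.
Qed.

Lemma mxl1_le m n (M : 'M[R]_(m, n)) (e : R) : (forall i j, `|M i j| <= e) -> mxl1 M <= (m * n)%:R * e.
Proof.
move=> Me; apply: (@le_trans _ _ (\sum_(i < m) \sum_(j < n) e)).
  by apply: ler_sum => i _; apply: ler_sum.
by rewrite sumr_const sumr_const !card_ord -mulrnA mulnC mulr_natl.
Qed.

Lemma norm_dotv_le n (a x : 'cV[R]_n) : `|dotv a x| <= mxl1 a * mxl1 x.
Proof.
rewrite dotvE; apply: (le_trans (ler_norm_sum _ _ _)).
rewrite {1}/mxl1 mulr_suml; apply: ler_sum => i _.
by rewrite big_ord1 normrM ler_wpM2l// entry_le_mxl1.
Qed.

(* D x = D' x + (D - D') x, so that x = D^-1 (D' x) + D^-1 (D - D') x. *)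
Section Perturbation.
Variables (n : nat) (D D' : 'M[R]_n).
Hypothesis uD : D \in unitmx.
Hypothesis small : mxl1 (invmx D) * mxl1 (D - D') <= 2^-1.

Let xE (x : 'cV[R]_n) : x - invmx D *m (D' *m x) = invmx D *m ((D - D') *m x).
Proof. by rewrite mulmxBl mulmxBr mulKmx. Qed.

Let diff_le (x : 'cV[R]_n) : mxl1 (x - invmx D *m (D' *m x)) <= mxl1 (invmx D) * mxl1 (D - D') * mxl1 x.
Proof.
rewrite xE -mulrA; apply: (le_trans (mxl1M _ _)); apply: ler_wpM2l; first exact: mxl1_ge0.
exact: mxl1M.
Qed.

(** The perturbation accounts for at most half of the norm of [x], which is absorbed on the left. No
    inverse of [D'] is presupposed, so its invertibility can be deduced from this bound. *)
Lemma perturbed_bound (x : 'cV[R]_n) : mxl1 x <= 2 * mxl1 (invmx D) * mxl1 (D' *m x).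
Proof.
have h1 := diff_le x; have h2 := mxl1M (invmx D) (D' *m x).
have h3 : mxl1 x <= mxl1 (x - invmx D *m (D' *m x)) + mxl1 (invmx D *m (D' *m x)).
  by rewrite -{1}(subrK (invmx D *m (D' *m x)) x) mxl1D.
have h4 : mxl1 (invmx D) * mxl1 (D - D') * mxl1 x <= 2^-1 * mxl1 x.
  by apply: ler_wpM2r => //; exact: mxl1_ge0.
rewrite -mulrA; lra.
Qed.

Lemma perturbed_dist (x : 'cV[R]_n) : mxl1 (x - invmx D *m (D' *m x)) <=
  2 * mxl1 (invmx D) ^+ 2 * mxl1 (D - D') * mxl1 (D' *m x).
Proof.
apply: (le_trans (diff_le x)).
rewrite (_ : 2 * _ * _ * _ = mxl1 (invmx D) * mxl1 (D - D') * (2 * mxl1 (invmx D) * mxl1 (D' *m x))).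
  by apply: ler_wpM2l; [rewrite mulr_ge0 ?mxl1_ge0|exact: perturbed_bound].
by ring.
Qed.

(** By the bound only 0 is mapped to 0. As [kermx] is a left kernel, the bound is applied to the
    rows of the kernel of the transpose. *)
Lemma perturbed_unitmx : D' \in unitmx.
Proof.
rewrite -unitmx_tr -row_free_unit -kermx_eq0; apply/eqP/row_matrixP => i; rewrite row0.
have : row i (kermx D'^T) *m D'^T = 0 by apply/sub_kermxP; exact: row_sub.
move/(congr1 trmx); rewrite trmx_mul trmxK trmx0 => h.
apply: trmx_inj; rewrite trmx0; apply: mxl1_le0.
have := perturbed_bound (row i (kermx D'^T))^T; rewrite h.
by rewrite [mxl1 0]big1 ?mulr0// => k _; rewrite big1// => l _; rewrite mxE normr0.
Qed.

End Perturbation.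

End EntrywiseNorm.

(** * Laws of large numbers and asymptotic normality *)

Section Events.
Context (d : measure_display) (Omega : measurableType d) (R : realType).
Variable P : probability Omega R.
Implicit Types (Q : nat -> Omega -> Prop) (e : R).

(** [Q] holds off an event of probability at most [e] for all large [J]. The event is a measurable
    cover of the failures, so [Q] may be any predicate; [tight] has the same shape. *)
Definition pnear e Q : Prop := \forall J \near \oo, exists A : set Omega,
  [/\ measurable A, (P A <= e%:E)%E & forall w, ~ A w -> Q J w].

Lemma pnear_sub e Q1 Q2 : (\forall J \near \oo, forall w, Q1 J w -> Q2 J w) ->
  pnear e Q1 -> pnear e Q2.
Proof.
apply: filterS2 => J Q12 [A [mA PA AQ]]; exists A; split => // w wA.
by apply: Q12; exact: AQ.
Qed.

Lemma pnear_and e1 e2 Q1 Q2 : pnear e1 Q1 -> pnear e2 Q2 ->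
  pnear (e1 + e2) (fun J w => Q1 J w /\ Q2 J w).
Proof.
apply: filterS2 => J [A1 [mA1 PA1 AQ1]] [A2 [mA2 PA2 AQ2]].
exists (A1 `|` A2); split; first exact: measurableU.
  by rewrite EFinD; apply: (le_trans (measureU2 _ mA1 mA2)); exact: leeD.
by move=> w /not_orP[w1 w2]; split; [exact: AQ1|exact: AQ2].
Qed.

Lemma pnear_forall (I : finType) (Q : I -> nat -> Omega -> Prop) :
  (forall i e, 0 < e -> pnear e (Q i)) ->
  forall e, 0 < e -> pnear e (fun J w => forall i, Q i J w).
Proof.
move=> QI.
suff H (s : seq I) e : 0 < e -> pnear e (fun J w => forall i, i \in s -> Q i J w).
  move=> e e0; apply: pnear_sub (H (enum I) e e0); apply: nearW => J w + i.
  by apply; rewrite mem_enum.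
elim: s e => [|i s IH] e e0.
  by apply: nearW => J; exists set0; split => //; rewrite measure0 lee_fin ltW.
have e2 : 0 < e / 2 by rewrite divr_gt0.
have E : e / 2 + e / 2 = e by field.
rewrite -E; apply: pnear_sub (pnear_and (QI i _ e2) (IH _ e2)).
apply: nearW => J w [Qi Qs] k; rewrite inE => /predU1P[->//|]; exact: Qs.
Qed.

Lemma pnear_forall_bounded (I : finType) (X : I -> nat -> Omega -> R) :
  (forall i e, 0 < e -> exists M, pnear e (fun J w => `|X i J w| <= M)) ->
  forall e, 0 < e -> exists2 M, 0 < M & pnear e (fun J w => forall i, `|X i J w| <= M).
Proof.
move=> QI.
suff H (s : seq I) e : 0 < e -> exists2 M, 0 < M & pnear e (fun J w => forall i, i \in s -> `|X i J w| <= M).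
  move=> e e0; have [M M0 HM] := H (enum I) e e0; exists M => //.
  by apply: pnear_sub HM; apply: nearW => J w + i; apply; rewrite mem_enum.
elim: s e => [|i s IH] e e0.
  by exists 1 => //; apply: nearW => J; exists set0; split => //; rewrite measure0 lee_fin ltW.
have e2 : 0 < e / 2 by rewrite divr_gt0.
have [M1 H1] := QI i _ e2; have [M2 M20 H2] := IH _ e2.
exists (Num.max M1 M2); first by rewrite lt_max M20 orbT.
have E : e / 2 + e / 2 = e by field.
rewrite -E; apply: pnear_sub (pnear_and H1 H2).
apply: nearW => J w [Qi Qs] k; rewrite inE le_max => /predU1P[->|/Qs ->]; first by rewrite Qi.
by rewrite orbT.
Qed.

End Events.

Section LargeSamples.
Context (d : measure_display) (Omega : measurableType d) (R : realType).
Context (d' : measure_display) (S : measurableType d').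
Variables (P : probability Omega R) (W : nat -> Omega -> S).
Hypothesis mW : forall j, measurable_fun setT (W j).
Hypothesis iidW : iid P W.
Variable g : S -> R.
Hypothesis mg : measurable_fun setT g.
Hypothesis ig : forall j, integrable_rv P (fun w => g (W j w) ^+ 2).

Lemma partial_sum_bounded : (forall j, mean P (fun w => g (W j w)) = 0) ->
  forall e, 0 < e -> exists M, pnear P e (fun J w => `|(Num.sqrt J%:R)^-1 * \sum_(j < J) g (W j w)| <= M).
Proof.
move=> g0 e e0; pose v := mean P (fun w => g (W 0%N w) ^+ 2).
have v0 : 0 <= v by apply: Rintegral_ge0 => w _; exact: sqr_ge0.
(* Chebyshev gives v / M^2 = v e / (v + 1) <= e; the added 1 keeps [M] positive when [v = 0]. *)
pose M := Num.sqrt ((v + 1) / e).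
have M0 : 0 < M by rewrite sqrtr_gt0 divr_gt0// ltr_wpDl.
exists M; near=> J; have J0 : (0 < J)%N by near: J; exact: nbhs_infty_gt.
have J1 : 0 < (J%:R : R) by rewrite ltr0n.
have [iS ES] := mean_sq_partial_sum mW iidW mg ig g0 J.
have mS := measurable_partial_sum mW mg J.
have sJ : 0 < Num.sqrt (J%:R : R) by rewrite sqrtr_gt0.
have c0 : 0 < M * Num.sqrt J%:R by rewrite mulr_gt0.
exists [set w | (M * Num.sqrt J%:R <= `|\sum_(j < J) g (W j w)|)%R]; split.
- rewrite (_ : mkset _ = (fun w => `|\sum_(j < J) g (W j w)|) @^-1` `[M * Num.sqrt J%:R, +oo[).
    by rewrite -[X in measurable X]setTI; apply: (measurableT_comp _ mS).
  by apply/seteqP; split => w /=; rewrite in_itv/= andbT.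
- apply: (le_trans (markov_sq c0 mS iS)); rewrite lee_fin ES exprMn [Num.sqrt J%:R ^+ 2]sqr_sqrtr ?ler0n//.
  rewrite sqr_sqrtr; last by rewrite ltW// divr_gt0// ltr_wpDl.
  rewrite ler_pdivrMr ?mulr_gt0 ?invr_gt0 ?ltr_wpDl// mulrA [e * _]mulrC divfK ?gt_eqF//.
  by rewrite mulrC ler_pM2r// lerDl.
move=> w /negP; rewrite -ltNge => h; rewrite normrM ger0_norm ?invr_ge0 ?(ltW sJ)//.
by rewrite mulrC ler_pdivrMr// ltW.
Unshelve. all: by end_near. Qed.

End LargeSamples.

Section LawOfLargeNumbers.
Context (d : measure_display) (Omega : measurableType d) (R : realType).
Context (d' : measure_display) (S : measurableType d').
Variables (P : probability Omega R) (W : nat -> Omega -> S).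
Hypothesis mW : forall j, measurable_fun setT (W j).
Hypothesis iidW : iid P W.
Variable g : S -> R.
Hypothesis mg : measurable_fun setT g.
Hypothesis ig : forall j, integrable_rv P (fun w => g (W j w) ^+ 2).

(** The average of the centered variables is [1 / sqrt J] times a normalized sum that is bounded in
    probability. *)
Lemma lln (l : R) : (forall j, mean P (fun w => g (W j w)) = l) ->
  forall e del, 0 < e -> 0 < del ->
    pnear P e (fun J w => `|J%:R^-1 * (\sum_(j < J) g (W j w)) - l| <= del).
Proof.
move=> gl e del e0 del0.
have mgW j : measurable_fun setT (fun w => g (W j w)) by exact: (measurableT_comp mg).
have ig1 j : integrable_rv P (fun w => g (W j w)) by exact: integrable_sq_integrable.
have mgl : measurable_fun setT (fun x => g x - l) by exact: measurable_funB.
have igl j : integrable_rv P (fun w => (g (W j w) - l) ^+ 2).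
  apply: integrable_sqD => //; exact: integrable_rv_cst.
have gl0 j : mean P (fun w => g (W j w) - l) = 0.
  by rewrite meanB//; [rewrite gl mean_cst subrr|exact: integrable_rv_cst].
have [M HM] := partial_sum_bounded mW iidW mgl igl gl0 e0.
apply: pnear_sub HM.
have limM : M * (Num.sqrt J%:R)^-1 @[J --> \oo] --> (0 : R).
  apply: (@cvg_bound_invsqrt _ _ _ `|M|) => J J0.
  by rewrite subr0 normrM ler_wpM2l// ger0_norm// invr_ge0 sqrtr_ge0.
near=> J => w h; have J0 : (0 < J)%N by near: J; exact: nbhs_infty_gt.
have J1 : 0 < (J%:R : R) by rewrite ltr0n.
have sJ : 0 < Num.sqrt (J%:R : R) by rewrite sqrtr_gt0.
have -> : J%:R^-1 * (\sum_(j < J) g (W j w)) - l =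
    (Num.sqrt J%:R)^-1 * ((Num.sqrt J%:R)^-1 * \sum_(j < J) (g (W j w) - l)).
  rewrite mulrA -invfM -expr2 sqr_sqrtr ?ler0n// sumrB sumr_const card_ord -[l *+ J]mulr_natl.
  by rewrite mulrBr mulKf// gt_eqF.
rewrite normrM ger0_norm ?invr_ge0 ?(ltW sJ)//.
apply: (@le_trans _ _ (M * (Num.sqrt J%:R)^-1)).
  by rewrite mulrC ler_wpM2r// invr_ge0 ltW.
apply: (le_trans (ler_norm _)).
have : `|0 - M / Num.sqrt J%:R| <= del by near: J; apply/(cvgrPdist_le _ _).1.
by rewrite sub0r normrN.
Unshelve. all: by end_near. Qed.

End LawOfLargeNumbers.

Section Lipschitz.
Variable R : realType.

Lemma cos_lipschitz (x y : R) : `|cos x - cos y| <= `|x - y|.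
Proof.
wlog xy : x y / x <= y.
  by move=> H; case/orP: (le_total x y) => /H//; rewrite distrC [`|y - x|]distrC.
have [c _ E] := @MVT_segment R cos (fun x => - sin x) x y xy (fun z _ => is_derive_cos z)
  (@continuous_subspaceT _ _ _ _ (@continuous_cos R)).
rewrite distrC E normrM normrN distrC ler_piMl// ler_norml.
by rewrite sin_geN1 sin_le1.
Qed.

Lemma dotvBr n (a x y : 'cV[R]_n) : dotv a (x - y) = dotv a x - dotv a y.
Proof. by rewrite !dotvE -sumrB; apply: eq_bigr => i _; rewrite !mxE mulrBr. Qed.

End Lipschitz.

(** * Central limit theorem for asymptotically linear vectors *)

Section LimitTheorem.
Context (d : measure_display) (Omega : measurableType d) (R : realType).
Context (d' : measure_display) (S : measurableType d').
Variables (P : probability Omega R) (W : nat -> Omega -> S).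
Hypothesis mW : forall j, measurable_fun setT (W j).
Hypothesis iidW : iid P W.

Definition square_integrable m n (F : S -> 'M[R]_(m, n)) : Prop :=
  forall j i k, integrable_rv P (fun w => F (W j w) i k ^+ 2).

Definition has_mean m n (F : S -> 'M[R]_(m, n)) (M : 'M[R]_(m, n)) : Prop :=
  forall j i k, mean P (fun w => F (W j w) i k) = M i k.

Lemma lln_mx m n (F : S -> 'M[R]_(m, n)) (M : 'M[R]_(m, n)) :
  random_mx F -> square_integrable F -> has_mean F M ->
  forall e del, 0 < e -> 0 < del ->
    pnear P e (fun J w => mxl1 (J%:R^-1 *: (\sum_(j < J) F (W j w)) - M) <= del).
Proof.
move=> mF iF FM e del e0 del0.
(* The successor avoids a division by 0 for matrices without entries. *)
have c0 : 0 < del / (m * n).+1%:R by rewrite divr_gt0// ltr0n.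
apply: (@pnear_sub _ _ _ P e (fun J w => forall ik : 'I_m * 'I_n,
  `|J%:R^-1 * (\sum_(j < J) F (W j w) ik.1 ik.2) - M ik.1 ik.2| <= del / (m * n).+1%:R)).
  apply: nearW => J w h; have := @mxl1_le _ _ _ (J%:R^-1 *: (\sum_(j < J) F (W j w)) - M) (del / (m * n).+1%:R).
  move=> /(_ _)/le_trans; apply.
    by move=> i k; have := h (i, k); rewrite !mxE summxE.
  by rewrite mulrCA ger_pMr// ler_pdivrMr ?ltr0n// mul1r ler_nat leqnSn.
apply: pnear_forall e0 => -[i k] e1 e10; apply: (lln mW iidW (mF i k)) => // j; exact: FM.
Qed.

Lemma partial_sum_bounded_mx n (F : S -> 'cV[R]_n) :
  random_mx F -> square_integrable F -> has_mean F 0 ->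
  forall e, 0 < e -> exists2 M, 0 < M &
    pnear P e (fun J w => mxl1 ((Num.sqrt J%:R)^-1 *: \sum_(j < J) F (W j w)) <= M).
Proof.
move=> mF iF F0 e e0.
have [||M M0 HM] := @pnear_forall_bounded _ _ _ P 'I_n (fun i J w =>
  (Num.sqrt J%:R)^-1 * (\sum_(j < J) F (W j w) i 0)) _ e => //.
  move=> i e1 e10; apply: (partial_sum_bounded mW iidW (mF i 0)) => // j.
  by rewrite F0 mxE.
exists ((n * 1).+1%:R * M); first by rewrite mulr_gt0.
apply: pnear_sub HM; apply: nearW => J w h; apply: le_trans (mxl1_le (e := M) _) _.
  by move=> i k; have := h i; rewrite (ord1 k) !mxE summxE.
by rewrite ler_wpM2r ?ler_nat// ltW.
Qed.

(** Cramer-Wold and Slutsky at once: each linear form of the normalized sum obeys [clt_cos], and the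
    cosine is 1-Lipschitz, so closeness of [Z] to the sum carries over to the means. As a matrix of
    second moments [V] is symmetric and nonnegative, which provides the limit law. *)
Lemma clt_asymptotically_linear n (h : S -> 'cV[R]_n) (Z : nat -> Omega -> 'cV[R]_n) (V : 'M[R]_n) :
  random_mx h -> square_integrable h -> has_mean h 0 ->
  (forall i k, mean P (fun w => h (W 0 w) i 0 * h (W 0 w) k 0) = V i k) ->
  (forall J, random_mx (Z J)) ->
  (forall e del, 0 < e -> 0 < del -> pnear P e (fun J w =>
    mxl1 (Z J w - (Num.sqrt J%:R)^-1 *: \sum_(j < J) h (W j w)) <= del)) ->
  cvg_in_law_normal P Z 0 V.
Proof.
move=> mh ih h0 hV mZ ZS.
have mhW j i : measurable_fun setT (fun w => h (W j w) i 0) by exact: (measurableT_comp (mh i 0)).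
have mg (a : 'cV[R]_n) : measurable_fun setT (fun s => dotv a (h s)).
  rewrite (_ : (fun s => _) = (fun s => \sum_i a i 0 * h s i 0)); last by apply/funext => s; rewrite dotvE.
  by apply: measurable_sum => i; exact: measurable_funM.
have ig (a : 'cV[R]_n) j : integrable_rv P (fun w => dotv a (h (W j w)) ^+ 2).
  rewrite (_ : (fun s => _) = (fun w => (\sum_i a i 0 * h (W j w) i 0) ^+ 2)); last by apply/funext => s; rewrite dotvE.
  apply: integrable_sq_sum => i; first exact: measurable_funM.
  exact: integrable_sqZ.
have ih1 j i : integrable_rv P (fun w => h (W j w) i 0) by exact: integrable_sq_integrable.
have g0 (a : 'cV[R]_n) j : mean P (fun w => dotv a (h (W j w))) = 0.
  rewrite (_ : (fun s => _) = (fun w => \sum_i a i 0 * h (W j w) i 0)); last by apply/funext => s; rewrite dotvE.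
  rewrite mean_sum => [|i _]; last exact: integrable_rvZ.
  by rewrite big1// => i _; rewrite meanZ// h0 mxE mulr0.
have VE (a : 'cV[R]_n) : mean P (fun w => dotv a (h (W 0%N w)) ^+ 2) = dotv a (V *m a).
  have ip i k : integrable_rv P (fun w => h (W 0%N w) i 0 * h (W 0%N w) k 0) by exact: integrable_sq_prod.
  rewrite (_ : (fun s => _) = (fun w => \sum_i (a i 0 * \sum_k (a k 0 * (h (W 0%N w) i 0 * h (W 0%N w) k 0))))); last first.
    apply/funext => w; rewrite dotvE expr2 mulr_suml; apply: eq_bigr => i _.
    rewrite -mulrA; congr (_ * _); rewrite mulr_sumr; apply: eq_bigr => k _; ring.
  rewrite dotv_mulmx mean_sum => [|i _]; last first.
    by apply: integrable_rvZ; apply: integrable_rv_sum => k _; exact: integrable_rvZ.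
  apply: eq_bigr => i _; rewrite meanZ; last by apply: integrable_rv_sum => k _; exact: integrable_rvZ.
  congr (_ * _); rewrite mean_sum => [|k _]; last exact: integrable_rvZ.
  by apply: eq_bigr => k _; rewrite meanZ// hV mulrC.
have symV : V^T = V.
  by apply/matrixP => i k; rewrite mxE -!hV; congr (mean P _); apply/funext => w; rewrite mulrC.
have psdV a : 0 <= dotv a (V *m a).
  by rewrite -VE; apply: Rintegral_ge0 => w _; exact: sqr_ge0.
have [nu [nuN nuC]] := mvnormal_exists symV psdV.
exists nu; split => //; apply: levy => //.
  move=> e e0; have e2 : 0 < e / 2 by rewrite divr_gt0.
  have [M M0 HM] := partial_sum_bounded_mx mh ih h0 e2.
  exists (1 + M); first by rewrite addr_gt0.
  have E : e / 2 + e / 2 = e by field.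
  have := pnear_and HM (ZS _ _ e2 ltr01); rewrite E.
  apply: pnear_sub; apply: nearW => J w [hM hZ] i.
  apply: (le_trans (entry_le_mxl1 _ _ _)).
  rewrite -(subrK ((Num.sqrt J%:R)^-1 *: \sum_(j < J) h (W j w)) (Z J w)).
  by apply: (le_trans (mxl1D _ _)); exact: lerD.
move=> a th; rewrite nuC.
have clt := clt_cos mW iidW (mg a) (ig a) (g0 a) (th := th).
rewrite VE -/(gaussian_char V a th) in clt; move/cvgrPdist_le in clt.
apply/cvgrPdist_le => eps eps0.
have e4 : 0 < eps / 8 by rewrite divr_gt0.
(* The linear form amplifies errors by at most [mxl1 a], so [del] costs at most [eps / 4]; the
   exceptional event costs twice [eps / 8], and the limit for the sum [eps / 2]. *)
pose del := eps / 4 / (1 + mxl1 a).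
have a1 : 0 < 1 + mxl1 a by rewrite ltr_wpDr// mxl1_ge0.
have del0 : 0 < del by rewrite !divr_gt0.
have e2 : 0 < eps / 2 by rewrite divr_gt0.
pose Y_ (J : nat) w := (Num.sqrt J%:R)^-1 * \sum_(j < J) dotv a (h (W j w)).
have {}clt : \forall J \near \oo, `|gaussian_char V a th - mean P (fun w => cos (Y_ J w + th))| <= eps / 2 by exact: clt.
near=> J.
have [A [mA PA hA]] : exists A : set Omega, [/\ measurable A, (P A <= (eps / 8)%:E)%E & forall w, ~ A w ->
    mxl1 (Z J w - (Num.sqrt J%:R)^-1 *: \sum_(j < J) h (W j w)) <= del].
  by near: J; exact: ZS.
pose Y w := Y_ J w.
have YE w : Y w = dotv a ((Num.sqrt J%:R)^-1 *: \sum_(j < J) h (W j w)).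
  rewrite /Y/Y_ dotvZr; congr (_ * _); rewrite /dotv mulmx_sumr summxE; exact: eq_bigr.
have h1 : `|gaussian_char V a th - mean P (fun w => cos (Y w + th))| <= eps / 2.
  by rewrite /Y; near: J.
have mY : measurable_fun setT Y.
  by apply: measurable_funM => //; exact: (measurable_partial_sum mW (mg a)).
have mdZ : measurable_fun setT (fun w => dotv a (Z J w)).
  by exact: (measurableT_comp (measurable_dotv a) (random_mx_measurable (mZ J))).
have h2 : `|mean P (fun w => cos (Y w + th)) - mean P (fun w => cos (dotv a (Z J w) + th))| <= eps / 4 + 2 * fine (P A).
  apply: mean_dist_le => //.
  - apply: (bounded_integrable (C := 1)); last by move=> w; exact: cos_max.
    by apply: measurable_cos; exact: measurable_funD.
  - apply: (bounded_integrable (C := 1)); last by move=> w; exact: cos_max.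
    by apply: measurable_cos; exact: measurable_funD.
  - by rewrite divr_ge0// ltW.
  - move=> w; apply: (le_trans (ler_normB _ _)).
    by have := cos_max (Y w + th); have := cos_max (dotv a (Z J w) + th); lra.
  - move=> w /hA hw; apply: (le_trans (cos_lipschitz _ _)).
    rewrite opprD addrACA subrr addr0 YE distrC -dotvBr.
    apply: (le_trans (norm_dotv_le _ _)).
    apply: (@le_trans _ _ (mxl1 a * del)); first by rewrite ler_wpM2l// mxl1_ge0.
    rewrite /del mulrCA ger_pMr ?divr_gt0// ler_pdivrMr// mul1r lerDr//.
have h3 : fine (P A) <= eps / 8 by rewrite -lee_fin fineK// fin_num_measure.
apply: (le_trans (ler_distD (mean P (fun w => cos (Y w + th))) _ _)).
apply: (le_trans (lerD h1 h2)); lra.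
Unshelve. all: by end_near. Qed.

End LimitTheorem.

Section RandomMatrices.
Context (d : measure_display) (T : measurableType d) (R : realType).

Lemma random_mx_cst m n (M : 'M[R]_(m, n)) : random_mx (fun _ : T => M).
Proof. by move=> i k; exact: measurable_cst. Qed.

Lemma random_mxD m n (F G : T -> 'M[R]_(m, n)) : random_mx F -> random_mx G ->
  random_mx (fun s => F s + G s).
Proof.
move=> mF mG i k; rewrite (_ : (fun s => _) = (fun s => F s i k + G s i k)).
  exact: measurable_funD.
by apply/funext => s; rewrite mxE.
Qed.

Lemma random_mxN m n (F : T -> 'M[R]_(m, n)) : random_mx F -> random_mx (fun s => - F s).
Proof.
move=> mF i k; rewrite (_ : (fun s => _) = (fun s => - F s i k)).
  exact: measurableT_comp.
by apply/funext => s; rewrite mxE.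
Qed.

Lemma random_mxB m n (F G : T -> 'M[R]_(m, n)) : random_mx F -> random_mx G ->
  random_mx (fun s => F s - G s).
Proof. by move=> mF mG; apply: random_mxD => //; exact: random_mxN. Qed.

Lemma random_mxM m n p (F : T -> 'M[R]_(m, n)) (G : T -> 'M[R]_(n, p)) :
  random_mx F -> random_mx G -> random_mx (fun s => F s *m G s).
Proof.
move=> mF mG i k; rewrite (_ : (fun s => _) = (fun s => \sum_l F s i l * G s l k)).
  by apply: measurable_sum => l; exact: measurable_funM.
by apply/funext => s; rewrite mxE.
Qed.

Lemma random_mx_tr m n (F : T -> 'M[R]_(m, n)) : random_mx F -> random_mx (fun s => (F s)^T).
Proof.
move=> mF i k; rewrite (_ : (fun s => _) = (fun s => F s k i)) => //.
by apply/funext => s; rewrite mxE.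
Qed.

End RandomMatrices.

Section Moments.
Context (d : measure_display) (Omega : measurableType d) (R : realType).
Context (d' : measure_display) (S : measurableType d').
Variables (P : probability Omega R) (W : nat -> Omega -> S).
Hypothesis mW : forall j, measurable_fun setT (W j).
Local Notation square_integrable := (square_integrable P W).
Local Notation has_mean := (has_mean P W).

Lemma random_mx_entry m n (F : S -> 'M[R]_(m, n)) j i k : random_mx F ->
  measurable_fun setT (fun w => F (W j w) i k).
Proof. by move=> mF; exact: (measurableT_comp (mF i k)). Qed.

Lemma square_integrable_entry m n (F : S -> 'M[R]_(m, n)) j i k : random_mx F ->
  square_integrable F -> integrable_rv P (fun w => F (W j w) i k).
Proof. by move=> mF iF; apply: integrable_sq_integrable => //; exact: random_mx_entry. Qed.

Lemma square_integrableD m n (F G : S -> 'M[R]_(m, n)) : random_mx F -> random_mx G ->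
  square_integrable F -> square_integrable G -> square_integrable (fun s => F s + G s).
Proof.
move=> mF mG iF iG j i k; under eq_fun do rewrite mxE.
by apply: integrable_sqD => //; exact: random_mx_entry.
Qed.

Lemma square_integrableMl m n p (M : 'M[R]_(p, m)) (F : S -> 'M[R]_(m, n)) : random_mx F ->
  square_integrable F -> square_integrable (fun s => M *m F s).
Proof.
move=> mF iF j i k; under eq_fun do rewrite mxE.
apply: integrable_sq_sum => l; last exact: integrable_sqZ.
by apply: measurable_funM => //; exact: random_mx_entry.
Qed.

Lemma square_integrableN m n (F : S -> 'M[R]_(m, n)) :
  square_integrable F -> square_integrable (fun s => - F s).
Proof. by move=> iF j i k; under eq_fun do rewrite mxE sqrrN. Qed.

Lemma square_integrableB m n (F G : S -> 'M[R]_(m, n)) : random_mx F -> random_mx G ->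
  square_integrable F -> square_integrable G -> square_integrable (fun s => F s - G s).
Proof.
move=> mF mG iF iG; apply: square_integrableD => //; first exact: random_mxN.
exact: square_integrableN.
Qed.

Lemma has_meanMl m n p (M : 'M[R]_(p, m)) (F : S -> 'M[R]_(m, n)) F0 : random_mx F ->
  square_integrable F -> has_mean F F0 -> has_mean (fun s => M *m F s) (M *m F0).
Proof.
move=> mF iF EF j i k; under eq_fun do rewrite mxE.
have iFe l : integrable_rv P (fun w => F (W j w) l k) by exact: square_integrable_entry.
rewrite mxE mean_sum => [|l _]; last exact: integrable_rvZ.
by apply: eq_bigr => l _; rewrite meanZ// EF.
Qed.

Lemma has_meanB m n (F G : S -> 'M[R]_(m, n)) F0 G0 : random_mx F -> random_mx G ->
  square_integrable F -> square_integrable G ->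
  has_mean F F0 -> has_mean G G0 -> has_mean (fun s => F s - G s) (F0 - G0).
Proof.
move=> mF mG iF iG EF EG j i k; under eq_fun do rewrite 2!mxE.
by rewrite meanB ?EF ?EG ?mxE//; exact: square_integrable_entry.
Qed.

Lemma second_moment_mulmx m n (M : 'M[R]_(m, n)) (F : S -> 'cV[R]_n) (G : 'M[R]_n) :
  random_mx F -> square_integrable F ->
  (forall i k, mean P (fun w => F (W 0 w) i 0 * F (W 0 w) k 0) = G i k) ->
  forall i k, mean P (fun w => (M *m F (W 0 w)) i 0 * (M *m F (W 0 w)) k 0) = (M *m G *m M^T) i k.
Proof.
move=> mF iF FG i k.
have ip l l' : integrable_rv P (fun w => F (W 0%N w) l 0 * F (W 0%N w) l' 0).
  by apply: integrable_sq_prod => //; exact: random_mx_entry.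
transitivity (mean P (fun w => \sum_l' M k l' * \sum_l M i l * (F (W 0%N w) l 0 * F (W 0%N w) l' 0))).
  congr (mean P _); apply/funext => w; rewrite !mxE mulr_sumr; apply: eq_bigr => l' _.
  by rewrite mulrCA mulr_suml; congr (_ * _); apply: eq_bigr => l _; rewrite mulrA.
have isum l' : integrable_rv P (fun w => \sum_l M i l * (F (W 0%N w) l 0 * F (W 0%N w) l' 0)).
  by apply: integrable_rv_sum => l _; exact: integrable_rvZ.
rewrite mean_sum => [|l' _]; last exact: integrable_rvZ.
rewrite mxE; apply: eq_bigr => l' _; rewrite meanZ// mulrC !mxE; congr (_ * _).
rewrite mean_sum => [|l _]; last exact: integrable_rvZ.
by apply: eq_bigr => l _; rewrite meanZ// FG.
Qed.

End Moments.

(** * Linear GMM *)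

Section TriangularSystem.
Variables (R : realType) (K L : nat).
Variables (A0 : 'M[R]_K) (C0 : 'M[R]_(L, K)) (D0 : 'M[R]_L).
Hypotheses (uA : A0 \in unitmx) (uD : D0 \in unitmx).

Let a := mxl1 (invmx A0).
Let q := mxl1 (invmx D0).
Let c0 := mxl1 C0.

(** In units of [M]: [u] is at most [2 * a], the perturbed [C] has norm at most [c0 + 1] because
    [del <= 1], and [z] is at most [2 * q] times its right-hand side. *)
Definition triangular_bound : R := 1 + 2 * a + 2 * q * (1 + (c0 + 1) * (2 * a)).

(** The error of [z] in units of [del * M]: the first summand comes from replacing [D] by [D0], the
    second from replacing [C] and [A]. *)
Definition triangular_gain : R :=
  2 * q ^+ 2 * (1 + (c0 + 1) * (2 * a)) + q * (2 * a + c0 * (2 * a ^+ 2)).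

Lemma triangular_bound_gt0 : 0 < triangular_bound.
Proof.
have ha : 0 <= a := mxl1_ge0 _; have hq : 0 <= q := mxl1_ge0 _; have hc : 0 <= c0 := mxl1_ge0 _.
have hc1 : 0 <= c0 + 1 by rewrite addr_ge0.
by rewrite /triangular_bound -addrA ltr_wpDr// !(addr_ge0, mulr_ge0).
Qed.

Lemma triangular_gain_ge0 : 0 <= triangular_gain.
Proof.
have ha : 0 <= a := mxl1_ge0 _; have hq : 0 <= q := mxl1_ge0 _; have hc : 0 <= c0 := mxl1_ge0 _.
have hc1 : 0 <= c0 + 1 by rewrite addr_ge0.
by rewrite /triangular_gain !(addr_ge0, mulr_ge0, sqr_ge0).
Qed.

Variables (A : 'M[R]_K) (C : 'M[R]_(L, K)) (D : 'M[R]_L) (b u : 'cV[R]_K) (c z : 'cV[R]_L).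
Variables (M del : R).
Hypotheses (del0 : 0 <= del) (del1 : del <= 1) (adel : a * del <= 2^-1) (qdel : q * del <= 2^-1).
Hypotheses (dA : mxl1 (A - A0) <= del) (dC : mxl1 (C - C0) <= del) (dD : mxl1 (D - D0) <= del).
Hypotheses (bM : mxl1 b <= M) (cM : mxl1 c <= M).

Let dA' : mxl1 (A0 - A) <= del. Proof. by rewrite -opprB mxl1N. Qed.
Let dD' : mxl1 (D0 - D) <= del. Proof. by rewrite -opprB mxl1N. Qed.

Let smallA : mxl1 (invmx A0) * mxl1 (A0 - A) <= 2^-1.
Proof. by apply: le_trans adel; apply: ler_wpM2l => //; exact: mxl1_ge0. Qed.

Let smallD : mxl1 (invmx D0) * mxl1 (D0 - D) <= 2^-1.
Proof. by apply: le_trans qdel; apply: ler_wpM2l => //; exact: mxl1_ge0. Qed.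

Lemma triangular_unitmx : A \in unitmx /\ D \in unitmx.
Proof. by split; [exact: perturbed_unitmx smallA|exact: perturbed_unitmx smallD]. Qed.

Hypotheses (Au : A *m u = b) (Dz : D *m z = c - C *m u).

Let M0 : 0 <= M. Proof. exact: le_trans (mxl1_ge0 _) bM. Qed.
Let ha : 0 <= a. Proof. exact: mxl1_ge0. Qed.
Let hq : 0 <= q. Proof. exact: mxl1_ge0. Qed.
Let hc : 0 <= c0. Proof. exact: mxl1_ge0. Qed.

Let u_le : mxl1 u <= 2 * a * M.
Proof.
apply: (le_trans (perturbed_bound uA smallA u)); rewrite Au.
by apply: ler_wpM2l => //; rewrite mulr_ge0.
Qed.

Let Dz_le : mxl1 (D *m z) <= M * (1 + (c0 + 1) * (2 * a)).
Proof.
rewrite Dz; apply: (le_trans (mxl1B _ _)).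
rewrite (_ : M * _ = M + (c0 + 1) * (2 * a * M)); last by ring.
apply: lerD => //; apply: (le_trans (mxl1M _ _)).
apply: ler_pM => //; try exact: mxl1_ge0.
rewrite -(subrK C0 C) addrC; apply: (le_trans (mxl1D _ _)).
by rewrite lerD// (le_trans dC).
Qed.

Lemma triangular_le : mxl1 u + mxl1 z <= triangular_bound * M.
Proof.
have hz : mxl1 z <= 2 * q * (M * (1 + (c0 + 1) * (2 * a))).
  apply: (le_trans (perturbed_bound uD smallD z)).
  by apply: ler_wpM2l => //; rewrite mulr_ge0.
apply: (le_trans (lerD u_le hz)).
rewrite [leRHS](_ : _ = M + (2 * a * M + 2 * q * (M * (1 + (c0 + 1) * (2 * a))))).
  by rewrite lerDr.
by rewrite /triangular_bound; ring.
Qed.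

Lemma triangular_dist :
  mxl1 (z - invmx D0 *m (c - C0 *m (invmx A0 *m b))) <= del * M * triangular_gain.
Proof.
(* Exact splitting of the error: [D] against [D0], then [C] against [C0], then [A] against [A0]. *)
have -> : z - invmx D0 *m (c - C0 *m (invmx A0 *m b)) =
    (z - invmx D0 *m (D *m z)) - invmx D0 *m ((C - C0) *m u + C0 *m (u - invmx A0 *m (A *m u))).
  rewrite -addrA -opprD -mulmxDr; congr (_ - _ *m _).
  by rewrite Dz Au mulmxBl mulmxBr !addrA !subrK.
apply: (le_trans (mxl1B _ _)).
have h1 : mxl1 (z - invmx D0 *m (D *m z)) <= 2 * q ^+ 2 * del * (M * (1 + (c0 + 1) * (2 * a))).
  apply: (le_trans (perturbed_dist uD smallD z)).
  have h := sqr_ge0 q.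
  apply: ler_pM => //; rewrite ?mulr_ge0 ?mxl1_ge0//.
  by apply: ler_wpM2l => //; rewrite mulr_ge0.
have h2 : mxl1 (u - invmx A0 *m (A *m u)) <= 2 * a ^+ 2 * del * M.
  apply: (le_trans (perturbed_dist uA smallA u)).
  have h := sqr_ge0 a; rewrite Au.
  apply: ler_pM => //; rewrite ?mulr_ge0 ?mxl1_ge0//.
  by apply: ler_wpM2l => //; rewrite mulr_ge0.
have h3 : mxl1 ((C - C0) *m u + C0 *m (u - invmx A0 *m (A *m u))) <=
    del * (2 * a * M) + c0 * (2 * a ^+ 2 * del * M).
  apply: (le_trans (mxl1D _ _)); apply: lerD.
    by apply: (le_trans (mxl1M _ _)); apply: ler_pM => //; exact: mxl1_ge0.
  by apply: (le_trans (mxl1M _ _)); apply: ler_wpM2l.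
have h4 := le_trans (mxl1M (invmx D0) _) (ler_wpM2l hq h3).
apply: (le_trans (lerD h1 h4)); rewrite le_eqVlt; apply/orP; left; apply/eqP.
by rewrite /triangular_gain; ring.
Qed.

End TriangularSystem.

(** * Asymptotic normality for triangular linear moment conditions *)

Section LinearGmm.
Context (d : measure_display) (Omega : measurableType d) (R : realType).
Context (d' : measure_display) (S : measurableType d').
Variables (P : probability Omega R) (W : nat -> Omega -> S).
Hypothesis mW : forall j, measurable_fun setT (W j).
Hypothesis iidW : iid P W.
Variables K L : nat.
Variables (fA : S -> 'M[R]_K) (fb : S -> 'cV[R]_K).
Variables (fC : S -> 'M[R]_(L, K)) (fD : S -> 'M[R]_L) (fc : S -> 'cV[R]_L).
Hypotheses (mA : random_mx fA) (mb : random_mx fb) (mC : random_mx fC) (mD : random_mx fD) (mc : random_mx fc).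
Hypotheses (iA : square_integrable P W fA) (ib : square_integrable P W fb).
Hypotheses (iC : square_integrable P W fC) (iD : square_integrable P W fD) (ic : square_integrable P W fc).
Variables (A0 : 'M[R]_K) (C0 : 'M[R]_(L, K)) (D0 : 'M[R]_L).
Hypotheses (EA : has_mean P W fA A0) (Eb : has_mean P W fb 0) (EC : has_mean P W fC C0).
Hypotheses (ED : has_mean P W fD D0) (Ec : has_mean P W fc 0).
Hypotheses (uA : A0 \in unitmx) (uD : D0 \in unitmx).
Variables (Theta : set 'cV[R]_(K + L)) (beta0 : 'cV[R]_K) (alpha0 : 'cV[R]_L).
Hypothesis intTheta : interior Theta (col_mx beta0 alpha0).

(** [fb] and [fc] are the moments at the true parameter, and the other blocks multiply deviations
    from it. The system is triangular since the first moment is free of [alpha]. *)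
Definition linear_moment (s : S) (beta : 'cV[R]_K) (alpha : 'cV[R]_L) : 'cV[R]_(K + L) :=
  col_mx (fb s - fA s *m (beta - beta0))
         (fc s - fC s *m (beta - beta0) - fD s *m (alpha - alpha0)).

Definition linear_objective J w beta alpha : R :=
  sqnorm (J%:R^-1 *: \sum_(j < J) linear_moment (W j w) beta alpha).

Variables (betahat : nat -> Omega -> 'cV[R]_K) (alphahat : nat -> Omega -> 'cV[R]_L).
Hypothesis hat_min : forall J w, (0 < J)%N -> forall beta alpha, Theta (col_mx beta alpha) ->
  linear_objective J w (betahat J w) (alphahat J w) <= linear_objective J w beta alpha.
Hypothesis mhat : forall J, random_mx (alphahat J).

Let avg m n (F : S -> 'M[R]_(m, n)) J w : 'M[R]_(m, n) := J%:R^-1 *: \sum_(j < J) F (W j w).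
Let std m n (F : S -> 'M[R]_(m, n)) J w : 'M[R]_(m, n) := (Num.sqrt J%:R)^-1 *: \sum_(j < J) F (W j w).

Let avg_linear_moment J w beta alpha :
  J%:R^-1 *: (\sum_(j < J) linear_moment (W j w) beta alpha) =
  col_mx (avg fb J w - avg fA J w *m (beta - beta0))
    (avg fc J w - avg fC J w *m (beta - beta0) - avg fD J w *m (alpha - alpha0)).
Proof.
rewrite /avg -!scalemxAl -!scalerBr -scale_col_mx; congr (_ *: _).
rewrite !mulmx_suml -!sumrB.
elim/big_ind3 : _ => //; first by rewrite col_mx0.
by move=> x y z x' y' z' -> ->; rewrite add_col_mx.
Qed.

Let sqnorm0 n (u : 'cV[R]_n) : sqnorm u <= 0 -> u = 0.
Proof.
rewrite /sqnorm dotvE => h; apply/matrixP => i k; rewrite (ord1 k) mxE; apply/eqP.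
rewrite -sqrf_eq0 eq_le sqr_ge0 andbT; apply: le_trans h.
by rewrite (bigD1 i)//= -expr2 lerDl; apply: sumr_ge0 => l _; rewrite -expr2 sqr_ge0.
Qed.

Let interior_ball : exists2 r, 0 < r & forall x y, mxl1 x + mxl1 y < r -> Theta (col_mx (beta0 + x) (alpha0 + y)).
Proof.
have /nbhs_ballP[r r0 hr] := intTheta; exists r => // x y xy; apply: hr; split => // i k.
rewrite -(splitK i) (ord1 k); case: (fintype.split i) => l /=; rewrite /ball/=.
  rewrite !col_mxEu mxE opprD addNKr normrN; apply: le_lt_trans xy.
  by rewrite (le_trans (entry_le_mxl1 x l 0))// lerDl mxl1_ge0.
rewrite !col_mxEd mxE opprD addNKr normrN; apply: le_lt_trans xy.
by rewrite (le_trans (entry_le_mxl1 y l 0))// lerDr mxl1_ge0.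
Qed.

(** The exact solution is feasible and annihilates the objective, so the minimum is 0 and the
    minimizer solves the equations too. Feasibility is asked of every solution because the bounds of
    the triangular system are stated for solutions. *)
Let exact_solution J w : (0 < J)%N -> avg fA J w \in unitmx -> avg fD J w \in unitmx ->
  (forall x y, avg fA J w *m x = avg fb J w -> avg fD J w *m y = avg fc J w - avg fC J w *m x ->
     Theta (col_mx (beta0 + x) (alpha0 + y))) ->
  avg fA J w *m (betahat J w - beta0) = avg fb J w /\
  avg fD J w *m (alphahat J w - alpha0) = avg fc J w - avg fC J w *m (betahat J w - beta0).
Proof.
move=> J0 unA unD inTheta.
pose x := invmx (avg fA J w) *m avg fb J w.
pose y := invmx (avg fD J w) *m (avg fc J w - avg fC J w *m x).
have Ax : avg fA J w *m x = avg fb J w by rewrite mulKVmx.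
have Dy : avg fD J w *m y = avg fc J w - avg fC J w *m x by rewrite mulKVmx.
have := hat_min w J0 (inTheta x y Ax Dy).
rewrite /linear_objective !avg_linear_moment [beta0 + x]addrC [alpha0 + y]addrC !addrK Ax Dy !subrr col_mx0.
have -> : sqnorm (0 : 'cV[R]_(K + L)) = 0 by rewrite /sqnorm dotvE big1// => i _; rewrite mxE mul0r.
move=> /sqnorm0; rewrite -col_mx0 => /eq_col_mx[/eqP + /eqP].
by rewrite !subr_eq0 => /eqP -> /eqP ->.
Qed.

Let h s : 'cV[R]_L := invmx D0 *m (fc s - C0 *m (invmx A0 *m fb s)).

Let std_h J w : std h J w = invmx D0 *m (std fc J w - C0 *m (invmx A0 *m std fb J w)).
Proof.
rewrite /std -!scalemxAr -scalerBr -scalemxAr; congr (_ *: _).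
by rewrite !mulmx_sumr -sumrB mulmx_sumr.
Qed.

Let gmm_asymptotically_linear e eta : 0 < e -> 0 < eta -> pnear P e (fun J w =>
  mxl1 (Num.sqrt J%:R *: (alphahat J w - alpha0) - std h J w) <= eta).
Proof.
move=> e0 eta0.
(* Five exceptional events: two for normalized sums, three for averages of blocks. *)
have e4 : 0 < e / 5 by rewrite divr_gt0.
have [M1 M10 HM1] := partial_sum_bounded_mx mW iidW mb ib Eb e4.
have [M2 M20 HM2] := partial_sum_bounded_mx mW iidW mc ic Ec e4.
pose M := M1 + M2; have M0 : 0 < M by rewrite addr_gt0.
pose a := mxl1 (invmx A0); pose q := mxl1 (invmx D0).
have a0 : 0 <= a := mxl1_ge0 _; have q0 : 0 <= q := mxl1_ge0 _.
(* [kap^-1] meets four demands on [del] at once: [del <= 1], [a * del] and [q * del] at most 1/2,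
   and a final error [del * M * triangular_gain A0 C0 D0] of at most [eta]. *)
pose kap := 1 + 2 * a + 2 * q + M * triangular_gain A0 C0 D0 / eta.
have g0 : 0 <= triangular_gain A0 C0 D0 by exact: triangular_gain_ge0.
have k1 : 1 <= kap.
  by rewrite /kap -!addrA lerDl !addr_ge0 ?mulr_ge0 ?invr_ge0 ?(ltW M0) ?(ltW eta0).
have k0 : 0 < kap by rewrite (lt_le_trans _ k1).
pose del := kap^-1; have del0 : 0 < del by rewrite invr_gt0.
have h1 : del <= 1 by rewrite invf_le1.
have mg0 : 0 <= M * triangular_gain A0 C0 D0 / eta.
  by rewrite !mulr_ge0 ?invr_ge0 ?(ltW M0) ?(ltW eta0).
have h2 : a * del <= 2^-1 by rewrite ler_pdivrMr// -ler_pdivrMl ?invr_gt0// invrK /kap; lra.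
have h3 : q * del <= 2^-1 by rewrite ler_pdivrMr// -ler_pdivrMl ?invr_gt0// invrK /kap; lra.
have h4 : del * M * triangular_gain A0 C0 D0 <= eta.
  rewrite -mulrA mulrC ler_pdivrMr// -ler_pdivrMl// mulrC /kap; lra.
have [r r0 hr] := interior_ball.
have E : e / 5 + e / 5 + e / 5 + e / 5 + e / 5 = e by field.
have LA := lln_mx mW iidW mA iA EA e4 del0.
have LC := lln_mx mW iidW mC iC EC e4 del0.
have LD := lln_mx mW iidW mD iD ED e4 del0.
rewrite -E; apply: pnear_sub (pnear_and (pnear_and (pnear_and (pnear_and HM1 HM2) LA) LC) LD).
have lim : triangular_bound A0 C0 D0 * M * (Num.sqrt J%:R)^-1 @[J --> \oo] --> (0 : R).
  apply: (@cvg_bound_invsqrt _ _ _ (triangular_bound A0 C0 D0 * M)) => J J0.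
  have t0 : 0 < triangular_bound A0 C0 D0 by exact: triangular_bound_gt0.
  by rewrite subr0 ger0_norm// !mulr_ge0 ?invr_ge0 ?sqrtr_ge0 ?(ltW M0) ?(ltW t0).
(* Solutions of the sample equations are within this distance of the truth, hence eventually in the
   ball contained in [Theta]. *)
have lim' : \forall J \near \oo, triangular_bound A0 C0 D0 * M * (Num.sqrt J%:R)^-1 < r.
  exact: (cvgr_lt _ lim).
near=> J => w [[[[b1 b2] bA] bC] bD].
have J0 : (0 < J)%N by near: J; exact: nbhs_infty_gt.
have J1 : 0 < (J%:R : R) by rewrite ltr0n.
have sJ : 0 < Num.sqrt (J%:R : R) by rewrite sqrtr_gt0.
have avg_std m n (F : S -> 'M[R]_(m, n)) : Num.sqrt J%:R *: avg F J w = std F J w.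
  rewrite /avg/std scalerA; congr (_ *: _); rewrite -{2}(@sqr_sqrtr _ (J%:R : R)) ?ler0n//.
  by rewrite expr2 invfM mulVKf// gt_eqF.
have bM1 : mxl1 (std fb J w) <= M by apply: (le_trans b1); rewrite lerDl ltW.
have bM2 : mxl1 (std fc J w) <= M by apply: (le_trans b2); rewrite lerDr ltW.
have [unA unD] := triangular_unitmx uA uD h2 h3 bA bD.
(* Scaling by [sqrt J] leaves the matrices alone and turns the averages on the right into normalized
   sums, so the same bounds serve the candidate solution first and the estimator afterwards. *)
have scale_sys (x : 'cV[R]_K) (y : 'cV[R]_L) : avg fA J w *m x = avg fb J w -> avg fD J w *m y = avg fc J w - avg fC J w *m x ->
    avg fA J w *m (Num.sqrt J%:R *: x) = std fb J w /\
    avg fD J w *m (Num.sqrt J%:R *: y) = std fc J w - avg fC J w *m (Num.sqrt J%:R *: x).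
  by move=> h5 h6; rewrite -!scalemxAr h5 h6 scalerBr !avg_std.
have [ex1 ex2] : avg fA J w *m (betahat J w - beta0) = avg fb J w /\
  avg fD J w *m (alphahat J w - alpha0) = avg fc J w - avg fC J w *m (betahat J w - beta0).
  apply: exact_solution => // x y h5 h6; apply: hr.
  have [h7 h8] := scale_sys _ _ h5 h6.
  have := triangular_le uA uD h1 h2 h3 bA bC bD bM1 bM2 h7 h8.
  rewrite !mxl1Z -mulrDr ger0_norm ?(ltW sJ)// mulrC -ler_pdivlMr// => h9.
  apply: (le_lt_trans h9); near: J; exact: lim'.
have [h7 h8] := scale_sys _ _ ex1 ex2.
rewrite std_h; apply: le_trans h4.
exact: (triangular_dist uA uD h1 h2 h3 bA bC bD bM1 bM2 h7 h8).
Unshelve. all: by end_near. Qed.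

Lemma linear_gmm_asymptotic_normality (G : 'M[R]_L) :
  (forall i k, mean P (fun w =>
     (fc (W 0 w) - C0 *m (invmx A0 *m fb (W 0 w))) i 0 *
     (fc (W 0 w) - C0 *m (invmx A0 *m fb (W 0 w))) k 0) = G i k) ->
  cvg_in_law_normal P (fun J w => Num.sqrt J%:R *: (alphahat J w - alpha0)) 0
    (invmx D0 *m G *m (invmx D0)^T).
Proof.
move=> hG.
have mh' : random_mx (fun s => fc s - C0 *m (invmx A0 *m fb s)).
  by apply: random_mxB => //; apply: random_mxM; [exact: random_mx_cst|apply: random_mxM => //; exact: random_mx_cst].
have mAb : random_mx (fun s => invmx A0 *m fb s) by apply: random_mxM => //; exact: random_mx_cst.
have mCAb : random_mx (fun s => C0 *m (invmx A0 *m fb s)) by apply: random_mxM => //; exact: random_mx_cst.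
have iAb : square_integrable P W (fun s => invmx A0 *m fb s) by exact: square_integrableMl.
have iCAb : square_integrable P W (fun s => C0 *m (invmx A0 *m fb s)) by exact: square_integrableMl.
have ih' : square_integrable P W (fun s => fc s - C0 *m (invmx A0 *m fb s)) by exact: square_integrableB.
have Eh' : has_mean P W (fun s => fc s - C0 *m (invmx A0 *m fb s)) 0.
  have -> : (0 : 'cV[R]_L) = 0 - C0 *m (invmx A0 *m (0 : 'cV[R]_K)) by rewrite !mulmx0 subr0.
  by apply: has_meanB => //; apply: has_meanMl => //; exact: has_meanMl.
apply: (clt_asymptotically_linear mW iidW (h := h)).
- by apply: random_mxM => //; exact: random_mx_cst.
- exact: square_integrableMl.
- have -> : (0 : 'cV[R]_L) = invmx D0 *m (0 : 'cV[R]_L) by rewrite mulmx0.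
  exact: has_meanMl.
- move=> i k; exact: (second_moment_mulmx mW (invmx D0) mh' ih' hG).
- move=> J i k; rewrite (_ : (fun w => _) = (fun w => Num.sqrt J%:R * (alphahat J w i k - alpha0 i k))).
    by apply: measurable_funM => //; apply: measurable_funB => //; exact: mhat.
  by apply/funext => w; rewrite !mxE.
- exact: gmm_asymptotically_linear.
Qed.

End LinearGmm.

(** * Teacher panels *)

Section TeacherYearMatrices.
Variables (R : realType) (T : nat).

(** As left multiplication by the centering matrix, the operation inherits additivity, compatibility
    with right multiplication and measurability. *)
Lemma ddotE K (M : 'M[R]_(T, K)) : ddot M = (1%:M - const_mx T%:R^-1) *m M.
Proof.
rewrite mulmxBl mul1mx; apply/matrixP => t k; rewrite !mxE mulr_sumr; congr (_ - _).
by apply: eq_bigr => s _; rewrite mxE.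
Qed.

Lemma ddotD K (M N : 'M[R]_(T, K)) : ddot (M + N) = ddot M + ddot N.
Proof. by rewrite !ddotE mulmxDr. Qed.

Lemma ddotM K L (M : 'M[R]_(T, K)) (N : 'M[R]_(K, L)) : ddot (M *m N) = ddot M *m N.
Proof. by rewrite !ddotE mulmxA. Qed.

Lemma class_avgD n (f g : 'I_n -> R) : class_avg (fun i => f i + g i) = class_avg f + class_avg g.
Proof. by rewrite /class_avg big_split mulrDr. Qed.

Lemma class_avg_cst n (x : R) : (0 < n)%N -> class_avg (fun _ : 'I_n => x) = x.
Proof.
by move=> n0; rewrite /class_avg sumr_const card_ord -[x *+ n]mulr_natl mulKf// pnatr_eq0 -lt0n.
Qed.

Lemma class_avg_dotv K n (h : 'I_n -> 'cV[R]_K) (v : 'cV[R]_K) :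
  class_avg (fun i => dotv (h i) v) = \sum_k class_avg (fun i => h i k 0) * v k 0.
Proof.
rewrite /class_avg; under eq_bigr do rewrite dotvE.
rewrite exchange_big mulr_sumr; apply: eq_bigr => k _.
by rewrite -mulrA mulr_suml.
Qed.

Lemma measurable_class_avg d (Omega : measurableType d) n (h : 'I_n -> Omega -> R) :
  (forall i, measurable_fun setT (h i)) -> measurable_fun setT (fun w => class_avg (fun i => h i w)).
Proof. by move=> mh; apply: measurable_funM => //; exact: measurable_sum. Qed.

Lemma m1_linear K (X : 'M[R]_(T, K)) (r : 'cV[R]_T) (beta0 beta : 'cV[R]_K) :
  m1 X (X *m beta0 + r) beta = (ddot X)^T *m ddot r - (ddot X)^T *m ddot X *m (beta - beta0).
Proof.
rewrite /m1 ddotD ddotM -mulmxA -mulmxBr; congr (_ *m _).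
by rewrite mulmxBr opprB addrAC addrC.
Qed.

Lemma m4_linear K L (X : 'M[R]_(T, K)) (D : 'M[R]_(T, L)) (r : 'cV[R]_T)
    (beta0 beta : 'cV[R]_K) (alpha0 alpha : 'cV[R]_L) :
  m4 X (X *m beta0 + r) D beta alpha =
    D^T *m (r - D *m alpha0) - D^T *m X *m (beta - beta0) - D^T *m D *m (alpha - alpha0).
Proof.
rewrite /m4 -!mulmxA -!mulmxBr; congr (_ *m _).
rewrite !mulmxBr; set a := X *m _; set b := X *m _; set c := D *m _; set e := D *m _.
by apply/matrixP => i k; rewrite !mxE; ring.
Qed.

End TeacherYearMatrices.

Section RandomBlocks.
Context (d : measure_display) (T : measurableType d) (R : realType).

Lemma random_row_mx m n1 n2 (F : T -> 'M[R]_(m, n1)) (G : T -> 'M[R]_(m, n2)) :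
  random_mx F -> random_mx G -> random_mx (fun s => row_mx (F s) (G s)).
Proof.
move=> mF mG i k; rewrite -(splitK k); case: (fintype.split k) => l /=.
  by rewrite (_ : (fun s => _) = (fun s => F s i l))//; apply/funext => s; rewrite row_mxEl.
by rewrite (_ : (fun s => _) = (fun s => G s i l))//; apply/funext => s; rewrite row_mxEr.
Qed.

Lemma random_lsubmx m n1 n2 (F : T -> 'M[R]_(m, n1 + n2)) : random_mx F -> random_mx (fun s => lsubmx (F s)).
Proof.
by move=> mF i k; rewrite (_ : (fun s => _) = (fun s => F s i (lshift n2 k)))//; apply/funext => s; rewrite mxE.
Qed.

Lemma random_rsubmx m n1 n2 (F : T -> 'M[R]_(m, n1 + n2)) : random_mx F -> random_mx (fun s => rsubmx (F s)).
Proof.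
by move=> mF i k; rewrite (_ : (fun s => _) = (fun s => F s i (rshift n1 k)))//; apply/funext => s; rewrite mxE.
Qed.

Lemma random_ddot n K (F : T -> 'M[R]_(n, K)) : random_mx F -> random_mx (fun s => ddot (F s)).
Proof.
move=> mF; under eq_fun do rewrite ddotE.
by apply: random_mxM => //; exact: random_mx_cst.
Qed.

End RandomBlocks.

Lemma EmxE (d : measure_display) (Omega : measurableType d) (R : realType)
    (P : probability Omega R) m n (F : Omega -> 'M[R]_(m, n)) i k :
  Emx P F i k = mean P (fun w => F w i k).
Proof. by rewrite mxE -meanE. Qed.

Section IdenticalMoments.
Context (d : measure_display) (Omega : measurableType d) (R : realType).
Context (d' : measure_display) (S : measurableType d').
Variables (P : probability Omega R) (W : nat -> Omega -> S).
Hypothesis mW : forall j, measurable_fun setT (W j).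
Hypothesis iidW : iid P W.

Lemma has_mean_Emx m n (F : S -> 'M[R]_(m, n)) j : random_mx F -> square_integrable P W F ->
  has_mean P W F (Emx P (fun w => F (W j w))).
Proof.
move=> mF iF k a b; rewrite EmxE.
by apply: (mean_identically_distributed mW iidW (mF a b)); exact: (square_integrable_entry mW).
Qed.

(** Column [b] of [F] is its product with the basis vector [delta_mx b 0]. *)
Lemma square_integrable_mulmx m n (F : S -> 'M[R]_(m, n)) :
  (forall v : 'cV[R]_n, square_integrable P W (fun s => F s *m v)) -> square_integrable P W F.
Proof.
move=> iF j a b; move: (iF (delta_mx b 0) j a 0).
by under eq_fun do rewrite -colE mxE.
Qed.

(** The diagonal of the outer product consists of the squared entries. *)
Lemma square_integrable_outer n (F : S -> 'cV[R]_n) :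
  (forall j, finite_mean P (fun w => F (W j w) *m (F (W j w))^T)) -> square_integrable P W F.
Proof.
move=> iF j a b; move: (iF j a a); rewrite (ord1 b).
by apply: eq_integrable => // w _; rewrite /= mxE big_ord1 mxE expr2.
Qed.

End IdenticalMoments.

Unset Implicit Arguments.
Set Strict Implicit.

Theorem theorem3
  (R : realType) (d : measure_display) (Omega : measurableType d)
  (P : probability Omega R)
  (T K KD : nat) (n : nat -> nat)
  (X : forall j : nat, 'I_T -> 'I_(n j) -> Omega -> 'cV[R]_K)
  (mu : nat -> 'I_T -> Omega -> R)
  (eps eta Robs Yobs : forall j : nat, 'I_T -> 'I_(n j) -> Omega -> R)
  (D : nat -> 'I_T -> Omega -> 'cV[R]_KD)
  (beta0 betaY0 : 'cV[R]_K) (kappa0 : R) (alpha0 : 'cV[R]_KD)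
  (phi0 : (T.-1).-tuple R)
  (Theta2 : set 'cV[R]_(K + KD))
  (betahat : nat -> Omega -> 'cV[R]_K)
  (alphahat : nat -> Omega -> 'cV[R]_KD) :
  let Xj j w := avg_mx (fun t i => X j t i w) in
  let muj j w : 'cV[R]_T := \col_t mu j t w in
  let epsj j w := avg_col (fun t i => eps j t i w) in
  let etaj j w := avg_col (fun t i => eta j t i w) in
  let Robsj j w := avg_col (fun t i => Robs j t i w) in
  let Dj j w := rows_mx (fun t => D j t w) in
  let Rj j w := Robsj j w - Xj j w *m beta0 in
  let zetaj j w := muj j w - Dj j w *m alpha0 in
  let mustar j t w := leave_out phi0 (Rj j w) t in
  let m1j j beta w := m1 (Xj j w) (Robsj j w) beta in
  let m4j j beta alpha w := m4 (Xj j w) (Robsj j w) (Dj j w) beta alpha in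
  let objective J w beta alpha :=
    gmm_objective J (fun j => Xj j w) (fun j => Robsj j w) (fun j => Dj j w)
      beta alpha in
  forall
  (T_ge2 : (2 <= T)%N)
  (n_gt0 : forall j, (0 < n j)%N)
  (X_random : forall j t i, random_mx (X j t i))
  (mu_random : forall j t, measurable_fun setT (mu j t))
  (eps_random : forall j t i, measurable_fun setT (eps j t i))
  (eta_random : forall j t i, measurable_fun setT (eta j t i))
  (D_random : forall j t, random_mx (D j t))
  (Robs_model : forall j t i w,
     Robs j t i w = dotv (X j t i w) beta0 + mu j t w + eps j t i w)
  (Yobs_model : forall j t i w,
     Yobs j t i w = dotv (X j t i w) betaY0 + kappa0 * mu j t w + eta j t i w)
  (mu_mean : forall j t, ('E_P[mu j t] = 0)%E)
  (mu_L2 : forall j t, mu j t \in Lfun P 2%:E)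
  (mu_stationary : forall j t s t' s', lag s t = lag s' t' ->
     correlation P (mu j t) (mu j s) = correlation P (mu j t') (mu j s'))
  (phi0_def : is_unique_mse_minimizer P Rj phi0)
  (alpha0_def : forall j, mean_zero P (fun w => (Dj j w)^T *m zetaj j w))
  (hyp1a : forall j t i,
     is_cond_expectation_vec P (muj j) (eps j t i) (cst 0) /\
     ('E_P[eps j t i] = 0)%E)
  (hyp1b : forall j t s i, s != t ->
     is_cond_expectation P (mu j s) (eta j t i) (cst 0))
  (hyp1c : forall j t s, s != t ->
     independent_pair P (fun w => (epsj j w t 0, etaj j w t 0))
                        (fun w => (epsj j w s 0, etaj j w s 0)))
  (hyp2a : forall j,
     finite_invertible_mean P (fun w => (ddot (Xj j w))^T *m ddot (Xj j w)))
  (hyp2b : forall j t, (0 < 'V_P[mustar j t] < +oo)%E)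
  (hyp2c : forall j,
     [/\ mean_zero P (fun w => (ddot (Xj j w))^T *m ddot (muj j w)),
         mean_zero P (fun w => (ddot (Xj j w))^T *m ddot (epsj j w)) &
         mean_zero P (fun w => (ddot (Xj j w))^T *m ddot (etaj j w))])
  (hyp5a : forall j,
     finite_invertible_mean P (fun w => (Dj j w)^T *m Dj j w))
  (hyp5b : forall j, mean_zero P (fun w => (Dj j w)^T *m epsj j w))
  (hyp6a : compact Theta2 /\ (interior Theta2) (col_mx beta0 alpha0))
  (hyp6b : forall j,
     (\int[P]_w ereal_sup [set (sqnorm (m1j j (usubmx th) w))%:E
                          | th in Theta2] < +oo)%E /\
     (\int[P]_w ereal_sup [set (sqnorm (m4j j (usubmx th) (dsubmx th) w))%:E
                          | th in Theta2] < +oo)%E)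
  (hyp6c : iid_mx P (fun j w =>
     row_mx (Xj j w) (row_mx (muj j w) (row_mx (epsj j w) (Dj j w)))))
  (hyp6d : forall j beta alpha,
     finite_mean P (fun w => m1j j beta w *m (m1j j beta w)^T) /\
     finite_mean P (fun w => m4j j beta alpha w *m (m4j j beta alpha w)^T))
  (hat_random : forall J, random_mx (betahat J) /\ random_mx (alphahat J))
  (hat_gmm : forall J w, (0 < J)%N ->
     Theta2 (col_mx (betahat J w) (alphahat J w)) /\
     forall beta alpha, Theta2 (col_mx beta alpha) ->
       objective J w (betahat J w) (alphahat J w) <= objective J w beta alpha),
  forall j : nat,
  let EDD := Emx P (fun w => (Dj j w)^T *m Dj j w) in
  let EDX := Emx P (fun w => (Dj j w)^T *m Xj j w) in
  let EXX := Emx P (fun w => (ddot (Xj j w))^T *m ddot (Xj j w)) in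
  let Gamma w :=
    (Dj j w)^T *m (Rj j w - Dj j w *m alpha0)
    - EDX *m invmx EXX *m (ddot (Xj j w))^T
        *m (ddot (Robsj j w) - ddot (Xj j w) *m beta0) in
  let V1 := invmx EDD *m Emx P (fun w => Gamma w *m (Gamma w)^T)
              *m (invmx EDD)^T in
  cvg_in_law_normal P
    (fun J w => Num.sqrt J%:R *: (alphahat J w - alpha0)) 0 V1.
Proof.
move=> Xj muj epsj etaj Robsj Dj Rj zetaj mustar m1j m4j objective.
move=> _ n_gt0 mX mmu meps _ mD RobsE _ _ _ _ _ alpha0_def _ _ _ hyp2a _ hyp2c hyp5a hyp5b [_ intTheta] _ iidW hyp6d mhat hat_gmm j0 EDD EDX EXX Gamma V1.
pose S := borel_mx R T (K + (1 + (1 + KD))).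
(* One measurable i.i.d. sequence carries the data: the moments and [Gamma] are fixed functions of
   [W j w], recovered by projections onto the blocks. Class sizes may vary with [j], but the class
   averages live in one space. *)
pose W (j : nat) (w : Omega) : S := row_mx (Xj j w) (row_mx (muj j w) (row_mx (epsj j w) (Dj j w))).
have mXj j : random_mx (Xj j).
  move=> t k; rewrite (_ : (fun w => _) = (fun w => class_avg (fun i => X j t i w k 0))).
    by apply: measurable_class_avg => i; exact: mX.
  by apply/funext => w; rewrite mxE.
have mmuj j : random_mx (muj j).
  by move=> t k; rewrite (_ : (fun w => _) = mu j t)//; apply/funext => w; rewrite mxE.
have mepsj j : random_mx (epsj j).
  move=> t k; rewrite (_ : (fun w => _) = (fun w => class_avg (fun i => eps j t i w))).
    exact: measurable_class_avg.
  by apply/funext => w; rewrite mxE.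
have mDj j : random_mx (Dj j).
  move=> t k; rewrite (_ : (fun w => _) = (fun w => D j t w k 0)); first exact: mD.
  by apply/funext => w; rewrite mxE.
have mW j : measurable_fun setT (W j : Omega -> S).
  by apply: random_mx_measurable; do 3! apply: random_row_mx => //.
pose pX (s : S) : 'M[R]_(T, K) := lsubmx s.
pose pmu (s : S) : 'cV[R]_T := lsubmx (rsubmx s).
pose peps (s : S) : 'cV[R]_T := lsubmx (rsubmx (rsubmx s)).
pose pD (s : S) : 'M[R]_(T, KD) := rsubmx (rsubmx (rsubmx s)).
pose pr s := pmu s + peps s.
have pXE j w : pX (W j w) = Xj j w by rewrite /pX row_mxKl.
have pmuE j w : pmu (W j w) = muj j w by rewrite /pmu row_mxKr row_mxKl.
have pepsE j w : peps (W j w) = epsj j w by rewrite /peps 2!row_mxKr row_mxKl.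
have pDE j w : pD (W j w) = Dj j w by rewrite /pD 3!row_mxKr.
have mS : random_mx (fun s : S => s : 'M[R]_(T, K + (1 + (1 + KD)))) by move=> i k; exact: measurable_entry.
have mpX : random_mx pX by exact: random_lsubmx.
have mpmu : random_mx pmu by apply: random_lsubmx; exact: random_rsubmx.
have mpeps : random_mx peps by apply: random_lsubmx; do 2! apply: random_rsubmx.
have mpD : random_mx pD by do 3! apply: random_rsubmx.
have mpr : random_mx pr by exact: random_mxD.
pose fA s := (ddot (pX s))^T *m ddot (pX s).
pose fb s := (ddot (pX s))^T *m ddot (pr s).
pose fC s := (pD s)^T *m pX s.
pose fD s := (pD s)^T *m pD s.
pose fc s := (pD s)^T *m (pr s - pD s *m alpha0).
have mfA : random_mx fA by apply: random_mxM; [apply: random_mx_tr|]; exact: random_ddot.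
have mfb : random_mx fb by apply: random_mxM; [apply: random_mx_tr|]; exact: random_ddot.
have mfC : random_mx fC by apply: random_mxM => //; exact: random_mx_tr.
have mfD : random_mx fD by apply: random_mxM => //; exact: random_mx_tr.
have mfc : random_mx fc.
  apply: random_mxM; first exact: random_mx_tr.
  by apply: random_mxB => //; apply: random_mxM => //; exact: random_mx_cst.
(* Averaging over a nonempty class leaves [mu] unchanged, so the averaged residual is [pr]. *)
have RobsjE j w : Robsj j w = Xj j w *m beta0 + pr (W j w).
  rewrite /pr pmuE pepsE; apply/matrixP => t k; rewrite (ord1 k) !mxE.
  under [X in class_avg X]eq_fun do rewrite RobsE -addrA.
  rewrite !class_avgD class_avg_cst// class_avg_dotv; congr (_ + _).
  by apply: eq_bigr => l _; rewrite mxE.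
have m1E j beta w : m1j j beta w = fb (W j w) - fA (W j w) *m (beta - beta0).
  by rewrite /m1j RobsjE m1_linear /fb /fA pXE.
have m4E j beta alpha w : m4j j beta alpha w =
    fc (W j w) - fC (W j w) *m (beta - beta0) - fD (W j w) *m (alpha - alpha0).
  by rewrite /m4j RobsjE (m4_linear _ _ _ _ _ alpha0) /fc /fC /fD pXE pDE.
have im1 beta : square_integrable P W (fun s => fb s - fA s *m (beta - beta0)).
  apply: square_integrable_outer => j; have := (hyp6d j beta alpha0).1.
  by under eq_fun do rewrite m1E.
have im4 beta alpha : square_integrable P W (fun s =>
    fc s - fC s *m (beta - beta0) - fD s *m (alpha - alpha0)).
  apply: square_integrable_outer => j; have := (hyp6d j beta alpha).2.
  by under eq_fun do rewrite m4E.
have mMr m (F : S -> 'M[R]_(m, K)) v : random_mx F -> random_mx (fun s => F s *m (v : 'cV[R]_K)).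
  by move=> mF; apply: random_mxM => //; exact: random_mx_cst.
have mMr' m (F : S -> 'M[R]_(m, KD)) v : random_mx F -> random_mx (fun s => F s *m (v : 'cV[R]_KD)).
  by move=> mF; apply: random_mxM => //; exact: random_mx_cst.
have ifb : square_integrable P W fb.
  by have := im1 beta0; under eq_fun do rewrite subrr mulmx0 subr0.
have ifc : square_integrable P W fc.
  by have := im4 beta0 alpha0; under eq_fun do rewrite !subrr !mulmx0 !subr0.
(* The moment is affine in the parameter: its values at [beta0] and at [v + beta0] differ by
   [fA s *m v], and both are square integrable because second moments are finite at all parameters.
   The blocks [fC] and [fD] are isolated in the same way. *)
have ifA : square_integrable P W fA.
  apply: square_integrable_mulmx => v; rewrite (_ : (fun s => _) =
    (fun s => fb s - (fb s - fA s *m (v + beta0 - beta0)))).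
    by apply: square_integrableB => //; apply: random_mxB => //; exact: mMr.
  by apply/funext => s; rewrite addrK subKr.
have ifC : square_integrable P W fC.
  apply: square_integrable_mulmx => v; rewrite (_ : (fun s => _) =
    (fun s => fc s - (fc s - fC s *m (v + beta0 - beta0) - fD s *m (alpha0 - alpha0)))).
    by apply: square_integrableB => //; apply: random_mxB; [apply: random_mxB => //; exact: mMr|exact: mMr'].
  by apply/funext => s; rewrite addrK subrr mulmx0 subr0 subKr.
have ifD : square_integrable P W fD.
  apply: square_integrable_mulmx => v; rewrite (_ : (fun s => _) =
    (fun s => fc s - (fc s - fC s *m (beta0 - beta0) - fD s *m (v + alpha0 - alpha0)))).
    by apply: square_integrableB => //; apply: random_mxB; [apply: random_mxB => //; exact: mMr|exact: mMr'].
  by apply/funext => s; rewrite addrK subrr mulmx0 subr0 subKr.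
(* Identical distribution makes the expectation at [j0] the expectation at every index. *)
have EA : has_mean P W fA EXX.
  have := has_mean_Emx mW iidW j0 mfA ifA.
  by rewrite (_ : Emx _ _ = EXX)//; congr (Emx P _); apply/funext => w; rewrite /fA pXE.
have EC : has_mean P W fC EDX.
  have := has_mean_Emx mW iidW j0 mfC ifC.
  by rewrite (_ : Emx _ _ = EDX)//; congr (Emx P _); apply/funext => w; rewrite /fC pXE pDE.
have ED : has_mean P W fD EDD.
  have := has_mean_Emx mW iidW j0 mfD ifD.
  by rewrite (_ : Emx _ _ = EDD)//; congr (Emx P _); apply/funext => w; rewrite /fD pDE.
have mean0D m n' (F G : Omega -> 'M[R]_(m, n')) : mean_zero P F -> mean_zero P G ->
    forall i k, mean P (fun w => (F w + G w) i k) = 0.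
  move=> [iF F0] [iG G0] i k; under eq_fun do rewrite mxE.
  rewrite meanD//; [|exact: iF|exact: iG].
  by rewrite -!EmxE F0 G0 mxE addr0.
have Eb : has_mean P W fb 0.
  move=> j i k; have [h1 h2 _] := hyp2c j.
  rewrite mxE -(mean0D _ _ _ _ h1 h2 i k); congr (mean P _); apply/funext => w.
  by rewrite /fb /pr ddotD pXE pmuE pepsE mulmxDr.
(* As [pr] is the sum of [mu] and [eps], the moment splits into the projection error [zetaj] and
   [epsj], both orthogonal to [Dj]. *)
have Ec : has_mean P W fc 0.
  move=> j i k; rewrite mxE -(mean0D _ _ _ _ (alpha0_def j) (hyp5b j) i k).
  congr (mean P _); apply/funext => w.
  by rewrite /fc /pr pDE pmuE pepsE -mulmxDr /zetaj addrAC.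
pose fG s := fc s - EDX *m (invmx EXX *m fb s).
have GammaE w : Gamma w = fG (W j0 w).
  rewrite /Gamma /fG /fc /fb /Rj RobsjE pDE pXE -!mulmxA ddotD ddotM.
  by rewrite ![_ *m beta0 + _]addrC !addrK.
have mfG : random_mx fG.
  apply: random_mxB => //; do 2! (apply: random_mxM; first exact: random_mx_cst).
  exact: mfb.
have mAb : random_mx (fun s => invmx EXX *m fb s) by apply: random_mxM => //; exact: random_mx_cst.
have ifG : square_integrable P W fG.
  apply: square_integrableB => //; last by do 2! apply: square_integrableMl => //.
  by apply: random_mxM => //; exact: random_mx_cst.
apply: (linear_gmm_asymptotic_normality mW iidW mfA mfb mfC mfD mfc ifA ifb ifC ifD ifc
  EA Eb EC ED Ec (hyp2a j0).2 (hyp5a j0).2 intTheta (betahat := betahat)).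
- move=> J w J0 beta alpha Th; have := (hat_gmm J w J0).2 beta alpha Th.
  have objE b a : objective J w b a = linear_objective W fA fb fC fD fc beta0 alpha0 J w b a.
    rewrite /objective /gmm_objective /linear_objective; congr (sqnorm (_ *: _)).
    by apply: eq_bigr => j _; rewrite /linear_moment -m1E -m4E.
  by rewrite !objE.
- by move=> J; have [] := mhat J.
(* The variance is taken at [j0] in the conclusion and at index 0 in the limit theorem; identical
   distribution reconciles the two. *)
- move=> i k; rewrite EmxE.
  have ip j : integrable_rv P (fun w => fG (W j w) i 0 * fG (W j w) k 0).
    by apply: integrable_sq_prod => //; exact: random_mx_entry.
  transitivity (mean P (fun w => fG (W j0 w) i 0 * fG (W j0 w) k 0)).
    apply: (mean_identically_distributed mW iidW (g := fun s => fG s i 0 * fG s k 0)) => //.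
    by apply: measurable_funM; [exact: mfG|exact: mfG].
  by congr (mean P _); apply/funext => w; rewrite GammaE [RHS]mxE big_ord1 [_^T _ _]mxE.
Qed.
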